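(* Suppose that the scattering filters are wavelet-generated according to $\Psi=\mathrm{Wav}(\psi,a,G,J)$. Moreover, assume that there exist $M_\psi\in O_d(\mathbb{R})$, $\rho\in[0,1)$, and $\kappa\in\mathbb{N}$, $\kappa\ge2$, such that $$\operatorname{supp}(\widehat\psi)\subseteq C^\rho_{M_\psi}\cap\mathcal{S}_{a^{-1},a^{\kappa-1}}.$$ Let $\alpha:=\sqrt{1-\frac{4a^\kappa}{(1+a^\kappa)^2}\cdot(1-\rho)^2}\in(0,1)$. If $\omega:(0,\infty)\to(0,\infty)$ is a weakly $t^2$-dominated weight, then we have, for all $f\in\mathcal{D}_\omega(\Psi;L^2(\mathbb{R}^d))$, $$W_N(f)\in\mathcal{O}(\omega^{-2}(\alpha^{-N})).$$ Specifically, the following convergence rates hold: a) If $f\in H^s(\mathbb{R}^d)$ for some $s>0$, then $W_N(f)\in\mathcal{O}(\alpha^{2\min\{s,1\}\cdot N})$. b) If $f\in H^s_{\log}(\mathbb{R}^d)$ for some $s>0$, then $W_N(f)\in\mathcal{O}(N^{-2s})$.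
   Context: Fix $d\in\mathbb{N}=\{1,2,\dots\}$. Fourier transform: $\widehat f(\xi)=\int_{\mathbb{R}^d}f(x)e^{-2\pi i\langle x,\xi\rangle}\,dx$. Wavelet-generated filters: let $a>1$ and let $G$ be a finite subgroup of $O_d(\mathbb{R})$ with $-I\in G$. A pair $(\psi,\phi)\in(L^1(\mathbb{R}^d)\cap L^2(\mathbb{R}^d))^2$ is admissible for $(a,G)$-wavelet scattering if $|\widehat\phi(\xi)|^2+\sum_{j=1}^\infty\sum_{M\in G}|\widehat\psi(a^{-j}M^{-1}\xi)|^2=1$ for a.e. $\xi\in\mathbb{R}^d$. For $J\in\mathbb{Z}$ let $\Lambda(a,G,J):=\{a^jM: j\in\mathbb{Z},\ j>-J,\ M\in G\}$; for $\lambda=a^jM\in\Lambda(a,G,J)$ let $\psi_\lambda:=a^{dj}\psi(a^jM^{-1}\,\cdot)$; let $\mathrm{Wav}(\psi,a,G,J):=\{\psi_\lambda:\lambda\in\Lambda(a,G,J)\}$ and $\phi_J:=a^{-dJ}\phi(a^{-J}\,\cdot)$. The filters $\Psi$ are wavelet-generated if $\Psi=\mathrm{Wav}(\psi,a,G,J)$ for some such $a,G,J$ and admissible pair $(\psi,\phi)$; the low-pass filter is then $\chi:=\phi_J$. Standing assumption: $\{\chi\}\cup\Psi$ is countably infinite and satisfies $|\widehat\chi(\xi)|^2+\sum_{\psi'\in\Psi}|\widehat{\psi'}(\xi)|^2=1$ for a.e. $\xi$, where each element of the set $\Psi$ is counted once (multiple occurrences of the same filter $\psi_\lambda$ for different $\lambda$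 are precluded). Energy remainder: for a path $p=(\psi_1,\dots,\psi_N)\in\Psi^N$ set $U[p]f:=|\dots||f*\psi_1|*\psi_2|\dots*\psi_N|$ (convolve, take the pointwise modulus, iterate); $W_N(f):=\sum_{p\in\Psi^N}\|U[p]f\|_2^2$. Geometry: $\nu^*\in\mathbb{R}^d$ is the vector with all entries $1/\sqrt d$; $C^\rho:=\{x\in\mathbb{R}_{\ge0}^d:\langle x,\nu^*\rangle\ge(1-\rho)\|x\|_2\}$; $C^\rho_A:=\{Ax:x\in C^\rho\}$ for $A\in O_d(\mathbb{R})$; $\mathcal{S}_{r,R}:=\{x\in\mathbb{R}^d:r\le\|x\|_2\le R\}$. Weights: for $k>0$, $\omega:(0,\infty)\to(0,\infty)$ is a weakly $t^k$-dominated weight if $\omega$ is nondecreasing and there exists $T>0$ such that $h_{k,\omega}(t):=t^k\omega^{-2}(t)$ is bounded on $(0,T)$, nondecreasing on $[T,\infty)$, and $\lim_{t\to\infty}h_{k,\omega}(t)=\infty$, where $\omega^{-2}(t)=1/\omega(t)^2$. For $\psi'\in\Psi$, $d_{\psi'}:=\inf_{\xi'\in\mathbb{R}^d}\sup_{\xi\in\operatorname{supp}(\widehat{\psi'})}\|\xi-\xi'\|_2$, and $\mathcal{D}_\omega(\Psi;L^2(\mathbb{R}^d)):=\{f\in L^2(\mathbb{R}^d):\sum_{\psi'\in\Psi}\omega^2(d_{\psi'})\|f*\psi'\|_2^2<\infty\}$. Sobolev spaces: $H^s(\mathbb{R}^d):=\{f\in L^2(\mathbb{R}^d):(1+\|\cdot\|_2^2)^{s/2}\widehat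 f\in L^2(\mathbb{R}^d)\}$ and $H^s_{\log}(\mathbb{R}^d):=\{f\in L^2(\mathbb{R}^d):\ln^s(e+\|\cdot\|_2)\widehat f\in L^2(\mathbb{R}^d)\}$. $W_N\in\mathcal{O}(E_N)$ means: there exist $C>0$, $N_0\in\mathbb{N}$ with $W_N\le CE_N$ for all $N\ge N_0$. *)

(* Defs.v *)
From HB Require Import structures.
From mathcomp Require Import all_boot all_order all_algebra.
From mathcomp Require Import all_classical all_reals all_analysis.
From mathcomp Require Import complex.

Set Implicit Arguments.
Unset Strict Implicit.
Unset Printing Implicit Defensive.

Import Order.TTheory GRing.Theory Num.Theory.
Import numFieldNormedType.Exports.

Local Open Scope classical_set_scope.
Local Open Scope ring_scope.
Local Open Scope complex_scope.

(* Vectors of R^d are column vectors. Their Borel sigma-algebra is generated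
   by the coordinates. *)
Section column_measurable.
Variables (R : realType) (n : nat).

Definition coordinates : 'I_n -> 'cV[R]_n -> R := fun i x => x i ord0.

Let cV_set0 : g_sigma_preimage coordinates set0.
Proof. exact: sigma_algebra0. Qed.

Let cV_setC A : g_sigma_preimage coordinates A ->
  g_sigma_preimage coordinates (~` A).
Proof. exact: sigma_algebraC. Qed.

Let cV_bigcup (F : (set 'cV[R]_n)^nat) :
  (forall i, g_sigma_preimage coordinates (F i)) ->
  g_sigma_preimage coordinates (\bigcup_i F i).
Proof. exact: sigma_algebra_bigcup. Qed.

HB.instance Definition _ := @isMeasurable.Build default_measure_display
  'cV[R]_n (g_sigma_preimage coordinates) cV_set0 cV_setC cV_bigcup.

End column_measurable.

Lemma measurable_coordinate (R : realType) n (i : 'I_n) :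
  measurable_fun [set: 'cV[R]_n] (coordinates i).
Proof.
move=> _ Y mY; rewrite setTI; apply: sub_sigma_algebra => /=.
rewrite -bigcup_seq/=; exists i => /=; first by rewrite mem_index_enum.
by exists Y => //; rewrite setTI.
Qed.

Lemma measurable_fun_cVP (R : realType) n d (T : measurableType d)
    (f : T -> 'cV[R]_n) :
  (forall i, measurable_fun [set: T] (fun t => f t i ord0)) ->
  measurable_fun [set: T] f.
Proof.
move=> mf.
suff : g_sigma_preimage (fun i => coordinates i \o f) `<=` measurable.
  rewrite g_sigma_preimage_comp => + _ A mA; apply.
  by exists A.
apply: smallest_sub; first exact: sigma_algebra_measurable.
case: n => [|n] in f mf *; first by rewrite big_ord0.
rewrite -bigcup_mkord_ord; apply: bigcup_sub => i Ii.
by move=> A [B mB <-]; exact: mf.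
Qed.

Definition cV_cons (R : realType) n (p : R * 'cV[R]_n) : 'cV[R]_n.+1 :=
  \col_i oapp (fun j => p.2 j ord0) p.1 (unlift ord0 i).

Definition cV_uncons (R : realType) n (x : 'cV[R]_n.+1) : R * 'cV[R]_n :=
  (x ord0 ord0, \col_i x (lift ord0 i) ord0).

Lemma cV_unconsK (R : realType) n : cancel (@cV_uncons R n) (@cV_cons R n).
Proof.
move=> x; apply/colP => i; rewrite mxE /=.
by case: unliftP => [j ->|->] //=; rewrite mxE.
Qed.

Lemma cV_consK (R : realType) n : cancel (@cV_cons R n) (@cV_uncons R n).
Proof.
move=> [a x]; rewrite /cV_uncons mxE unlift_none /=; congr pair.
by apply/colP => i; rewrite !mxE liftK.
Qed.

Lemma measurable_cV_cons (R : realType) n :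
  measurable_fun [set: measurableTypeR R * 'cV[R]_n] (@cV_cons R n).
Proof.
apply: measurable_fun_cVP => i; case: (unliftP ord0 i) => [j ->|->].
- rewrite (_ : (fun _ => _) = coordinates j \o snd); last first.
    by apply/funext => p /=; rewrite mxE liftK.
  by apply: measurableT_comp; [exact: measurable_coordinate|exact: measurable_snd].
- rewrite (_ : (fun _ => _) = fst); last first.
    by apply/funext => p /=; rewrite mxE unlift_none.
  exact: measurable_fst.
Qed.

Lemma measurable_cV_uncons (R : realType) n :
  measurable_fun [set: 'cV[R]_n.+1]
    (@cV_uncons R n : _ -> measurableTypeR R * 'cV[R]_n).
Proof.
apply: measurable_fun_pair; first exact: (measurable_coordinate ord0).
apply: measurable_fun_cVP => i.
rewrite (_ : (fun _ => _) = coordinates (lift ord0 i)).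
  exact: measurable_coordinate.
by apply/funext => x; rewrite mxE.
Qed.

Section lebesgue_step.
Variables (R : realType) (n : nat).
Variable mu : {sigma_finite_measure set 'cV[R]_n -> \bar R}.

Definition lebesgue_succ : set 'cV[R]_n.+1 -> \bar R :=
  pushforward (@lebesgue_measure R \x mu)%E (@cV_cons R n).

Let succ0 : lebesgue_succ set0 = 0%E.
Proof. by rewrite /lebesgue_succ /pushforward preimage_set0 measure0. Qed.

Let succ_ge0 A : (0 <= lebesgue_succ A)%E.
Proof. by rewrite /lebesgue_succ /pushforward; exact: measure_ge0. Qed.

Let succ_sigma_additive : semi_sigma_additive lebesgue_succ.
Proof.
move=> F mF tF mUF; rewrite /lebesgue_succ /pushforward preimage_bigcup.
have mpre A : measurable A -> measurable (@cV_cons R n @^-1` A).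
  by move=> mA; rewrite -[X in measurable X]setTI; exact: measurable_cV_cons.
apply: measure_semi_sigma_additive => [k||].
- exact: mpre.
- apply/trivIsetP => /= i j _ _ ij; rewrite -preimage_setI.
  by move/trivIsetP : tF => /(_ _ _ _ _ ij) ->//; rewrite preimage_set0.
- by rewrite -preimage_bigcup; exact: mpre.
Qed.

HB.instance Definition _ := isMeasure.Build _ _ _ lebesgue_succ
  succ0 succ_ge0 succ_sigma_additive.

Let succ_sigma_finite : sigma_finite setT lebesgue_succ.
Proof.
have [F FT mF] : sigma_finite setT (@lebesgue_measure R \x mu)%E.
  have /sigma_finiteP[F [TF ndF Foo]] := sigma_finiteT (@lebesgue_measure R).
  have /sigma_finiteP[G [TG ndG Goo]] := sigma_finiteT mu.
  exists (fun k => F k `*` G k).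
    rewrite -setXTT TF TG predeqE => -[x y]; split.
      move=> [/= [i _ Fix] [k _ Gky]]; exists (maxn i k) => //; split.
      - by move: x Fix; exact/subsetPset/ndF/leq_maxl.
      - by move: y Gky; exact/subsetPset/ndG/leq_maxr.
    by move=> [i _ []/= ? ?]; split; exists i.
  move=> k; have [? ?] := Foo k; have [? ?] := Goo k.
  split; first exact: measurableX.
  by rewrite product_measure1E// lte_mul_pinfty// ge0_fin_numE.
exists (fun k => @cV_uncons R n @^-1` F k) => [|k].
  by rewrite -preimage_bigcup -FT preimage_setT.
split.
  rewrite -[X in measurable X]setTI; apply: measurable_cV_uncons => //.
  exact: (mF k).1.
rewrite /lebesgue_succ /pushforward -comp_preimage.
rewrite (_ : _ \o _ = id) ?preimage_id; first exact: (mF k).2.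
by apply/funext => x /=; exact: cV_consK.
Qed.

HB.instance Definition _ := Measure_isSigmaFinite.Build _ _ _ lebesgue_succ
  succ_sigma_finite.

End lebesgue_step.

(* Lebesgue measure on R^n, as an iterated product of the Lebesgue measure on
   the line. *)
Fixpoint leb (R : realType) (n : nat) :
    {sigma_finite_measure set 'cV[R]_n -> \bar R} :=
  match n with
  | 0 => \d_(0 : 'cV[R]_0)
  | n'.+1 => lebesgue_succ (leb R n')
  end.

Lemma leb_box (R : realType) n (A : 'I_n -> set (measurableTypeR R)) :
  (forall i, measurable (A i)) ->
  leb R n [set x | forall i, A i (x i ord0)] =
  (\prod_(i < n) lebesgue_measure (A i))%E.
Proof.
elim: n A => [|n IH] A mA.
  by rewrite big_ord0 /= diracE mem_set// => -[].
have mB : measurable [set x : 'cV[R]_n | forall i, A (lift ord0 i) (x i ord0)].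
  rewrite [X in measurable X](_ : _ =
      \big[setI/setT]_i (coordinates i @^-1` A (lift ord0 i))); last first.
    rewrite -bigcap_seq; apply/seteqP; split=> x /= Ax i; first by move=> _; exact: Ax.
    by apply: Ax; rewrite /= mem_index_enum.
  apply: bigsetI_measurable => i _.
  rewrite -[X in measurable X]setTI.
  by apply: measurable_coordinate => //; exact: mA.
rewrite big_ord_recl -IH; last by move=> i; exact: mA.
rewrite /= /lebesgue_succ /pushforward -product_measure1E; [|exact: mA|exact: mB].
congr (_ _); apply/seteqP; split=> -[a x] /=.
- move=> Ax; split; first by have := Ax ord0; rewrite mxE unlift_none.
  by move=> i; have := Ax (lift ord0 i); rewrite mxE liftK.
- by move=> [Aa Ax] i; rewrite mxE /=; case: unliftP => [j ->|->] /=.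
Qed.

Section euclidean_geometry.
Variables (R : realType) (d : nat).
Implicit Types (x y : 'cV[R]_d) (A : 'M[R]_d).

Definition inner x y : R := \sum_(i < d) x i ord0 * y i ord0.

(* The library's norm on matrices is the sup norm. *)
Definition norm2 x : R := Num.sqrt (\sum_(i < d) x i ord0 ^+ 2).

Definition orthogonal_group : set 'M[R]_d := [set A | A^T *m A = 1%:M].

Definition finite_orthogonal_subgroup (G : set 'M[R]_d) : Prop :=
  [/\ finite_set G, G `<=` orthogonal_group, G 1%:M,
      (forall A B, G A -> G B -> G (A *m B)) &
      (forall A, G A -> G (invmx A))].

Definition diagonal_direction : 'cV[R]_d := const_mx (Num.sqrt d%:R)^-1.

Definition cone (rho : R) : set 'cV[R]_d :=
  [set x : 'cV[R]_d | (forall i, 0 <= x i ord0) /\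
           (1 - rho) * norm2 x <= inner x diagonal_direction].

Definition rotated_cone A (rho : R) : set 'cV[R]_d :=
  [set A *m x | x in cone rho].

Definition shell (r s : R) : set 'cV[R]_d :=
  [set x : 'cV[R]_d | r <= norm2 x <= s].

End euclidean_geometry.

Section complex_functions.
Variables (R : realType) (d : nat).
Local Notation V := 'cV[R]_d.
Local Notation mu := (leb R d).
Implicit Types f g h : V -> R[i].

Definition cmeasurable f : Prop :=
  measurable_fun setT (fun x => complex.Re (f x)) /\
  measurable_fun setT (fun x => complex.Im (f x)).

Definition sqnorm f : \bar R := (\int[mu]_x (Normc.normc (f x) ^+ 2)%:E)%E.

Definition in_L1 f : Prop :=
  cmeasurable f /\ (\int[mu]_x (Normc.normc (f x))%:E < +oo)%E.

Definition in_L2 f : Prop := cmeasurable f /\ (sqnorm f < +oo)%E.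

Definition in_L12 f : Prop := in_L1 f /\ in_L2 f.

Definition cintegral f : R[i] :=
  (\int[mu]_x complex.Re (f x))%R +i* (\int[mu]_x complex.Im (f x))%R.

Definition fourier f (xi : V) : R[i] :=
  cintegral (fun x =>
    let t := 2 * pi * inner x xi in f x * (cos t -i* sin t)).

(* The Fourier transform on L^2: the extension by density of [fourier] from
   the intersection of L^1 and L^2. *)
Definition is_fourier_L2 f g : Prop :=
  [/\ in_L2 f, in_L2 g &
   exists u : nat -> V -> R[i],
     [/\ forall n, in_L12 (u n),
         sqnorm (u n \- f) @[n --> \oo] --> 0%E &
         sqnorm (fourier (u n) \- g) @[n --> \oo] --> 0%E]].

Definition convolution f g (x : V) : R[i] :=
  cintegral (fun y => f y * g (x - y)).

Definition supp f : set V := closure [set x : V | f x != 0].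

Definition in_Sobolev (s : R) f : Prop :=
  exists g, is_fourier_L2 f g /\
    in_L2 (fun xi => ((1 + norm2 xi ^+ 2) `^ (s / 2))%:C * g xi).

Definition in_log_Sobolev (s : R) f : Prop :=
  exists g, is_fourier_L2 f g /\
    in_L2 (fun xi => (ln (expR 1 + norm2 xi) `^ s)%:C * g xi).

End complex_functions.

Section filters.
Variables (R : realType) (d : nat).
Local Notation V := 'cV[R]_d.
Local Notation mu := (leb R d).
Implicit Types (f g psi phi chi : V -> R[i]) (Psi : set (V -> R[i])).
Implicit Types (a : R) (G : set 'M[R]_d) (J : int).

Definition admissible a G psi phi : Prop :=
  [/\ in_L12 psi, in_L12 phi &
   \forall xi \ae mu,
     ((Normc.normc (fourier phi xi) ^+ 2)%:E +
      \sum_(1 <= j <oo)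
        (\sum_(M \in G) Normc.normc (fourier psi (a ^- j *: (invmx M *m xi))) ^+ 2)%:E
      = 1)%E].

(* A pair (j, M) stands for the element a ^ j *: M; as 1 < a and M is
   orthogonal, the latter determines j and M. *)
Definition scales G J : set (int * 'M[R]_d) := [set l | - J < l.1 /\ G l.2].

Definition wavelet psi a (l : int * 'M[R]_d) : V -> R[i] :=
  fun x => (a ^ (d%:Z * l.1))%:C * psi (a ^ l.1 *: (invmx l.2 *m x)).

Definition Wav psi a G J : set (V -> R[i]) := wavelet psi a @` scales G J.

Definition low_pass phi a J : V -> R[i] :=
  fun x => (a ^ (- (d%:Z * J)))%:C * phi (a ^ (- J) *: x).

(* Filters are elements of L^1 and L^2, that is, functions up to equality
   almost everywhere. [same_filters Psi W] says that Psi contains exactly one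
   representative of each of the classes of the functions in W, so that sums
   over Psi count each filter once. *)
Definition same_filters Psi (W : set (V -> R[i])) : Prop :=
  [/\ forall g, Psi g -> in_L12 g /\ exists2 h, W h & g = h %[ae mu],
      forall h, W h -> exists2 g, Psi g & g = h %[ae mu] &
      forall g g', Psi g -> Psi g' -> g = g' %[ae mu] -> g = g'].

Definition countably_infinite (T : Type) (A : set T) : Prop :=
  countable A /\ infinite_set A.

Definition Littlewood_Paley chi Psi : Prop :=
  \forall xi \ae mu,
    ((Normc.normc (fourier chi xi) ^+ 2)%:E +
     \esum_(g in Psi) (Normc.normc (fourier g xi) ^+ 2)%:E = 1)%E.

Definition propagate f (p : seq (V -> R[i])) : V -> R[i] :=
  foldl (fun h g x => (Normc.normc (convolution h g x))%:C) f p.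

Definition energy_remainder Psi (N : nat) f : \bar R :=
  \esum_(p in [set p : N.-tuple (V -> R[i]) | forall i, Psi (tnth p i)])
    sqnorm (propagate f p).

(* [fine] turns the infinite values into 0; the value is finite as soon as the
   Fourier transform of g has a nonempty bounded support. *)
Definition band_radius g : R :=
  fine (ereal_inf [set ereal_sup [set (norm2 (xi - xi'))%:E
                                 | xi in supp (fourier g)]
                  | xi' in [set: V]]).

Definition in_decay_space (omega : R -> R) Psi f : Prop :=
  in_L2 f /\
  (\esum_(g in Psi) ((omega (band_radius g) ^+ 2)%:E * sqnorm (convolution f g))
   < +oo)%E.

End filters.

(* A function on the open half-line is encoded as a function on R of which only
   the values at positive arguments matter. *)
Definition weight_ratio (R : realType) (k : R) (omega : R -> R) (t : R) : R :=
  t `^ k * omega t ^- 2.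

Definition weakly_dominated_weight (R : realType) (k : R) (omega : R -> R)
    : Prop :=
  [/\ forall t, 0 < t -> 0 < omega t,
      forall s t, 0 < s -> s <= t -> omega s <= omega t &
   exists T, [/\ 0 < T,
     exists B, forall t, 0 < t < T -> `|weight_ratio k omega t| <= B,
     forall s t, T <= s -> s <= t ->
       weight_ratio k omega s <= weight_ratio k omega t &
     weight_ratio k omega t @[t --> +oo] --> +oo]].

Definition is_bigO (R : realType) (W : nat -> \bar R) (E : nat -> R) : Prop :=
  exists C N0, [/\ 0 < C, (0 < N0)%N &
    forall N, (N0 <= N)%N -> (W N <= (C * E N)%:E)%E].

(* Main.v *)
Require Import Defs.
From mathcomp Require Import all_boot all_order all_algebra.
From mathcomp Require Import all_classical all_reals all_analysis.
From mathcomp Require Import complex.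
From mathcomp Require Import measurable_realfun.
From mathcomp Require Import ring lra.

(** Taking the modulus demodulates. For a signal h with transform h^ and any
    frequency nu, the second moment of the spectrum of |h| about the origin is
    at most the second moment of the spectrum of h about nu:
    [modulus_moment_le]. The reason is that two complex numbers are at least as
    far apart as their moduli, also after a rotation of one of them, so that
    the difference between |h| and its translate by z has at most the norm of
    h - c h(. - z) for every unimodular c. Take for c the character of nu at z,
    express both norms on the frequency side by Plancherel's identity, divide
    by |z|^2 and let z tend to 0.

    If the spectrum of a filter lies in a cone intersected with a shell of
    ratio K = a^kappa, there is a centre nu on the axis of the cone with
    |xi - nu| <= alpha |xi| on the whole spectrum ([cone_center_le]). The
    wavelets inherit this by dilation and rotation, with their own centres
    ([filter_support]). Hence filtering and taking moduli, summed over a family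
    of filters with Littlewood-Paley sum at most 1, multiplies the second
    moment by at most alpha^2; and as the spectra of all filters stay outside
    the ball of radius r0 = a^(-J), the energy of the last layer is at most
    r0^(-2) times a second moment. By induction on N ([energy_contraction]),
    N + 1 layers leave at most r0^(-2) alpha^(2N) times the second moment of
    the signal.

    Now let f be square integrable and let g be the first filter of a path. If
    the spectrum of g lies in a ball of radius R, then |f * g| has second
    moment at most R^2 |f * g|^2, by demodulation with the centre of the ball.
    As the layers never create energy, the energy which N + 2 layers leave of f
    is at most the sum over g of
      min (1, r0^(-2) alpha^(2N) R_g^2) |f * g|^2    ([energy_remainder_decay]).
    The moments are computed for integrable signals; the estimate passes to all
    square integrable ones by truncation, because convolutions with the filters
    and moduli are nonexpansive.

    Everything follows from this sum. For a weight omega, the minimum is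
    compared with omega(R_g)^2 / omega(alpha^(-N))^2 ([weight_comparison]). For
    the Sobolev spaces, the radius of the band of a wavelet is at most a
    constant times |xi| for every xi in the band, so that the sum is bounded by
    the integral of min (1, c alpha^(2N) |xi|^2) |f^(xi)|^2
    ([energy_frequency_bound]), and the minimum is compared with the Sobolev
    weights ([sobolev_rate], [log_sobolev_rate]).

    Plancherel's identity is proved by regularizing the energy of f^ with the
    factor prod exp (-e |xi_i|), whose transform is a product p_e of Poisson
    kernels: twice the regularized energy, plus the average under p_e(z) dz of
    the squared norm of f - f(. - z), is exactly twice the energy of f
    ([plancherel_defect]). As e tends to 0 the average vanishes, because
    translations are continuous in the mean square. *)

Set Implicit Arguments.
Unset Strict Implicit.
Unset Printing Implicit Defensive.

Import Order.TTheory GRing.Theory Num.Theory.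
Import numFieldNormedType.Exports.

Local Open Scope classical_set_scope.
Local Open Scope ring_scope.
Local Open Scope complex_scope.

Local Notation normc := Normc.normc.
Local Notation Re := complex.Re.
Local Notation Im := complex.Im.

(** * Complex-valued functions and their integrals *)

Section complex_numbers.
Variable R : realType.
Implicit Types z w : R[i].

Lemma normc_ge0 z : 0 <= normc z.
Proof. by case: z => x y /=; exact: sqrtr_ge0. Qed.

Lemma normc_sqrE z : normc z ^+ 2 = Re z ^+ 2 + Im z ^+ 2.
Proof. by case: z => x y /=; rewrite sqr_sqrtr// addr_ge0// sqr_ge0. Qed.

Lemma ReM z w : Re (z * w) = Re z * Re w - Im z * Im w.
Proof. by case: z w => x y [u v]. Qed.

Lemma ImM z w : Im (z * w) = Re z * Im w + Im z * Re w.
Proof. by case: z w => x y [u v]. Qed.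

Lemma ReD z w : Re (z + w) = Re z + Re w.
Proof. by case: z w => x y [u v]. Qed.

Lemma ImD z w : Im (z + w) = Im z + Im w.
Proof. by case: z w => x y [u v]. Qed.

Lemma ReN z : Re (- z) = - Re z.
Proof. by case: z. Qed.

Lemma ImN z : Im (- z) = - Im z.
Proof. by case: z. Qed.

Lemma ReB z w : Re (z - w) = Re z - Re w.
Proof. by rewrite ReD ReN. Qed.

Lemma ImB z w : Im (z - w) = Im z - Im w.
Proof. by rewrite ImD ImN. Qed.

Lemma ReJ z : Re (conjc z) = Re z.
Proof. by case: z. Qed.

Lemma ImJ z : Im (conjc z) = - Im z.
Proof. by case: z. Qed.

Lemma normcM z w : normc (z * w) = normc z * normc w.
Proof. exact: Normc.normcM. Qed.

Lemma normc_conj z : normc (conjc z) = normc z.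
Proof. by case: z => x y /=; rewrite sqrrN. Qed.

Lemma normc_opp z : normc (- z) = normc z.
Proof. by case: z => x y /=; rewrite !sqrrN. Qed.

Lemma normc_real (x : R) : normc x%:C = `|x|.
Proof. by rewrite /= expr0n addr0 sqrtr_sqr. Qed.

Lemma normc_triangle z w : normc (z + w) <= normc z + normc w.
Proof. exact: le_normcD. Qed.

Lemma normc_dist z w : `|normc z - normc w| <= normc (z - w).
Proof.
rewrite ler_norml; apply/andP; split.
  by have := normc_triangle (w - z) z; rewrite subrK -(opprB z) normc_opp; lra.
by have := normc_triangle (z - w) w; rewrite subrK; lra.
Qed.

Lemma Re_le_normc z : `|Re z| <= normc z.
Proof.
by case: z => x y /=; rewrite -sqrtr_sqr ler_wsqrtr// lerDl sqr_ge0.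
Qed.

Lemma Im_le_normc z : `|Im z| <= normc z.
Proof.
by case: z => x y /=; rewrite -sqrtr_sqr ler_wsqrtr// lerDr sqr_ge0.
Qed.

Lemma normc_le_ReIm z : normc z <= `|Re z| + `|Im z|.
Proof.
have h : 0 <= `|Re z| + `|Im z| by rewrite addr_ge0.
rewrite -(ler_pXn2r (_ : 0 < 2)%N) ?nnegrE ?normc_ge0//.
rewrite normc_sqrE -(real_normK (num_real (Re z))) -(real_normK (num_real (Im z))).
by have := mulr_ge0 (normr_ge0 (Re z)) (normr_ge0 (Im z)); nra.
Qed.

Lemma eqc (z w : R[i]) : Re z = Re w -> Im z = Im w -> z = w.
Proof. by case: z w => x y [u v] /= -> ->. Qed.

Lemma conjM z w : conjc (z * w) = conjc z * conjc w.
Proof. by case: z w => a b [c d]; apply: eqc => /=; ring. Qed.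

(** The elementary form of the Minkowski inequality used for norms: the weight t
    is at one's disposal. *)
Lemma normcD_weighted (t : R) (z w : R[i]) : 0 < t ->
  normc (z + w) ^+ 2 <= (1 + t) * normc z ^+ 2 + (1 + t^-1) * normc w ^+ 2.
Proof.
move=> t0; have h := normc_triangle z w.
apply: (@le_trans _ _ ((normc z + normc w) ^+ 2)).
  by rewrite ler_sqr ?nnegrE ?addr_ge0 ?normc_ge0.
have := sqr_ge0 (t * normc z - normc w); move: (normc z) (normc w) => a b hs.
rewrite -subr_ge0.
have -> : (1 + t) * a ^+ 2 + (1 + t^-1) * b ^+ 2 - (a + b) ^+ 2 = t^-1 * (t * a - b) ^+ 2.
  by field; lra.
by rewrite mulr_ge0// invr_ge0 ltW.
Qed.

Lemma normcM_weighted (t : R) (z w : R[i]) : 0 < t ->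
  normc (z * w) <= t^-1 * normc z ^+ 2 + t * normc w ^+ 2.
Proof.
move=> t0; rewrite normcM; have := sqr_ge0 (normc z - t * normc w).
have := normc_ge0 z; have := normc_ge0 w; move: (normc z) (normc w) => a b b0 a0 hs.
have : 0 <= t^-1 * (a - t * b) ^+ 2 + a * b.
  have ti : 0 <= t^-1 by rewrite invr_ge0 ltW.
  exact: addr_ge0 (mulr_ge0 ti hs) (mulr_ge0 a0 b0).
have -> : t^-1 * (a - t * b) ^+ 2 = t^-1 * a ^+ 2 + t * b ^+ 2 - 2 * (a * b) by field; lra.
lra.
Qed.

End complex_numbers.

Section complex_measurability.
Context d (T : measurableType d) (R : realType).
Implicit Types f g : T -> R[i].

(** Stated over an arbitrary measurable type, since Fubini's theorem involves
    functions of two variables; on vectors it is convertible to [cmeasurable]. *)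
Definition cmeas f : Prop :=
  measurable_fun setT (fun x => Re (f x)) /\
  measurable_fun setT (fun x => Im (f x)).

Lemma cmeasD f g : cmeas f -> cmeas g -> cmeas (fun x => f x + g x).
Proof.
move=> [fr fi] [gr gi]; split.
  by under eq_fun do rewrite ReD; exact: measurable_funD.
by under eq_fun do rewrite ImD; exact: measurable_funD.
Qed.

Lemma cmeasN f : cmeas f -> cmeas (fun x => - f x).
Proof.
move=> [fr fi]; split.
  by under eq_fun do rewrite ReN; exact: measurableT_comp.
by under eq_fun do rewrite ImN; exact: measurableT_comp.
Qed.

Lemma cmeasB f g : cmeas f -> cmeas g -> cmeas (fun x => f x - g x).
Proof. by move=> mf mg; apply: cmeasD => //; exact: cmeasN. Qed.

Lemma cmeasM f g : cmeas f -> cmeas g -> cmeas (fun x => f x * g x).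
Proof.
move=> [fr fi] [gr gi]; split.
  by under eq_fun do rewrite ReM; apply: measurable_funB; exact: measurable_funM.
by under eq_fun do rewrite ImM; apply: measurable_funD; exact: measurable_funM.
Qed.

Lemma cmeas_cst (c : R[i]) : cmeas (fun=> c).
Proof. by split; exact: measurable_cst. Qed.

Lemma cmeas_real (f : T -> R) : measurable_fun setT f -> cmeas (fun x => (f x)%:C).
Proof. by move=> mf; split => //=; exact: measurable_cst. Qed.

Lemma cmeas_conj f : cmeas f -> cmeas (fun x => conjc (f x)).
Proof.
move=> [fr fi]; split.
  by under eq_fun do rewrite ReJ.
by under eq_fun do rewrite ImJ; exact: measurableT_comp.
Qed.

Lemma measurable_normc2 f : cmeas f -> measurable_fun setT (fun x => normc (f x) ^+ 2).
Proof.
move=> [fr fi]; under eq_fun do rewrite normc_sqrE.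
by apply: measurable_funD; exact: measurable_funX.
Qed.

Lemma measurable_normc f : cmeas f -> measurable_fun setT (fun x => normc (f x)).
Proof.
move=> mf.
rewrite (_ : (fun x => normc (f x)) = Num.sqrt \o (fun x => normc (f x) ^+ 2)).
  apply: measurableT_comp; last exact: measurable_normc2.
  by apply: continuous_measurable_fun; exact: sqrt_continuous.
by apply/funext => x /=; rewrite sqrtr_sqr ger0_norm// normc_ge0.
Qed.

Lemma measurable_normcE f : cmeas f ->
  measurable_fun setT (fun x => (normc (f x))%:E).
Proof. by move=> mf; apply/measurable_EFinP; exact: measurable_normc. Qed.

Lemma measurable_normc2E f : cmeas f ->
  measurable_fun setT (fun x => (normc (f x) ^+ 2)%:E).
Proof. by move=> mf; apply/measurable_EFinP; exact: measurable_normc2. Qed.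

End complex_measurability.

Lemma cmeas_comp d1 d2 (T : measurableType d1) (U : measurableType d2)
    (R : realType) (h : U -> T) (f : T -> R[i]) :
  measurable_fun setT h -> cmeas f -> cmeas (fun x => f (h x)).
Proof. by move=> mh [fr fi]; split; [exact: (measurableT_comp fr)|exact: (measurableT_comp fi)]. Qed.

Section complex_integral.
Context d (T : measurableType d) (R : realType) (mu : {measure set T -> \bar R}).
Implicit Types f g : T -> R[i].

(** On vectors this is convertible to [cintegral]. *)
Definition cint f : R[i] :=
  (\int[mu]_x Re (f x))%R +i* (\int[mu]_x Im (f x))%R.

Definition cintegrable f : Prop :=
  cmeas f /\ (\int[mu]_x (normc (f x))%:E < +oo)%E.

Lemma cintegrableP f : cintegrable f <->
  mu.-integrable setT (fun x => (Re (f x))%:E) /\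
  mu.-integrable setT (fun x => (Im (f x))%:E).
Proof.
split=> [[mf foo]|[ir ii]].
  split; apply/integrableP; split.
  - by apply/measurable_EFinP; exact: mf.1.
  - apply: le_lt_trans foo; apply: ge0_le_integral => //=.
    + by apply/measurable_EFinP/measurableT_comp => //; exact: mf.1.
    + exact: measurable_normcE.
    + by move=> x _; rewrite lee_fin Re_le_normc.
  - by apply/measurable_EFinP; exact: mf.2.
  - apply: le_lt_trans foo; apply: ge0_le_integral => //=.
    + by apply/measurable_EFinP/measurableT_comp => //; exact: mf.2.
    + exact: measurable_normcE.
    + by move=> x _; rewrite lee_fin Im_le_normc.
have mf : cmeas f.
  by split; apply/measurable_EFinP; [exact: measurable_int ir|exact: measurable_int ii].
split=> //.
have /integrableP[_] := integrableD measurableT (integrable_abse ir) (integrable_abse ii).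
apply: le_lt_trans; apply: ge0_le_integral => //=.
- by move=> x _; rewrite lee_fin normc_ge0.
- exact: measurable_normcE.
- apply/measurable_EFinP/measurableT_comp => //.
  by apply: measurable_funD; apply: measurableT_comp => //; [exact: mf.1|exact: mf.2].
- by move=> x _; rewrite lee_fin (le_trans (normc_le_ReIm _))// ler_norm.
Qed.

Lemma cintegrable_le f g : cmeas f -> cintegrable g ->
  (forall x, normc (f x) <= normc (g x)) -> cintegrable f.
Proof.
move=> mf [mg goo] fg; split=> //; apply: le_lt_trans goo.
apply: ge0_le_integral => //.
- by move=> x _; rewrite lee_fin normc_ge0.
- exact: measurable_normcE.
- exact: measurable_normcE.
- by move=> x _; rewrite lee_fin.
Qed.

Lemma cintegrableD f g : cintegrable f -> cintegrable g ->
  cintegrable (fun x => f x + g x).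
Proof.
move=> /cintegrableP[fr fi] /cintegrableP[gr gi]; apply/cintegrableP; split.
  by under eq_fun do rewrite ReD EFinD; exact: integrableD.
by under eq_fun do rewrite ImD EFinD; exact: integrableD.
Qed.

Lemma cintegrableZ (c : R[i]) f : cintegrable f -> cintegrable (fun x => c * f x).
Proof.
move=> /cintegrableP[fr fi]; apply/cintegrableP; split.
  under eq_fun do rewrite ReM EFinB.
  by apply: integrableB => //; under eq_fun do rewrite EFinM; exact: integrableZl.
under eq_fun do rewrite ImM EFinD.
by apply: integrableD => //; under eq_fun do rewrite EFinM; exact: integrableZl.
Qed.

Lemma cintegrableN f : cintegrable f -> cintegrable (fun x => - f x).
Proof.
by move=> /(cintegrableZ (-1)); under eq_fun do rewrite mulN1r.
Qed.

Lemma eq_cint f g : f =1 g -> cint f = cint g.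
Proof. by move=> /funext ->. Qed.

Lemma cintD f g : cintegrable f -> cintegrable g ->
  cint (fun x => f x + g x) = cint f + cint g.
Proof.
move=> /cintegrableP[fr fi] /cintegrableP[gr gi]; apply: eqc.
  by rewrite ReD /=; under eq_Rintegral do rewrite ReD; rewrite RintegralD.
by rewrite ImD /=; under eq_Rintegral do rewrite ImD; rewrite RintegralD.
Qed.

Lemma integrable_scale (c : R) (h : T -> R) :
  mu.-integrable setT (fun x => (h x)%:E) ->
  mu.-integrable setT (fun x => (c * h x)%:E).
Proof. by move=> ih; under eq_fun do rewrite EFinM; exact: integrableZl. Qed.

Lemma cintZ (c : R[i]) f : cintegrable f -> cint (fun x => c * f x) = c * cint f.
Proof.
move=> /cintegrableP[fr fi]; apply: eqc.
  rewrite ReM /=; under eq_Rintegral do rewrite ReM.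
  by rewrite RintegralB//; [rewrite !RintegralZl|exact: integrable_scale..].
rewrite ImM /=; under eq_Rintegral do rewrite ImM.
by rewrite RintegralD//; [rewrite !RintegralZl|exact: integrable_scale..].
Qed.

Lemma cintZr (c : R[i]) f : cintegrable f -> cint (fun x => f x * c) = cint f * c.
Proof.
by move=> fi; rewrite mulrC -cintZ//; apply: eq_cint => x; rewrite mulrC.
Qed.

Lemma cintN f : cintegrable f -> cint (fun x => - f x) = - cint f.
Proof.
by move=> fi; rewrite -mulN1r -cintZ//; apply: eq_cint => x; rewrite mulN1r.
Qed.

Lemma cintB f g : cintegrable f -> cintegrable g ->
  cint (fun x => f x - g x) = cint f - cint g.
Proof. by move=> fi gi; rewrite cintD ?cintN//; exact: cintegrableN. Qed.

Lemma cintegrable_conj f : cintegrable f -> cintegrable (fun x => conjc (f x)).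
Proof.
move=> [mf foo]; split; first exact: cmeas_conj.
by under eq_integral do rewrite normc_conj.
Qed.

Lemma cint_conj f : cintegrable f -> cint (fun x => conjc (f x)) = conjc (cint f).
Proof.
move=> /cintegrableP[fr fi]; apply: eqc; rewrite /= ?ReJ ?ImJ/=.
  by under eq_Rintegral do rewrite ReJ.
under eq_Rintegral do rewrite ImJ -mulN1r.
by rewrite RintegralZl// mulN1r.
Qed.

(** Multiplied by the conjugate of the integral, the function has a nonnegative
    real integral, and real parts are at most moduli. *)
Lemma normc_cint_le f : cintegrable f ->
  ((normc (cint f))%:E <= \int[mu]_x (normc (f x))%:E)%E.
Proof.
move=> fi; set z := cint f.
have [->|z0] := eqVneq z 0.
  by rewrite normc_real normr0; apply: integral_ge0 => x _; rewrite lee_fin normc_ge0.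
have nz : 0 < normc z.
  by rewrite lt_neqAle normc_ge0 andbT eq_sym; apply: contra_neq z0 => /Normc.eq0_normc.
have mn := measurable_normcE fi.1.
have fn : (\int[mu]_x (normc (f x))%:E)%E \is a fin_num.
  rewrite ge0_fin_numE ?fi.2//.
  by apply: integral_ge0 => x _; rewrite lee_fin normc_ge0.
rewrite -(fineK fn) lee_fin -(ler_pM2l nz) -expr2 normc_sqrE.
have -> : Re z ^+ 2 + Im z ^+ 2 = Re (cint (fun x => conjc z * f x)).
  by rewrite cintZ// ReM ReJ ImJ; ring.
set g := fun x => _; have -> : Re (cint g) = (\int[mu]_x Re (g x))%R by [].
rewrite -RintegralZl//; last first.
  by apply/integrableP; split => //; under eq_integral do rewrite /= ger0_norm ?normc_ge0//; exact: fi.2.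
apply: le_Rintegral => //.
- by have /cintegrableP[] := cintegrableZ (conjc z) fi.
- apply: integrable_scale; apply/integrableP; split => //.
  by under eq_integral do rewrite /= ger0_norm ?normc_ge0//; exact: fi.2.
- move=> x _; apply: le_trans (ler_norm _) _; apply: le_trans (Re_le_normc _) _.
  by rewrite normcM normc_conj.
Qed.

Lemma ae_eq_cint f g : cmeas f -> cmeas g -> f = g %[ae mu] -> cint f = cint g.
Proof.
move=> [fr fi] [gr gi] fg; congr Complex; congr fine; apply: ae_eq_integral => //.
- exact/measurable_EFinP.
- exact/measurable_EFinP.
- by apply: filterS fg => x /= ->.
- exact/measurable_EFinP.
- exact/measurable_EFinP.
- by apply: filterS fg => x /= ->.
Qed.

End complex_integral.

Section complex_fubini.
Context d1 d2 (T1 : measurableType d1) (T2 : measurableType d2) (R : realType).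
Variable m1 : {sigma_finite_measure set T1 -> \bar R}.
Variable m2 : {sigma_finite_measure set T2 -> \bar R}.

(** Tonelli's theorem gives the measurability of the integrals of the positive
    and the negative part, which may both be infinite. *)
Lemma measurable_Rintegral1 (h : T1 * T2 -> R) : measurable_fun setT h ->
  measurable_fun setT (fun x => \int[m2]_y h (x, y))%R.
Proof.
move=> mh.
have mE : measurable_fun setT (EFin \o h) by exact/measurable_EFinP.
have mi : measurable_fun setT (fun x => \int[m2]_y (h (x, y))%:E)%E.
  rewrite (_ : (fun _ => _) = fun x =>
    (\int[m2]_y (EFin \o h)^\+ (x, y) - \int[m2]_y (EFin \o h)^\- (x, y))%E); last first.
    apply/funext => x; rewrite [LHS]integralE; congr (_ - _)%E; apply: eq_integral => ? _.
      by rewrite !funeposE.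
    by rewrite !funenegE.
  apply: emeasurable_funB.
    by apply: measurable_fun_fubini_tonelli_F => //; exact: measurable_funepos.
  by apply: measurable_fun_fubini_tonelli_F => //; exact: measurable_funeneg.
apply: (measurableT_comp _ mi); exact: fine_measurable.
Qed.

Lemma measurable_Rintegral2 (h : T1 * T2 -> R) : measurable_fun setT h ->
  measurable_fun setT (fun y => \int[m1]_x h (x, y))%R.
Proof.
move=> mh.
have mE : measurable_fun setT (EFin \o h) by exact/measurable_EFinP.
have mi : measurable_fun setT (fun y => \int[m1]_x (h (x, y))%:E)%E.
  rewrite (_ : (fun _ => _) = fun y =>
    (\int[m1]_x (EFin \o h)^\+ (x, y) - \int[m1]_x (EFin \o h)^\- (x, y))%E); last first.
    apply/funext => y; rewrite [LHS]integralE; congr (_ - _)%E; apply: eq_integral => ? _.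
      by rewrite !funeposE.
    by rewrite !funenegE.
  apply: emeasurable_funB.
    by apply: measurable_fun_fubini_tonelli_G => //; exact: measurable_funepos.
  by apply: measurable_fun_fubini_tonelli_G => //; exact: measurable_funeneg.
apply: (measurableT_comp _ mi); exact: fine_measurable.
Qed.

Lemma cmeas_cint1 (F : T1 * T2 -> R[i]) : cmeas F ->
  cmeas (fun x => cint m2 (fun y => F (x, y))).
Proof.
by move=> [Fr Fi]; split; [exact: measurable_Rintegral1 Fr|exact: measurable_Rintegral1 Fi].
Qed.

Lemma cmeas_cint2 (F : T1 * T2 -> R[i]) : cmeas F ->
  cmeas (fun y => cint m1 (fun x => F (x, y))).
Proof.
by move=> [Fr Fi]; split; [exact: measurable_Rintegral2 Fr|exact: measurable_Rintegral2 Fi].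
Qed.

(** The inner extended integrals are infinite on a null set only. *)
Lemma Rintegral_Rintegral (h : T1 * T2 -> R) :
  (m1 \x m2)%E.-integrable setT (EFin \o h) ->
  (\int[m1]_x \int[m2]_y h (x, y))%R =
  fine (\int[m1]_x \int[m2]_y (h (x, y))%:E)%E.
Proof.
move=> ih; congr fine.
have mh := measurable_int _ ih.
apply: ae_eq_integral => //.
- by apply/measurable_EFinP; apply: measurable_Rintegral1; exact/measurable_EFinP.
- exact: (measurable_fubini_F ih).
- have := integrable_ae measurableT (integrable_fubini_F ih).
  by apply: filterS => x /(_ I) /= fx _; rewrite /Rintegral fineK.
Qed.

Lemma Rintegral_Rintegral2 (h : T1 * T2 -> R) :
  (m1 \x m2)%E.-integrable setT (EFin \o h) ->
  (\int[m2]_y \int[m1]_x h (x, y))%R =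
  fine (\int[m2]_y \int[m1]_x (h (x, y))%:E)%E.
Proof.
move=> ih; congr fine.
have mh := measurable_int _ ih.
apply: ae_eq_integral => //.
- by apply/measurable_EFinP; apply: measurable_Rintegral2; exact/measurable_EFinP.
- exact: (measurable_fubini_G ih).
- have := ae_integrable2 ih.
  by apply: filterS => y iy _; rewrite /Rintegral fineK//; exact: integrable_fin_num.
Qed.

Lemma cfubini (F : T1 * T2 -> R[i]) : cmeas F ->
  (\int[m1]_x \int[m2]_y (normc (F (x, y)))%:E < +oo)%E ->
  cint m1 (fun x => cint m2 (fun y => F (x, y))) =
  cint m2 (fun y => cint m1 (fun x => F (x, y))).
Proof.
move=> mF Foo.
have /cintegrableP[iR iI] : cintegrable (m1 \x m2)%E F.
  split=> //; rewrite fubini_tonelli1//.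
    exact: measurable_normcE.
  by move=> x; rewrite lee_fin normc_ge0.
apply: eqc => /=.
  by rewrite (Rintegral_Rintegral iR) (Rintegral_Rintegral2 iR) (Fubini iR).
by rewrite (Rintegral_Rintegral iI) (Rintegral_Rintegral2 iI) (Fubini iI).
Qed.

Lemma cint_prod (F : T1 * T2 -> R[i]) : cmeas F ->
  (\int[m1]_x \int[m2]_y (normc (F (x, y)))%:E < +oo)%E ->
  cint (m1 \x m2)%E F = cint m1 (fun x => cint m2 (fun y => F (x, y))).
Proof.
move=> mF Foo.
have /cintegrableP[iR iI] : cintegrable (m1 \x m2)%E F.
  split=> //; rewrite fubini_tonelli1//.
    exact: measurable_normcE.
  by move=> x; rewrite lee_fin normc_ge0.
apply: eqc => /=.
  by rewrite (Rintegral_Rintegral iR) (integral12_prod_meas1 iR).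
by rewrite (Rintegral_Rintegral iI) (integral12_prod_meas1 iI).
Qed.

End complex_fubini.

(** * Translations and reflections preserve Lebesgue measure *)

Section measure_preserving.
Context d (T : measurableType d) (R : realType) (mu : {measure set T -> \bar R}).
Variable phi : T -> T.
Hypothesis mphi : measurable_fun setT phi.
Hypothesis phiP : forall A, measurable A -> mu (phi @^-1` A) = mu A.

Lemma ge0_integral_preserving (f : T -> \bar R) : measurable_fun setT f ->
  (forall x, 0 <= f x)%E -> (\int[mu]_x f (phi x) = \int[mu]_x f x)%E.
Proof.
move=> mf f0.
rewrite (_ : (\int[mu]_x f (phi x))%E = (\int[mu]_(x in phi @^-1` setT) (f \o phi) x)%E)//.
rewrite -ge0_integral_pushforward//.
by apply: eq_measure_integral => //= A mA _; exact: phiP.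
Qed.

Lemma integral_preserving (f : T -> \bar R) : measurable_fun setT f ->
  (\int[mu]_x f (phi x) = \int[mu]_x f x)%E.
Proof.
move=> mf; rewrite [LHS]integralE [RHS]integralE; congr (_ - _)%E.
  rewrite -(ge0_integral_preserving (measurable_funepos mf))//.
  by apply: eq_integral => x _; rewrite !funeposE.
rewrite -(ge0_integral_preserving (measurable_funeneg mf))//.
by apply: eq_integral => x _; rewrite !funenegE.
Qed.

Lemma cint_preserving (f : T -> R[i]) : cmeas f ->
  cint mu (fun x => f (phi x)) = cint mu f.
Proof.
move=> [fr fi]; congr Complex; congr fine.
  by rewrite -(integral_preserving (f := fun x => (Re (f x))%:E))//; exact/measurable_EFinP.
by rewrite -(integral_preserving (f := fun x => (Im (f x))%:E))//; exact/measurable_EFinP.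
Qed.

End measure_preserving.

Section line_translation.
Variable R : realType.

Lemma measurable_shift (c : R) :
  measurable_fun [set: measurableTypeR R] (fun x : measurableTypeR R => x + c : measurableTypeR R).
Proof. by apply: measurable_funD => //; exact: measurable_cst. Qed.

(** By the uniqueness of the measure that gives every interval its length. *)
Lemma lebesgue_measure_shift (c : R) (A : set (measurableTypeR R)) : measurable A ->
  lebesgue_measure ((fun x : R => x + c) @^-1` A) = lebesgue_measure A.
Proof.
move=> mA; rewrite -[LHS]/(pushforward lebesgue_measure (fun x : measurableTypeR R => x + c : measurableTypeR R) A).
apply/esym/lebesgue_measure_unique => //=; first exact: measurable_shift.
move=> mm _ [[a b]] _ <-.
rewrite /pushforward/= (_ : _ @^-1` _ = `]a - c, b - c]%classic); last first.
  apply/seteqP; split => x /=; rewrite !in_itv/= ltrBlDr lerBrDr//.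
rewrite !lebesgue_measure_itv/= !lte_fin ltrD2r -!EFinB.
by congr (if _ then _ else _); congr EFin; ring.
Qed.

End line_translation.

Section vector_space.
Variables (R : realType) (n : nat).
Local Notation V := 'cV[R]_n.

Lemma measurable_addV (c : V) : measurable_fun [set: V] (fun x : V => x + c).
Proof.
apply: measurable_fun_cVP => i; under eq_fun do rewrite mxE.
by apply: measurable_funD => //; exact: measurable_coordinate.
Qed.

Lemma measurable_oppV : measurable_fun [set: V] (fun x : V => - x).
Proof.
apply: measurable_fun_cVP => i; under eq_fun do rewrite mxE.
by apply: measurableT_comp => //; exact: measurable_coordinate.
Qed.

Lemma measurable_scaleV (c : R) : measurable_fun [set: V] (fun x : V => c *: x).
Proof.
apply: measurable_fun_cVP => i; under eq_fun do rewrite mxE.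
by apply: measurable_funM => //; exact: measurable_coordinate.
Qed.

Lemma measurable_coord1 i : measurable_fun [set: V * V] (fun p : V * V => p.1 i ord0).
Proof. exact: (measurableT_comp (measurable_coordinate i) measurable_fst). Qed.

Lemma measurable_coord2 i : measurable_fun [set: V * V] (fun p : V * V => p.2 i ord0).
Proof. exact: (measurableT_comp (measurable_coordinate i) measurable_snd). Qed.

Lemma measurable_subVV : measurable_fun [set: V * V] (fun p : V * V => p.1 - p.2).
Proof.
apply: measurable_fun_cVP => i; under eq_fun do rewrite !mxE.
by apply: measurable_funB; [exact: measurable_coord1|exact: measurable_coord2].
Qed.

Lemma measurable_mulmxV m (A : 'M[R]_(m, n)) :
  measurable_fun [set: V] (fun x : V => A *m x).
Proof.
apply: measurable_fun_cVP => i; under eq_fun do rewrite !mxE.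
apply: measurable_sum => j; apply: measurable_funM => //.
exact: measurable_coordinate.
Qed.

Lemma measurable_innerVV : measurable_fun [set: V * V] (fun p : V * V => inner p.1 p.2).
Proof.
apply: measurable_sum => j; apply: measurable_funM.
  exact: measurable_coord1.
exact: measurable_coord2.
Qed.

Lemma measurable_inner (y : V) : measurable_fun [set: V] (fun x : V => inner x y).
Proof.
apply: measurable_sum => j; apply: measurable_funM => //.
exact: measurable_coordinate.
Qed.

End vector_space.

Section leb_integral.
Variable R : realType.

Lemma cV_cons_add n (t s : R) (x y : 'cV[R]_n) :
  cV_cons (t, x) + cV_cons (s, y) = cV_cons (t + s, x + y).
Proof.
by apply/colP => i; rewrite !mxE; case: (unlift _ _) => [j|] //=; rewrite mxE.
Qed.

Lemma cV_cons_opp n (t : R) (x : 'cV[R]_n) : - cV_cons (t, x) = cV_cons (- t, - x).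
Proof.
by apply/colP => i; rewrite !mxE; case: (unlift _ _) => [j|] //=; rewrite mxE.
Qed.

Lemma cV_cons_uncons n (x : 'cV[R]_n.+1) : exists t y, x = cV_cons (t, y).
Proof. by exists (cV_uncons x).1, (cV_uncons x).2; rewrite -surjective_pairing cV_unconsK. Qed.

Lemma measurable_cons1 n (t : R) : measurable_fun [set: 'cV[R]_n] (fun x => cV_cons (t, x)).
Proof.
apply: (measurableT_comp (@measurable_cV_cons R n)).
exact: measurable_fun_pair.
Qed.

Lemma ge0_integral_leb_succ n (f : 'cV[R]_n.+1 -> \bar R) : measurable_fun setT f ->
  (forall x, 0 <= f x)%E ->
  (\int[leb R n.+1]_x f x =
   \int[@lebesgue_measure R]_t \int[leb R n]_x f (cV_cons (t, x)))%E.
Proof.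
move=> mf f0.
have mc := @measurable_cV_cons R n.
rewrite (_ : (\int[leb R n.+1]_x f x)%E =
   (\int[pushforward (@lebesgue_measure R \x leb R n)%E (@cV_cons R n)]_(x in setT) f x)%E)//.
rewrite ge0_integral_pushforward// fubini_tonelli1//=.
by apply: measurableT_comp.
Qed.

Lemma ge0_integral_leb0 (f : 'cV[R]_0 -> \bar R) : measurable_fun setT f ->
  (\int[leb R 0]_x f x = f 0%R)%E.
Proof. by move=> mf; rewrite /= integral_dirac// diracT mul1e. Qed.

(** By induction on the dimension, with Tonelli's theorem separating the first
    coordinate from the others. *)
Lemma ge0_leb_shift n (c : 'cV[R]_n) (f : 'cV[R]_n -> \bar R) : measurable_fun setT f ->
  (forall x, 0 <= f x)%E ->
  (\int[leb R n]_x f (x + c)%R = \int[leb R n]_x f x)%E.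
Proof.
elim: n c f => [|n IH] c f mf f0.
  by apply: eq_integral => x _; congr f; apply/colP => -[].
have mfc : measurable_fun setT (fun x : 'cV[R]_n.+1 => f (x + c)).
  by apply: measurableT_comp => //; exact: measurable_addV.
rewrite (ge0_integral_leb_succ mfc (fun x => f0 _)) (ge0_integral_leb_succ mf f0).
have [s [y cE]] := cV_cons_uncons c.
pose g t := (\int[leb R n]_x f (cV_cons (t, x)))%E.
have mg : measurable_fun [set: measurableTypeR R] g.
  apply: (measurable_fun_fubini_tonelli_F (fun p => f (cV_cons p))) => //.
  exact: measurableT_comp (@measurable_cV_cons R n).
transitivity (\int[@lebesgue_measure R]_t g (t + s)%R)%E.
  apply: eq_integral => t _; rewrite /g -(IH y (fun x => f (cV_cons (t + s, x)))).
  - by apply: eq_integral => x _; rewrite cE cV_cons_add.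
  - by apply: measurableT_comp => //; exact: measurable_cons1.
  - by [].
apply: (ge0_integral_preserving (measurable_shift s)) => //.
- exact: lebesgue_measure_shift.
- by move=> t; exact: integral_ge0.
Qed.

Lemma ge0_leb_opp n (f : 'cV[R]_n -> \bar R) : measurable_fun setT f ->
  (forall x, 0 <= f x)%E ->
  (\int[leb R n]_x f (- x)%R = \int[leb R n]_x f x)%E.
Proof.
elim: n f => [|n IH] f mf f0.
  by apply: eq_integral => x _; congr f; apply/colP => -[].
have mfc : measurable_fun setT (fun x : 'cV[R]_n.+1 => f (- x)).
  by apply: measurableT_comp => //; exact: measurable_oppV.
rewrite (ge0_integral_leb_succ mfc (fun x => f0 _)) (ge0_integral_leb_succ mf f0).
pose g t := (\int[leb R n]_x f (cV_cons (t, x)))%E.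
have mg : measurable_fun [set: measurableTypeR R] g.
  apply: (measurable_fun_fubini_tonelli_F (fun p => f (cV_cons p))) => //.
  exact: measurableT_comp (@measurable_cV_cons R n).
transitivity (\int[@lebesgue_measure R]_t g (- t)%R)%E.
  apply: eq_integral => t _; rewrite /g -(IH (fun x => f (cV_cons (- t, x)))).
  - by apply: eq_integral => x _; rewrite cV_cons_opp.
  - by apply: measurableT_comp => //; exact: measurable_cons1.
  - by [].
apply: (@ge0_integral_preserving _ _ _ lebesgue_measure (fun t : measurableTypeR R => - t : measurableTypeR R)) => //.
- exact: oppr_measurable.
- exact: lebesgue_measureN.
- by move=> t; exact: integral_ge0.
Qed.

Lemma leb_shift_set n (c : 'cV[R]_n) A : measurable A ->
  leb R n ((fun x => x + c) @^-1` A) = leb R n A.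
Proof.
move=> mA; have := ge0_leb_shift c (f := fun x => (\1_A x)%:E).
have mpre : measurable ((fun x => x + c) @^-1` A).
  by rewrite -[X in measurable X]setTI; exact: measurable_addV.
move=> h; rewrite -[in RHS](setIT A) -integral_indic// -h.
- rewrite (_ : (\int[leb R n]_x (\1_A (x + c))%:E)%E =
    (\int[leb R n]_x (\1_((fun x => x + c) @^-1` A) x)%:E)%E); last first.
    by apply: eq_integral => x _; rewrite !indicE.
  by rewrite integral_indic// setIT.
- by apply/measurable_EFinP.
- by move=> x; rewrite lee_fin.
Qed.

Lemma leb_opp_set n A : measurable A ->
  leb R n ((fun x : 'cV[R]_n => - x) @^-1` A) = leb R n A.
Proof.
move=> mA; have := ge0_leb_opp (f := fun x : 'cV[R]_n => (\1_A x)%:E).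
have mpre : measurable ((fun x : 'cV[R]_n => - x) @^-1` A).
  by rewrite -[X in measurable X]setTI; exact: measurable_oppV.
move=> h; rewrite -[in RHS](setIT A) -integral_indic// -h.
- rewrite (_ : (\int[leb R n]_x (\1_A (- x))%:E)%E =
    (\int[leb R n]_x (\1_((fun x : 'cV[R]_n => - x) @^-1` A) x)%:E)%E); last first.
    by apply: eq_integral => x _; rewrite !indicE.
  by rewrite integral_indic// setIT.
- by apply/measurable_EFinP.
- by move=> x; rewrite lee_fin.
Qed.

Lemma cint_leb_shift n (c : 'cV[R]_n) (f : 'cV[R]_n -> R[i]) : cmeas f ->
  cint (leb R n) (fun x => f (x + c)) = cint (leb R n) f.
Proof.
apply: cint_preserving; first exact: measurable_addV.
exact: leb_shift_set.
Qed.

Lemma cint_leb_opp n (f : 'cV[R]_n -> R[i]) : cmeas f ->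
  cint (leb R n) (fun x => f (- x)) = cint (leb R n) f.
Proof.
apply: cint_preserving; first exact: measurable_oppV.
exact: leb_opp_set.
Qed.

End leb_integral.

(** * Linear changes of variables *)

Section linear_change_of_variables.
Variables (R : realType) (n : nat).
Local Notation V := 'cV[R]_n.
Local Notation mu := (leb R n).

Lemma measurable_box (A : 'I_n -> set (measurableTypeR R)) :
  (forall i, measurable (A i)) -> measurable [set x : V | forall i, A i (x i ord0)].
Proof.
move=> mA; rewrite [X in measurable X](_ : _ =
    \big[setI/setT]_i (coordinates i @^-1` A i)); last first.
  rewrite -bigcap_seq; apply/seteqP; split=> x /= Ax i; first by move=> _; exact: Ax.
  by apply: Ax; rewrite /= mem_index_enum.
apply: bigsetI_measurable => i _.
rewrite -[X in measurable X]setTI.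
by apply: measurable_coordinate => //; exact: mA.
Qed.

Definition cube (m : R) : set V := [set x : V | forall i, `[- m, m]%classic (x i ord0)].

Lemma measurable_cube (m : R) : measurable (cube m).
Proof.
exact (@measurable_box (fun=> `[- m, m]%classic) (fun=> measurable_itv _)).
Qed.

Lemma leb_cube (m : R) : 0 <= m -> mu (cube m) = ((m + m) ^+ n)%:E.
Proof.
move=> m0.
apply: (etrans (@leb_box R n (fun=> `[- m, m]%classic) (fun=> measurable_itv _))).
rewrite (eq_bigr (fun=> (m + m)%:E)); last first.
  move=> i _; rewrite lebesgue_measure_itv/= lte_fin opprK.
  case: ifPn => // h; congr EFin; lra.
by rewrite prodEFin prodr_const card_ord.
Qed.

Lemma leb_cube_fin (m : R) : (mu (cube m) < +oo)%E.
Proof.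
apply: (@le_lt_trans _ _ (mu (cube `|m|))); last by rewrite leb_cube// ltry.
apply: le_measure; rewrite ?inE; try exact: measurable_cube.
move=> x xm i; have := xm i; rewrite /= !in_itv/= => /andP[h1 h2].
by have := ler_norm m; have := normr_ge0 m; move=> ? ?; apply/andP; split; lra.
Qed.

Lemma measurable_reflectV (c : V) : measurable_fun [set: V] (fun x : V => c - x).
Proof.
apply: measurable_fun_cVP => i; under eq_fun do rewrite !mxE.
by apply: measurable_funB => //; exact: measurable_coordinate.
Qed.

Lemma ge0_leb_reflect (c : V) (f : V -> \bar R) : measurable_fun setT f ->
  (forall x, 0 <= f x)%E ->
  (\int[mu]_x f (c - x)%R = \int[mu]_x f x)%E.
Proof.
move=> mf f0; rewrite -[RHS](ge0_leb_opp mf f0).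
rewrite -[RHS](ge0_leb_shift (- c) (f := fun x => f (- x))) => [|//|//].
  by apply: eq_integral => x _; rewrite opprB.
by apply: measurableT_comp => //; exact: measurable_oppV.
Qed.

Variables (B B' : 'M[R]_n).
Hypotheses (BB' : B *m B' = 1%:M) (B'B : B' *m B = 1%:M).

(** Both sides are the integral of f (B x) q (B x + y) over all pairs (x, y), and
    the substitutions that show it are translations and reflections only. It
    follows that composition with B multiplies all integrals by the same factor. *)
Lemma ge0_linear_exchange (f q : V -> R) :
  measurable_fun setT f -> measurable_fun setT q ->
  (forall x, 0 <= f x) -> (forall x, 0 <= q x) ->
  ((\int[mu]_x (f (B *m x))%:E) * (\int[mu]_x (q x)%:E) =
   (\int[mu]_x (q (B *m x))%:E) * (\int[mu]_x (f x)%:E))%E.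
Proof.
move=> mf mq f0 q0.
have mB := measurable_mulmxV B.
have mfB : measurable_fun [set: V] (fun x : V => f (B *m x)) by exact: measurableT_comp.
have mqB : measurable_fun [set: V] (fun x : V => q (B *m x)) by exact: measurableT_comp.
have mfE : measurable_fun [set: V] (fun x : V => (f x)%:E) by exact/measurable_EFinP.
have mqE : measurable_fun [set: V] (fun x : V => (q x)%:E) by exact/measurable_EFinP.
have mxy : measurable_fun [set: V * V] (fun p : V * V => B *m p.1 + p.2).
  apply: measurable_fun_cVP => i; under eq_fun do rewrite mxE.
  apply: measurable_funD; last exact: measurable_coord2.
  exact: (measurableT_comp (measurable_coordinate i) (measurableT_comp mB measurable_fst)).
have mxy' : measurable_fun [set: V * V] (fun p : V * V => B *m p.1 - p.2).
  apply: measurable_fun_cVP => i; under eq_fun do rewrite mxE.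
  apply: measurable_funD.
    exact: (measurableT_comp (measurable_coordinate i) (measurableT_comp mB measurable_fst)).
  under eq_fun do rewrite mxE.
  by apply: measurableT_comp => //; exact: measurable_coord2.
pose F (p : V * V) := (f (B *m p.1) * q (B *m p.1 + p.2))%:E.
pose H (p : V * V) := (f (B *m p.1 - p.2) * q (B *m p.1))%:E.
have mF : measurable_fun setT F.
  apply/measurable_EFinP; apply: measurable_funM.
    exact: (measurableT_comp mfB measurable_fst).
  exact: (measurableT_comp mq mxy).
have mH : measurable_fun setT H.
  apply/measurable_EFinP; apply: measurable_funM.
    exact: (measurableT_comp mf mxy').
  exact: (measurableT_comp mqB measurable_fst).
have F0 p : (0 <= F p)%E by rewrite lee_fin mulr_ge0.
have H0 p : (0 <= H p)%E by rewrite lee_fin mulr_ge0.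
transitivity (\int[mu]_x \int[mu]_y F (x, y))%E.
  rewrite -ge0_integralZr//.
  - apply: eq_integral => x _; rewrite -(ge0_leb_shift (B *m x) mqE)//.
    rewrite -ge0_integralZl//.
    + by apply: eq_integral => y _; rewrite /F/= EFinM addrC.
    + by apply/measurable_EFinP; apply: (measurableT_comp mq); exact: measurable_addV.
    + by move=> y _; rewrite lee_fin.
    + by rewrite lee_fin.
  - exact/measurable_EFinP.
  - by move=> x _; rewrite lee_fin.
  - by apply: integral_ge0 => x _; rewrite lee_fin.
rewrite fubini_tonelli//.
transitivity (\int[mu]_y \int[mu]_x H (x, y))%E.
  apply: eq_integral => y _.
  rewrite -[LHS](ge0_leb_shift (- (B' *m y))); last 2 first.
  - by apply: measurableT_comp => //; exact: measurable_pair2.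
  - by move=> x.
  apply: eq_integral => x _; rewrite /F /H/= mulmxDr mulmxN mulmxA BB' mul1mx.
  by rewrite subrK.
rewrite -fubini_tonelli//.
rewrite -ge0_integralZr//.
- apply: eq_integral => x _; rewrite -(ge0_leb_reflect (B *m x) mfE)//.
  rewrite -ge0_integralZl//.
  + by apply: eq_integral => y _; rewrite /H/= EFinM muleC.
  + apply/measurable_EFinP; apply: (measurableT_comp mf).
    exact: measurable_reflectV.
  + by move=> y _; rewrite lee_fin.
  + by rewrite lee_fin.
- exact/measurable_EFinP.
- by move=> x _; rewrite lee_fin.
- by apply: integral_ge0 => x _; rewrite lee_fin.
Qed.

(** [ge0_linear_exchange] with the indicator of the unit cube as q. The factor is
    finite since the preimage of the cube under B is bounded. *)
Lemma ge0_leb_linear : exists2 c : R, 0 <= c &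
  forall f : V -> R, measurable_fun setT f -> (forall x, 0 <= f x) ->
  (\int[mu]_x (f (B *m x))%:E = c%:E * \int[mu]_x (f x)%:E)%E.
Proof.
pose q := \1_(cube 2^-1) : V -> R.
have mq : measurable_fun setT q by apply: measurable_indic; exact: measurable_cube.
have q0 x : 0 <= q x by [].
have q1 : (\int[mu]_x (q x)%:E = 1)%E.
  rewrite integral_indic ?setIT//; last exact: measurable_cube.
  apply: (etrans (leb_cube _)) => //.
  by rewrite (_ : 2^-1 + 2^-1 = 1) ?expr1n//; field.
have mB := measurable_mulmxV B.
have mqB : measurable_fun [set: V] (fun x : V => q (B *m x)) by exact: measurableT_comp.
have qfin : (\int[mu]_x (q (B *m x))%:E < +oo)%E.
  (* The entries of the inverse bound the coordinates of x by those of B x. *)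
  pose M : R := \sum_i \sum_j `|B' i j|.
  apply: (@le_lt_trans _ _ (mu (cube (M + 1)))); last exact: leb_cube_fin.
  rewrite -[X in (_ <= mu X)%E]setIT -integral_indic//; last exact: measurable_cube.
  apply: ge0_le_integral => //.
  - by move=> x _; rewrite lee_fin.
  - exact/measurable_EFinP.
  - by apply/measurable_EFinP; apply: measurable_indic; exact: measurable_cube.
  move=> x _; rewrite lee_fin /q !indicE.
  case: (boolP (B *m x \in _)) => // /set_mem xQ; rewrite mem_set//.
  move=> i /=; rewrite in_itv/=.
  have xi : `|x i ord0| <= M.
    have -> : x = B' *m (B *m x) by rewrite mulmxA B'B mul1mx.
    rewrite mxE; apply: le_trans (ler_norm_sum _ _ _) _.
    apply: (@le_trans _ _ (\sum_j `|B' i j|)); last first.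
      rewrite /M [leRHS](bigD1 i)//= lerDl.
      by apply: sumr_ge0 => *; apply: sumr_ge0.
    apply: ler_sum => j _; rewrite normrM ler_piMr//.
    have := xQ j; rewrite /= in_itv/= ler_norml => /andP[h1 h2].
    by apply/andP; split; lra.
  move: xi; rewrite ler_norml => /andP[h1 h2].
  by apply/andP; split; lra.
have qge : (0 <= \int[mu]_x (q (B *m x))%:E)%E by apply: integral_ge0 => x _; rewrite lee_fin.
exists (fine (\int[mu]_x (q (B *m x))%:E)); first exact: fine_ge0.
move=> f mf f0; rewrite fineK ?ge0_fin_numE//.
by rewrite -ge0_linear_exchange// q1 mule1.
Qed.

Lemma cint_leb_linear : exists2 c : R, 0 <= c &
  forall f : V -> R[i], cintegrable mu f ->
  cint mu (fun x => f (B *m x)) = c%:C * cint mu f.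
Proof.
have [c c0 cP] := ge0_leb_linear; exists c => // f fi.
have mB := measurable_mulmxV B.
suff key (h : V -> R) : mu.-integrable setT (EFin \o h) ->
    (\int[mu]_x h (B *m x) = c * \int[mu]_x h x)%R.
  have /cintegrableP[ir ii] := fi.
  apply: eqc; rewrite ?ReM ?ImM /= ?mul0r ?subr0 ?addr0.
    exact: (key (fun x => Re (f x))).
  exact: (key (fun x => Im (f x))).
move=> ih; have mh : measurable_fun setT h by apply/measurable_EFinP; exact: measurable_int ih.
pose hp x := Num.max (h x) 0; pose hm x := Num.max (- h x) 0.
have mhp : measurable_fun setT hp by apply: measurable_maxr.
have mhm : measurable_fun setT hm by apply: measurable_maxr => //; exact: measurableT_comp.
have pmE (k : V -> V) x : h (k x) = hp (k x) - hm (k x).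
  by rewrite /hp /hm; have [h0|h0] := leP 0 (h (k x));
    [rewrite (max_r _) ?subr0// oppr_le0|rewrite (max_l _) ?sub0r ?opprK// oppr_ge0 ltW].
have ip : mu.-integrable setT (EFin \o hp).
  apply: le_integrable ih => //; first exact/measurable_EFinP.
  move=> x _ /=; rewrite lee_fin /hp; have [h0|h0] := leP 0 (h x) => //.
  by rewrite normr0.
have im : mu.-integrable setT (EFin \o hm).
  apply: le_integrable ih => //; first exact/measurable_EFinP.
  move=> x _ /=; rewrite lee_fin /hm; have [h0|h0] := leP 0 (- h x) => //.
    by rewrite normrN.
  by rewrite normr0.
have comp (k : V -> R) : mu.-integrable setT (EFin \o k) -> measurable_fun setT k ->
    (forall x, 0 <= k x) ->
    mu.-integrable setT (EFin \o (fun x => k (B *m x))) /\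
    (\int[mu]_x k (B *m x) = c * \int[mu]_x k x)%R.
  move=> ik mk k0.
  have kE := cP _ mk k0.
  have kfin : (\int[mu]_x (k x)%:E)%E \is a fin_num by exact: integrable_fin_num.
  split; last by rewrite /Rintegral kE fineM.
  apply/integrableP; split.
    by apply/measurable_EFinP; exact: measurableT_comp.
  under eq_integral do rewrite /= ger0_norm//.
  by rewrite kE ltey_eq fin_numM.
have [ip' pE] := comp _ ip mhp (fun x => ltac:(by rewrite /hp le_max lexx orbT)).
have [im' mE] := comp _ im mhm (fun x => ltac:(by rewrite /hm le_max lexx orbT)).
under eq_Rintegral do rewrite (pmE (fun x => B *m x)).
under [in RHS]eq_Rintegral do rewrite (pmE id).
by rewrite !RintegralB// pE mE mulrBr.
Qed.

End linear_change_of_variables.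

(** * The Laplace and Poisson kernels on the line *)

Section line_kernel.
Variable R : realType.
Local Notation lam := (@lebesgue_measure R).

Definition laplace (e t : R) : R := expR (- (e * `|t|)).

(** The Fourier transform of [laplace e], which is the Cauchy density of scale
    e / (2 pi). *)
Definition poisson_kernel (e z : R) : R := 2 * e / (e ^+ 2 + (2 * pi * z) ^+ 2).

Lemma integral0y_antiderivative (F f : R -> R) (l : R) :
  (forall t, 0 <= f t) -> continuous f -> (forall t : R, is_derive t (1 : R) F (f t)) ->
  F t @[t --> +oo] --> l ->
  (\int[lam]_(t in `[0%R, +oo[) (f t)%:E = (l - F 0)%:E)%E.
Proof.
move=> f0 cf dF Fl.
have cF t : {for t, continuous F}.
  by apply/differentiable_continuous/derivable1_diffP; exact: ex_derive.
rewrite (ge0_continuous_FTC2y _ _ Fl)//.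
- exact: continuous_subspaceT.
- by apply: cvg_at_right_filter; exact: cF.
- by move=> x _; rewrite derive1E; exact: derive_val.
Qed.

Lemma continuous_laplace e : continuous (laplace e).
Proof.
move=> t; apply: (@continuous_comp _ _ _ (fun t => - (e * `|t|)) expR); last exact: continuous_expR.
by apply: cvgN; apply: cvgMr; exact: norm_continuous.
Qed.

Lemma continuous_cosM (w : R) : continuous (fun t : R => cos (w * t)).
Proof.
move=> t; apply: (@continuous_comp _ _ _ (fun t => w * t) cos); last exact: continuous_cos.
exact: mulrl_continuous.
Qed.

Lemma continuous_sinM (w : R) : continuous (fun t : R => sin (w * t)).
Proof.
move=> t; apply: (@continuous_comp _ _ _ (fun t => w * t) sin); last exact: continuous_sin.
exact: mulrl_continuous.
Qed.

Lemma cvg_laplace (e : R) : 0 < e -> expR (- (e * t)) @[t --> +oo] --> (0 : R).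
Proof.
move=> e0; apply: (cvg_comp (fun t => e * t) (fun t => expR (- t))); last exact: cvgr_expR.
exact: gt0_cvgMry.
Qed.

(** Adding 1 to the cosine makes the integrand nonnegative, so that the integral
    over the half-line is the limit of an antiderivative. *)
Lemma integral_laplace_cos1 (e w : R) : 0 < e ->
  (\int[lam]_t (laplace e t * (1 + cos (w * t)))%:E =
   (2 / e + 2 * e / (e ^+ 2 + w ^+ 2))%:E)%E.
Proof.
move=> e0; have ew : 0 < e ^+ 2 + w ^+ 2 by rewrite ltr_pwDl ?sqr_ge0// exprn_gt0.
have cos1 t : 0 <= 1 + cos t :> R by have := cos_geN1 t; lra.
have f0 t : 0 <= laplace e t * (1 + cos (w * t)) by rewrite mulr_ge0// expR_ge0.
rewrite ge0_symfun_integralT//; last 2 first.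
- move=> t; apply: cvgM; first exact: continuous_laplace.
  by apply: cvgD; [exact: cvg_cst|exact: continuous_cosM].
- by move=> t /=; rewrite /laplace normrN mulrN cosN.
rewrite -set_itvcy.
pose f t := expR (- (e * t)) * (1 + cos (w * t)).
(* Integrating by parts twice gives the antiderivative F = expR (- e t) G of f. *)
pose G t := - e^-1 + (w * sin (w * t) - e * cos (w * t)) / (e ^+ 2 + w ^+ 2).
pose F t := expR (- (e * t)) * G t.
rewrite (_ : (\int[lam]_(t in _) _)%E = (\int[lam]_(t in `[0%R, +oo[) (f t)%:E)%E); last first.
  apply: eq_integral => t; rewrite inE/= in_itv/= andbT => t0.
  by rewrite /laplace ger0_norm.
have -> : (\int[lam]_(t in `[0%R, +oo[) (f t)%:E = (0 - F 0)%:E)%E; last first.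
  rewrite -EFinM; congr EFin; rewrite /F /G !mulr0 oppr0 expR0 sin0 cos0.
  by field; lra.
apply: integral0y_antiderivative.
- by move=> t; rewrite mulr_ge0 ?expR_ge0.
- move=> t; apply: cvgM.
    apply: (@continuous_comp _ _ _ (fun t => - (e * t)) expR); last exact: continuous_expR.
    by apply: cvgN; exact: mulrl_continuous.
  by apply: cvgD; [exact: cvg_cst|exact: continuous_cosM].
- move=> t; rewrite /F /G.
  apply: is_derive_eq.
  rewrite /f /GRing.scale/=; field; lra.
- pose C := e^-1 + (`|w| + e) / (e ^+ 2 + w ^+ 2).
  have GC t : `|G t| <= C.
    rewrite /G /C (le_trans (ler_normD _ _))// normrN.
    rewrite (gtr0_norm (_ : 0 < e^-1)) ?invr_gt0// lerD2l.
    rewrite normrM (gtr0_norm (_ : 0 < (_)^-1)) ?invr_gt0// ler_pM2r ?invr_gt0//.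
    rewrite (le_trans (ler_normB _ _))// !normrM (gtr0_norm e0).
    rewrite lerD//; first by rewrite ler_piMr// ler_norml sin_geN1 sin_le1.
    by apply: (ler_piMr (ltW e0)); rewrite ler_norml cos_geN1 cos_le1.
  apply: (@squeeze_cvgr _ _ _ _ (fun t => - C * expR (- (e * t))) (fun t => C * expR (- (e * t)))).
  + apply: nearW => t; rewrite /F mulNr -ler_norml normrM ger0_norm ?expR_ge0// mulrC.
    by rewrite ler_wpM2r ?expR_ge0.
  + by rewrite -(mulr0 (- C)); apply: cvgMr; exact: cvg_laplace.
  + by rewrite -[X in _ --> X](mulr0 C); apply: cvgMr; exact: cvg_laplace.
Qed.

Lemma continuous_poisson (e : R) : 0 < e -> continuous (poisson_kernel e).
Proof.
move=> e0 z; have den : 0 < e ^+ 2 + (2 * pi * z) ^+ 2 by rewrite ltr_pwDl ?sqr_ge0// exprn_gt0.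
apply: cvgM; first exact: cvg_cst.
apply: cvgV; first by rewrite gt_eqF.
apply: cvgD; first exact: cvg_cst.
apply: (@continuous_comp _ _ _ (fun z => 2 * pi * z) (fun z => z ^+ 2)).
  exact: mulrl_continuous.
exact: exprn_continuous.
Qed.

Lemma poisson_ge0 (e z : R) : 0 < e -> 0 <= poisson_kernel e z.
Proof.
move=> e0; rewrite divr_ge0// ?mulr_ge0//; first exact: ltW.
by rewrite addr_ge0// sqr_ge0.
Qed.

Lemma integral_poisson (e : R) : 0 < e -> (\int[lam]_z (poisson_kernel e z)%:E = 1)%E.
Proof.
move=> e0; have pi0 := pi_gt0 R.
have den z : 0 < e ^+ 2 + (2 * pi * z) ^+ 2 by rewrite ltr_pwDl ?sqr_ge0// exprn_gt0.
have c0 z : 0 <= poisson_kernel e z by exact: poisson_ge0.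
have cc := continuous_poisson e0.
rewrite ge0_symfun_integralT//; last first.
  by move=> z /=; rewrite /poisson_kernel mulrN sqrrN.
rewrite -set_itvcy.
pose F z : R := pi^-1 * atan (2 * pi / e * z).
have -> : (\int[lam]_(t in `[0%R, +oo[) (poisson_kernel e t)%:E = (pi^-1 * (pi / 2) - F 0)%:E)%E; last first.
  by rewrite -EFinM; congr EFin; rewrite /F mulr0 atan0; move: pi0; move: (pi : R) => p p0; field; lra.
apply: integral0y_antiderivative => //.
- move=> z; rewrite /F; apply: is_derive_eq.
  rewrite /poisson_kernel /GRing.scale/=; move: (den z) pi0; move: (pi : R) => p dz p0.
  by field; rewrite !gt_eqF.
- apply: cvgMr; apply: (cvg_comp (fun z => 2 * pi / e * z) atan); last exact: cvgy_atan.
  by apply: gt0_cvgMry => //; rewrite divr_gt0// mulr_gt0.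
Qed.

Lemma integrable_laplace (e : R) : 0 < e -> lam.-integrable setT (EFin \o laplace e).
Proof.
move=> e0; have ml : measurable_fun setT (laplace e).
  by apply: continuous_measurable_fun; exact: continuous_laplace.
apply/integrableP; split; first exact/measurable_EFinP.
apply: (@le_lt_trans _ _ (\int[lam]_t (laplace e t * (1 + cos (0 * t)))%:E)%E); last first.
  by rewrite integral_laplace_cos1// ltry.
apply: ge0_le_integral => //.
- by apply/measurable_EFinP; apply: measurableT_comp.
- apply/measurable_EFinP; under eq_fun do rewrite mul0r.
  by apply: measurable_funM => //; exact: measurable_cst.
- move=> t _; rewrite lee_fin ger0_norm ?expR_ge0//.
  by rewrite mul0r cos0 ler_peMr ?expR_ge0//; lra.
Qed.

Lemma laplace_integral (e : R) : 0 < e -> (\int[lam]_t laplace e t = 2 / e)%R.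
Proof.
move=> e0; have := integral_laplace_cos1 0 e0.
rewrite (_ : (fun t => _) = fun t => (2 * laplace e t)%:E); last first.
  by apply/funext => t; rewrite mul0r cos0 mulrC.
move=> /(congr1 fine); rewrite -/(Rintegral _ _ _) RintegralZl//; last exact: integrable_laplace.
rewrite /= expr0n addr0 => h; apply: (mulfI (_ : 2 != 0 :> R)) => //.
by rewrite h; field; lra.
Qed.

(** The real part is read off [integral_laplace_cos1]; the imaginary part is the
    integral of an odd function. *)
Lemma laplace_fourier (e u : R) : 0 < e ->
  cint lam (fun t => (laplace e t)%:C * (cos (2 * pi * (t * u)) -i* sin (2 * pi * (t * u))))
  = (poisson_kernel e u)%:C.
Proof.
move=> e0; have il := integrable_laplace e0.
have ml : measurable_fun setT (laplace e).
  by apply: continuous_measurable_fun; exact: continuous_laplace.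
pose w := 2 * pi * u.
have wE t : 2 * pi * (t * u) = w * t by rewrite /w; ring.
have mc : measurable_fun setT (fun t => cos (w * t)).
  by apply: continuous_measurable_fun; exact: continuous_cosM.
have ms : measurable_fun setT (fun t => sin (w * t)).
  by apply: continuous_measurable_fun; exact: continuous_sinM.
have ic : lam.-integrable setT (fun t => (laplace e t * cos (w * t))%:E).
  apply: le_integrable il => //; first exact/measurable_EFinP/measurable_funM.
  move=> t _ /=; rewrite lee_fin normrM ler_piMr// ler_norml.
  by rewrite cos_geN1 cos_le1.
apply: eqc => /=.
  under eq_Rintegral do rewrite mul0r subr0 wE.
  have h : (\int[lam]_t (laplace e t * (1 + cos (w * t))) = 2 / e + poisson_kernel e u)%R.
    by rewrite /Rintegral integral_laplace_cos1// /poisson_kernel.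
  move: h; under eq_Rintegral do rewrite mulrDr mulr1.
  by rewrite RintegralD// laplace_integral// => /addrI.
under eq_Rintegral do rewrite mul0r addr0 wE mulrN.
pose h t := - (laplace e t * sin (w * t)).
have mh : measurable_fun setT h by apply: measurableT_comp => //; exact: measurable_funM.
have hN : (\int[lam]_t h (- t) = \int[lam]_t h t)%R.
  congr fine; apply: (@integral_preserving _ _ _ lam -%R _ _ (EFin \o h)) => //.
  - exact: lebesgue_measureN.
  - exact/measurable_EFinP.
have ih : lam.-integrable setT (EFin \o h).
  apply: le_integrable il => //; first exact/measurable_EFinP.
  move=> t _ /=; rewrite lee_fin normrN normrM ler_piMr// ler_norml.
  by rewrite sin_geN1 sin_le1.
have : (\int[lam]_t h (- t) = - \int[lam]_t h t)%R.
  rewrite -mulN1r -RintegralZl//; apply: eq_Rintegral => t _.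
  by rewrite /h /laplace normrN mulrN sinN; ring.
by move=> /eqP; rewrite hN -subr_eq0 opprK -mulr2n mulrn_eq0/= => /eqP.
Qed.

End line_kernel.

(** * Characters and product kernels *)

Section characters.
Variables (R : realType).

Definition cis (t : R) : R[i] := cos t -i* sin t.

Lemma cisD s t : cis (s + t) = cis s * cis t.
Proof.
apply: eqc; rewrite ?ReM ?ImM /= ?cosD ?sinD; ring.
Qed.

Lemma cis0 : cis 0 = 1.
Proof. by rewrite /cis cos0 sin0 oppr0. Qed.

Lemma cisN t : cis (- t) = conjc (cis t).
Proof. by rewrite /cis cosN sinN. Qed.

Lemma normc_cis t : normc (cis t) = 1.
Proof. by rewrite /= sqrrN cos2Dsin2 sqrtr1. Qed.

Lemma cmeas_cis d (T : measurableType d) (h : T -> R) : measurable_fun setT h ->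
  cmeas (fun x => cis (h x)).
Proof.
move=> mh; split.
  by apply: (measurableT_comp _ mh); apply: continuous_measurable_fun; exact: continuous_cos.
apply: (measurableT_comp (f := fun t => - sin t) _ mh).
by apply: measurableT_comp => //; apply: continuous_measurable_fun; exact: continuous_sin.
Qed.

Variable n : nat.
Local Notation V := 'cV[R]_n.

Definition character (x xi : V) : R[i] := cis (2 * pi * inner x xi).

Lemma innerC (x y : V) : inner x y = inner y x.
Proof. by apply: eq_bigr => i _; rewrite mulrC. Qed.

Lemma innerDl (x y z : V) : inner (x + y) z = inner x z + inner y z.
Proof. by rewrite /inner -big_split; apply: eq_bigr => i _; rewrite mxE mulrDl. Qed.

Lemma innerNl (x z : V) : inner (- x) z = - inner x z.
Proof. by rewrite /inner -sumrN; apply: eq_bigr => i _; rewrite mxE mulNr. Qed.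

Lemma innerZl (a : R) (x z : V) : inner (a *: x) z = a * inner x z.
Proof. by rewrite /inner mulr_sumr; apply: eq_bigr => i _; rewrite mxE mulrA. Qed.

Lemma innerDr (x y z : V) : inner z (x + y) = inner z x + inner z y.
Proof. by rewrite innerC innerDl !(innerC z). Qed.

Lemma innerNr (x z : V) : inner z (- x) = - inner z x.
Proof. by rewrite innerC innerNl innerC. Qed.

Lemma innerZr (a : R) (x z : V) : inner z (a *: x) = a * inner z x.
Proof. by rewrite innerC innerZl innerC. Qed.

Lemma characterC x y : character x y = character y x.
Proof. by rewrite /character innerC. Qed.

Lemma characterDl x y z : character (x + y) z = character x z * character y z.
Proof. by rewrite /character innerDl mulrDr cisD. Qed.

Lemma characterNl x z : character (- x) z = conjc (character x z).
Proof. by rewrite /character innerNl mulrN cisN. Qed.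

Lemma normc_character x z : normc (character x z) = 1.
Proof. exact: normc_cis. Qed.

Lemma cmeas_character2 : cmeas (fun p : V * V => character p.1 p.2).
Proof.
by apply: cmeas_cis; apply: measurable_funM => //; exact: measurable_innerVV.
Qed.

Lemma cmeas_character z : cmeas (fun x : V => character x z).
Proof.
by apply: cmeas_cis; apply: measurable_funM => //; exact: measurable_inner.
Qed.

Lemma fourierE (f : V -> R[i]) xi :
  fourier f xi = cint (leb R n) (fun x => f x * character x xi).
Proof. by []. Qed.

End characters.

Section product_functions.
Variable R : realType.
Local Notation lam := (@lebesgue_measure R).

Lemma cint_leb_succ n (F : 'cV[R]_n.+1 -> R[i]) : cmeas F ->
  (\int[lam]_t \int[leb R n]_x (normc (F (cV_cons (t, x))))%:E < +oo)%E ->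
  cintegrable (leb R n.+1) F /\
  cint (leb R n.+1) F = cint lam (fun t => cint (leb R n) (fun x => F (cV_cons (t, x)))).
Proof.
move=> mF Foo; have mc := @measurable_cV_cons R n.
have iF : cintegrable (leb R n.+1) F.
  split=> //; rewrite ge0_integral_leb_succ//; first exact: measurable_normcE.
  by move=> x; rewrite lee_fin normc_ge0.
have mFc : cmeas (fun p : measurableTypeR R * 'cV[R]_n => F (cV_cons p)) by exact: cmeas_comp mF.
split=> //; rewrite -(cint_prod mFc)//.
have /cintegrableP[ir ii] : cintegrable (lam \x leb R n)%E (fun p => F (cV_cons p)).
  split=> //; rewrite fubini_tonelli1//; first exact: measurable_normcE.
  by move=> x; rewrite lee_fin normc_ge0.
congr Complex; congr fine.
  rewrite (_ : (\int[leb R n.+1]_x (Re (F x))%:E)%E =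
   (\int[pushforward (@lebesgue_measure R \x leb R n)%E (@cV_cons R n)]_(x in setT) (Re (F x))%:E)%E)//.
  rewrite integral_pushforward//.
  by apply/measurable_EFinP; exact: mF.1.
rewrite (_ : (\int[leb R n.+1]_x (Im (F x))%:E)%E =
 (\int[pushforward (@lebesgue_measure R \x leb R n)%E (@cV_cons R n)]_(x in setT) (Im (F x))%:E)%E)//.
rewrite integral_pushforward//.
by apply/measurable_EFinP; exact: mF.2.
Qed.

Lemma cmeas_prod d (T : measurableType d) (I : Type) (r : seq I) (u : I -> T -> R[i]) :
  (forall i, cmeas (u i)) -> cmeas (fun x => \prod_(i <- r) u i x).
Proof.
move=> mu; elim: r => [|i r IH].
  by under eq_fun do rewrite big_nil; exact: cmeas_cst.
by under eq_fun do rewrite big_cons; exact: cmeasM.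
Qed.

(** By induction on the dimension, splitting off the first coordinate. *)
Lemma cint_leb_prod n (u : 'I_n -> measurableTypeR R -> R[i]) :
  (forall i, cintegrable lam (u i)) ->
  cintegrable (leb R n) (fun x => \prod_i u i (x i ord0)) /\
  cint (leb R n) (fun x => \prod_i u i (x i ord0)) = \prod_i cint lam (u i).
Proof.
elim: n u => [|n IH] u iu.
  split.
    split; first by under eq_fun do rewrite big_ord0; exact: cmeas_cst.
    under eq_integral do rewrite big_ord0.
    by rewrite ge0_integral_leb0 ?ltry.
  rewrite big_ord0; under eq_cint do rewrite big_ord0.
  by apply: eqc; rewrite /= /Rintegral ge0_integral_leb0.
pose v (i : 'I_n) := u (lift ord0 i).
have [iv vE] := IH v (fun i => iu (lift ord0 i)).
have FE t x : \prod_(i < n.+1) u i (cV_cons (t, x) i ord0) = u ord0 t * \prod_i v i (x i ord0).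
  rewrite big_ord_recl mxE unlift_none/=; congr (_ * _).
  by apply: eq_bigr => i _; rewrite mxE liftK.
have mF : cmeas (fun x : 'cV[R]_n.+1 => \prod_i u i (x i ord0)).
  apply: cmeas_prod => i; apply: cmeas_comp (iu i).1.
  exact: (measurable_coordinate i).
have [|iF ->] := cint_leb_succ mF.
  have vfin : (\int[leb R n]_x (normc (\prod_i v i (x i ord0)))%:E)%E \is a fin_num.
    rewrite ge0_fin_numE; first exact: iv.2.
    by apply: integral_ge0 => x _; rewrite lee_fin normc_ge0.
  rewrite (_ : (\int[lam]_t _)%E = (\int[lam]_t ((normc (u ord0 t))%:E *
      \int[leb R n]_x (normc (\prod_i v i (x i ord0)))%:E))%E); last first.
    apply: eq_integral => t _; rewrite -ge0_integralZl//.
    - by apply: eq_integral => x _; rewrite FE normcM EFinM.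
    - exact: measurable_normcE iv.1.
    - by move=> x _; rewrite lee_fin normc_ge0.
    - by rewrite lee_fin normc_ge0.
  rewrite ge0_integralZr//.
  - by rewrite ltey_eq fin_numM// ge0_fin_numE; [exact: (iu ord0).2|apply: integral_ge0 => x _; rewrite lee_fin normc_ge0].
  - exact: measurable_normcE (iu ord0).1.
  - by move=> x _; rewrite lee_fin normc_ge0.
  - by apply: integral_ge0 => x _; rewrite lee_fin normc_ge0.
split=> //; rewrite big_ord_recl -vE -cintZr//.
apply: eq_cint => t; rewrite -cintZ//.
by apply: eq_cint => x; exact: FE.
Qed.

End product_functions.

Section product_kernel.
Variables (R : realType) (n : nat).
Local Notation V := 'cV[R]_n.
Local Notation mu := (leb R n).
Local Notation lam := (@lebesgue_measure R).

Definition laplace_prod (e : R) (xi : V) : R := \prod_i laplace e (xi i ord0).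
Definition poisson_prod (e : R) (z : V) : R := \prod_i poisson_kernel e (z i ord0).

Lemma laplace_prod_ge0 e xi : 0 <= laplace_prod e xi.
Proof. by apply: prodr_ge0 => i _; exact: expR_ge0. Qed.

Lemma laplace_prodE e xi : laplace_prod e xi = expR (- (e * \sum_i `|xi i ord0|)).
Proof.
by rewrite /laplace_prod -expR_sum; congr expR; rewrite sumrN mulr_sumr.
Qed.

Lemma poisson_prod_ge0 e z : 0 < e -> 0 <= poisson_prod e z.
Proof. by move=> e0; apply: prodr_ge0 => i _; exact: poisson_ge0. Qed.

Lemma laplace_C e : 0 < e -> cintegrable lam (fun t => (laplace e t)%:C).
Proof.
move=> e0; apply/cintegrableP => /=; split; first exact: integrable_laplace.
by apply: integrable0.
Qed.

Lemma poisson_C e : 0 < e ->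
  cintegrable lam (fun t => (poisson_kernel e t)%:C) /\ cint lam (fun t => (poisson_kernel e t)%:C) = 1.
Proof.
move=> e0; split.
  split; first by apply: cmeas_real; apply: continuous_measurable_fun; exact: continuous_poisson.
  under eq_integral do rewrite normc_real ger0_norm ?poisson_ge0//.
  by rewrite integral_poisson// ltry.
apply: eqc => /=; last by rewrite Rintegral_cst// mul0r.
by rewrite /Rintegral integral_poisson.
Qed.

Lemma laplace_prod_C e xi : (laplace_prod e xi)%:C = \prod_i (laplace e (xi i ord0))%:C.
Proof. by rewrite rmorph_prod. Qed.

Lemma poisson_prod_C e xi : (poisson_prod e xi)%:C = \prod_i (poisson_kernel e (xi i ord0))%:C.
Proof. by rewrite rmorph_prod. Qed.

Lemma cintegrable_laplace_prod e : 0 < e -> cintegrable mu (fun xi => (laplace_prod e xi)%:C).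
Proof.
move=> e0; have [] := @cint_leb_prod R n (fun=> fun t => (laplace e t)%:C) (fun=> laplace_C e0).
by move=> h _; under eq_fun do rewrite laplace_prod_C.
Qed.

Lemma measurable_laplace_prod e : measurable_fun [set: V] (laplace_prod e).
Proof.
apply: measurable_prod => i _; apply: measurableT_comp.
  by apply: continuous_measurable_fun; exact: continuous_laplace.
exact: measurable_coordinate.
Qed.

Lemma measurable_poisson_prod e : 0 < e -> measurable_fun [set: V] (poisson_prod e).
Proof.
move=> e0; apply: measurable_prod => i _; apply: measurableT_comp.
  by apply: continuous_measurable_fun; exact: continuous_poisson.
exact: measurable_coordinate.
Qed.

Lemma integral_poisson_prod e : 0 < e -> (\int[mu]_z (poisson_prod e z)%:E = 1)%E.
Proof.
move=> e0.
have [iF FE] := @cint_leb_prod R n (fun=> fun t => (poisson_kernel e t)%:C) (fun=> (poisson_C e0).1).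
have : cint mu (fun x => (poisson_prod e x)%:C) = 1.
  under eq_cint do rewrite poisson_prod_C.
  by rewrite FE big1// => i _; exact: (poisson_C e0).2.
move=> /(congr1 (@complex.Re R)) /= h; rewrite -h /Rintegral fineK//.
apply: integrable_fin_num => //.
suff /cintegrableP[] : cintegrable mu (fun x => (poisson_prod e x)%:C) by [].
by under eq_fun do rewrite poisson_prod_C.
Qed.

Lemma character_prod (x z : V) :
  character x z = \prod_i cis (2 * pi * (x i ord0 * z i ord0)).
Proof.
rewrite /character /inner mulr_sumr.
by elim/big_rec2: _ => [|i a b _ <-]; [rewrite cis0|rewrite cisD].
Qed.

Lemma laplace_prod_fourier e z : 0 < e ->
  cint mu (fun xi => (laplace_prod e xi)%:C * character xi z) = (poisson_prod e z)%:C.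
Proof.
move=> e0; pose u (i : 'I_n) (t : measurableTypeR R) : R[i] :=
  (laplace e t)%:C * cis (2 * pi * (t * z i ord0)).
have iu i : cintegrable lam (u i).
  apply: (cintegrable_le _ (laplace_C e0)).
  - apply: cmeasM; first exact: (laplace_C e0).1.
    by apply: cmeas_cis; apply: measurable_funM => //; exact: measurable_funM.
  - by move=> t; rewrite /u normcM normc_cis mulr1.
have [_ uE] := cint_leb_prod iu.
rewrite poisson_prod_C -(eq_bigr _ (fun i _ => laplace_fourier (z i ord0) e0)).
rewrite -uE; apply: eq_cint => xi.
by rewrite laplace_prod_C character_prod -big_split.
Qed.

(** The kernels are the dilates of a single one, hence an approximate identity. *)
Lemma poisson_prod_scale e w : 0 < e ->
  poisson_prod e (e *: w) = e ^- n * poisson_prod 1 w.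
Proof.
move=> e0; rewrite /poisson_prod.
rewrite (eq_bigr (fun i => e^-1 * poisson_kernel 1 (w i ord0))); last first.
  move=> i _; rewrite mxE /poisson_kernel; move: (pi : R) => p.
  have ? : 0 < 1 + (2 * p * w i ord0) ^+ 2 by rewrite ltr_pwDl ?sqr_ge0.
  have -> : e ^+ 2 + (2 * p * (e * w i ord0)) ^+ 2 = e ^+ 2 * (1 + (2 * p * w i ord0) ^+ 2) by ring.
  by rewrite expr1n invfM; field; rewrite !gt_eqF.
by rewrite big_split/= prodr_const card_ord exprVn.
Qed.

End product_kernel.

(** * Continuity of translations in the mean square *)

Section square_norm.
Variables (R : realType) (n : nat).
Local Notation V := 'cV[R]_n.
Local Notation mu := (leb R n).
Implicit Types f g : V -> R[i].

Lemma sqnorm_ge0 f : (0 <= sqnorm f)%E.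
Proof. by apply: integral_ge0 => x _; rewrite lee_fin sqr_ge0. Qed.

Lemma le_sqnorm f g : cmeas f -> cmeas g -> (forall x, normc (f x) <= normc (g x)) ->
  (sqnorm f <= sqnorm g)%E.
Proof.
move=> mf mg fg; apply: ge0_le_integral => //.
- by move=> x _; rewrite lee_fin sqr_ge0.
- exact: measurable_normc2E.
- exact: measurable_normc2E.
- by move=> x _; rewrite lee_fin lerXn2r ?nnegrE ?normc_ge0.
Qed.

Lemma eq_sqnorm f g : (forall x, normc (f x) = normc (g x)) -> sqnorm f = sqnorm g.
Proof. by move=> fg; apply: eq_integral => x _; rewrite fg. Qed.

(** A substitute for Minkowski's inequality that stays with squared norms: a
    small t shows that the squared norm is continuous. *)
Lemma sqnormD_weighted (t : R) f g : 0 < t -> cmeas f -> cmeas g ->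
  (sqnorm (fun x => f x + g x)%R <= (1 + t)%:E * sqnorm f + (1 + t^-1)%:E * sqnorm g)%E.
Proof.
move=> t0 mf mg; have mf2 := measurable_normc2E mf; have mg2 := measurable_normc2E mg.
have t1 : 0 <= 1 + t by lra.
have t2 : 0 <= 1 + t^-1 by rewrite addr_ge0// invr_ge0 ltW.
have p f' x : (0 <= (normc (f' x : R[i]) ^+ 2)%:E)%E by rewrite lee_fin sqr_ge0.
rewrite -!ge0_integralZl ?lee_fin//; try by move=> x _; exact: p.
rewrite -ge0_integralD//.
- apply: ge0_le_integral => //.
  + by move=> x _; rewrite lee_fin sqr_ge0.
  + by apply: measurable_normc2E; exact: cmeasD.
  + by apply: emeasurable_funD; exact: measurable_funeM.
  + by move=> x _; rewrite -!EFinM -EFinD lee_fin normcD_weighted.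
- by move=> x _; rewrite mule_ge0 ?lee_fin// sqr_ge0.
- exact: measurable_funeM.
- by move=> x _; rewrite mule_ge0 ?lee_fin// sqr_ge0.
- exact: measurable_funeM.
Qed.

Lemma sqnormD_le f g : cmeas f -> cmeas g ->
  (sqnorm (fun x => f x + g x)%R <= 2%:E * sqnorm f + 2%:E * sqnorm g)%E.
Proof. by move=> mf mg; have := sqnormD_weighted ltr01 mf mg; rewrite invr1. Qed.

Lemma sqnormZ (c : R[i]) f : cmeas f ->
  sqnorm (fun x => c * f x) = ((normc c ^+ 2)%:E * sqnorm f)%E.
Proof.
move=> mf; rewrite -ge0_integralZl ?lee_fin ?sqr_ge0//.
- by apply: eq_integral => x _; rewrite normcM exprMn EFinM.
- exact: measurable_normc2E.
- by move=> x _; rewrite lee_fin sqr_ge0.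
Qed.

Lemma sqnorm_shift (c : V) f : cmeas f -> sqnorm (fun x => f (x + c)) = sqnorm f.
Proof.
move=> mf; apply: (ge0_leb_shift c (f := fun x => (normc (f x) ^+ 2)%:E)).
  exact: measurable_normc2E.
by move=> x; rewrite lee_fin sqr_ge0.
Qed.

Lemma cmeas_shift (c : V) f : cmeas f -> cmeas (fun x : V => f (x + c)).
Proof. by apply: cmeas_comp; exact: measurable_addV. Qed.

Lemma in_L2D f g : in_L2 f -> in_L2 g -> in_L2 (fun x => f x + g x).
Proof.
move=> [mf fi] [mg gi]; split; first exact: cmeasD.
apply: le_lt_trans (sqnormD_le mf mg) _.
by rewrite lte_add_pinfty// lte_mul_pinfty.
Qed.

Lemma in_L2Z (c : R[i]) f : in_L2 f -> in_L2 (fun x => c * f x).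
Proof.
move=> [mf fi]; split; first by apply: cmeasM => //; exact: cmeas_cst.
by rewrite sqnormZ// lte_mul_pinfty// lee_fin sqr_ge0.
Qed.

Lemma in_L2B f g : in_L2 f -> in_L2 g -> in_L2 (fun x => f x - g x).
Proof.
move=> fi gi; have := in_L2D fi (in_L2Z (-1) gi).
by under eq_fun do rewrite mulN1r.
Qed.

Lemma in_L2_shift (c : V) f : in_L2 f -> in_L2 (fun x => f (x + c)).
Proof. by move=> [mf fi]; split; [exact: cmeas_shift|rewrite sqnorm_shift]. Qed.

Lemma in_L2_le (f g : V -> R[i]) : cmeas f -> in_L2 g ->
  (forall x, normc (f x) <= normc (g x)) -> in_L2 f.
Proof. by move=> mf [mg goo] fg; split=> //; apply: le_lt_trans goo; exact: le_sqnorm. Qed.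

Lemma in_L2_fin f : in_L2 f -> sqnorm f \is a fin_num.
Proof. by move=> [_ foo]; rewrite ge0_fin_numE// sqnorm_ge0. Qed.

End square_norm.

Section vanishing_sequences.
Variable R : realType.

Lemma lee_twice2 (a b : \bar R) (x y : R) : (a <= x%:E)%E -> (b <= y%:E)%E ->
  (2%:E * a + 2%:E * b <= (2 * x + 2 * y)%:E)%E.
Proof.
move=> ax bY; rewrite [(2 * x + 2 * y)%:E]EFinD; apply: leeD.
  have -> : ((2 * x)%:E = 2%:E * x%:E)%E by rewrite -EFinM.
  by apply: lee_wpmul2l.
have -> : ((2 * y)%:E = 2%:E * y%:E)%E by rewrite -EFinM.
by apply: lee_wpmul2l.
Qed.

Lemma cvge0P (u : nat -> \bar R) : (forall k, 0 <= u k)%E ->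
  u @ \oo --> 0%E <-> forall e : R, 0 < e -> \forall k \near \oo, (u k <= e%:E)%E.
Proof.
move=> u0; split=> [/fine_cvgP[ufin /cvgr0Pnorm_le u0'] e e0|h].
  near=> k; have uk : u k \is a fin_num by near: k.
  rewrite -(fineK uk) lee_fin (le_trans (ler_norm _))//.
  by near: k; exact: u0'.
apply/fine_cvgP; split.
  near=> k; rewrite ge0_fin_numE// (@le_lt_trans _ _ 1%:E) ?ltry//.
  by near: k; exact: h.
apply/cvgr0Pnorm_le => e e0; near=> k.
have uk : (u k <= e%:E)%E by near: k; exact: h.
have uf : u k \is a fin_num by rewrite ge0_fin_numE// (le_lt_trans uk) ?ltry.
by rewrite /= ger0_norm ?fine_ge0// -lee_fin fineK.
Unshelve. all: by end_near.
Qed.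

End vanishing_sequences.

Section translation_continuity.
Import HBNNSimple.
Variables (R : realType) (n : nat).
Local Notation V := 'cV[R]_n.
Local Notation mu := (leb R n).
Implicit Types f g : V -> R[i].

Variables (z : nat -> V) (Z : R).
Hypothesis z0 : forall i, z k i ord0 @[k --> \oo] --> (0 : R).
Hypothesis zZ : forall k i, `|z k i ord0| <= Z.

Let diff k f := sqnorm (fun x => f x - f (x - z k)).

(** Continuity at 0 is expressed along one bounded sequence z of vectors that
    tends to 0 coordinatewise, the form used with dominated convergence. *)
Definition translation_continuous f := in_L2 f /\ diff k f @[k --> \oo] --> 0%E.

Let diff_ge0 k f : (0 <= diff k f)%E.
Proof. exact: sqnorm_ge0. Qed.

Lemma translation_continuousD f g :
  translation_continuous f -> translation_continuous g ->
  translation_continuous (fun x => f x + g x).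
Proof.
move=> [f2 fc] [g2 gc]; split; first exact: in_L2D.
have mf := f2.1; have mg := g2.1.
have := (cvge0P _).1 fc; have := (cvge0P _).1 gc => /(_ (fun k => diff_ge0 k g)) {}gc /(_ (fun k => diff_ge0 k f)) {}fc.
apply/cvge0P => // e e0.
have e4 : 0 < e / 4 by rewrite divr_gt0.
near=> k.
apply: (@le_trans _ _ (2%:E * diff k f + 2%:E * diff k g)%E).
  rewrite /diff (_ : (fun x => _) = fun x => (f x - f (x - z k)) + (g x - g (x - z k))); last first.
    by apply/funext => x; ring.
  by apply: sqnormD_le; apply: cmeasB => //; exact: cmeas_shift.
have -> : e = 2 * (e / 4) + 2 * (e / 4) by field.
by apply: lee_twice2; near: k; [exact: fc|exact: gc].
Unshelve. all: by end_near.
Qed.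

Lemma translation_continuousZ (c : R[i]) f :
  translation_continuous f -> translation_continuous (fun x => c * f x).
Proof.
move=> [f2 fc]; split; first exact: in_L2Z.
have mf := f2.1.
rewrite (_ : (fun k => _) = fun k => ((normc c ^+ 2)%:E * diff k f)%E); last first.
  apply/funext => k; rewrite /diff -sqnormZ; last by apply: cmeasB => //; exact: cmeas_shift.
  by apply: eq_sqnorm => x; rewrite mulrBr.
by rewrite -[X in _ --> X](mule0 (normc c ^+ 2)%:E); apply: cvgeZl.
Qed.

Lemma translation_continuousB f g :
  translation_continuous f -> translation_continuous g ->
  translation_continuous (fun x => f x - g x).
Proof.
move=> fc gc; have := translation_continuousD fc (translation_continuousZ (-1) gc).
by under eq_fun do rewrite mulN1r.
Qed.

(** Translations preserve the norm, so that f - f (. - z) differs from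
    g - g (. - z) by at most twice the distance of f and g. *)
Lemma translation_continuous_closed f : in_L2 f ->
  (forall e : R, 0 < e -> exists2 g, translation_continuous g &
     (sqnorm (fun x => f x - g x)%R <= e%:E)%E) ->
  translation_continuous f.
Proof.
move=> f2 fg; split=> //; apply/cvge0P => // e e0.
have e12 : 0 < e / 12 by rewrite divr_gt0.
have [g [g2 gc] fge] := fg _ e12.
have mf := f2.1; have mg := g2.1.
have {}gc := (cvge0P (fun k => diff_ge0 k g)).1 gc.
near=> k.
have gk : (diff k g <= (e / 12)%:E)%E by near: k; exact: gc.
have mfg : cmeas (fun x => f x - g x) by exact: cmeasB.
have msh (h : V -> R[i]) : cmeas h -> cmeas (fun x : V => h x - h (x - z k)).
  by move=> mh; apply: cmeasB => //; exact: cmeas_shift.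
rewrite /diff (_ : (fun x => _) = fun x => (f x - g x) +
   ((g x - g (x - z k)) + (-1) * (f (x - z k) - g (x - z k)))); last first.
  by apply/funext => x; ring.
have m3 : cmeas (fun x : V => (-1) * (f (x - z k) - g (x - z k))).
  by apply: cmeasM; [exact: cmeas_cst|exact: (cmeas_shift (- z k) mfg)].
apply: le_trans (sqnormD_le mfg (cmeasD (msh _ mg) m3)) _.
rewrite (_ : e%:E = (2 * (e / 12) + 2 * (2 * (e / 12) + 2 * (e / 12)) + 2 * (e / 12))%:E); last by congr EFin; field.
apply: (@le_trans _ _ (2 * (e / 12) + 2 * (2 * (e / 12) + 2 * (e / 12)))%:E); last first.
  by rewrite lee_fin lerDl mulr_ge0// ltW.
apply: lee_twice2 => //.
apply: le_trans (sqnormD_le (msh _ mg) m3) _.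
apply: lee_twice2 => //.
rewrite sqnormZ; last exact: (cmeas_shift (- z k) mfg).
rewrite normc_opp normc_real normr1 expr1n mul1e.
by rewrite (sqnorm_shift (- z k) mfg).
Unshelve. all: by end_near.
Qed.

Lemma sqnorm_dominated (F : nat -> V -> R[i]) f (g : V -> R) :
  (forall k, cmeas (F k)) -> cmeas f ->
  (forall x, normc (F k x - f x) @[k --> \oo] --> (0 : R)) ->
  (forall k x, normc (F k x - f x) ^+ 2 <= g x) ->
  mu.-integrable setT (EFin \o g) ->
  sqnorm (fun x => f x - F k x) @[k --> \oo] --> 0%E.
Proof.
move=> mF mf Ff Fg ig.
have [] := @dominated_convergence _ _ _ mu setT measurableT
  (fun k x => (normc (f x - F k x) ^+ 2)%:E) (cst 0%E) (EFin \o g).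
- by move=> k; apply: measurable_normc2E; exact: cmeasB.
- exact: measurable_cst.
- apply: aeW => x _; apply/fine_cvgP; split; first exact: nearW.
  rewrite (_ : _ \o _ = fun k => normc (F k x - f x) * normc (F k x - f x)); last first.
    by apply/funext => k /=; rewrite expr2 -normc_opp opprB.
  by rewrite -[X in _ --> X](mulr0 (0 : R)); apply: cvgM; exact: Ff.
- exact: ig.
- apply: aeW => x k _ /=; rewrite lee_fin ger0_norm ?sqr_ge0//.
  by rewrite -normc_opp opprB.
- by move=> _ _; rewrite integral0.
Qed.

Lemma translation_continuous_dominated (F : nat -> V -> R[i]) f (g : V -> R) :
  (forall k, translation_continuous (F k)) -> in_L2 f ->
  (forall x, normc (F k x - f x) @[k --> \oo] --> (0 : R)) ->
  (forall k x, normc (F k x - f x) ^+ 2 <= g x) ->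
  mu.-integrable setT (EFin \o g) ->
  translation_continuous f.
Proof.
move=> Fc f2 Ff Fg ig; apply: translation_continuous_closed => // e e0.
have := sqnorm_dominated (fun k => (Fc k).1.1) f2.1 Ff Fg ig.
move=> /(cvge0P (fun k => sqnorm_ge0 _)).1 /(_ _ e0) [k _ kP].
by exists (F k) => //; apply: kP => /=.
Qed.

Definition indicator (A : set V) : V -> R[i] := fun x => (\1_A x)%:C.

Lemma cmeas_indicator A : measurable A -> cmeas (indicator A).
Proof. by move=> mA; apply: cmeas_real; exact: measurable_indic. Qed.

Lemma normc_indicator A x : normc (indicator A x) = \1_A x.
Proof. by rewrite normc_real ger0_norm. Qed.

Lemma sqnorm_indicator A : measurable A -> sqnorm (indicator A) = mu A.
Proof.
move=> mA; rewrite -[in RHS](setIT A) -integral_indic//; apply: eq_integral => x _.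
by rewrite normc_indicator indicE; case: (_ \in _); rewrite ?expr1n ?expr0n.
Qed.

Lemma in_L2_indicator A m : measurable A -> A `<=` cube m -> in_L2 (indicator A).
Proof.
move=> mA Am; split; first exact: cmeas_indicator.
rewrite sqnorm_indicator//; apply: le_lt_trans (leb_cube_fin n m).
by apply: le_measure; rewrite ?inE//; exact: measurable_cube.
Qed.

Lemma leb_hyperplane i (c : R) : mu [set x : V | x i ord0 = c] = 0%E.
Proof.
pose A (j : 'I_n) : set (measurableTypeR R) := if j == i then [set c] else setT.
have mA j : measurable (A j) by rewrite /A; case: ifPn => // _; exact: measurable_set1.
have -> : [set x : V | x i ord0 = c] = [set x | forall j, A j (x j ord0)].
  apply/seteqP; split => x /=.
    by move=> xc j; rewrite /A; case: eqP => [->|].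
  by move=> /(_ i); rewrite /A eqxx.
apply: (etrans (leb_box mA)).
by rewrite (bigD1 i)//= /A eqxx lebesgue_measure_set1 mul0e.
Qed.

Definition closed_box (l c : 'I_n -> R) : set V :=
  [set x | forall i, `[l i, c i]%classic (x i ord0)].

Lemma measurable_closed_box l c : measurable (closed_box l c).
Proof. exact (@measurable_box R n (fun i => `[l i, c i]%classic) (fun=> measurable_itv _)). Qed.

(** Off the hyperplanes through its faces, which are null sets, the indicator of
    a box is locally constant; all translates vanish outside a larger cube. *)
Lemma translation_continuous_box (m : R) (l c : 'I_n -> R) :
  (forall i, - m <= l i) -> (forall i, c i <= m) ->
  translation_continuous (indicator (closed_box l c)).
Proof.
move=> lm cm.
have mB := measurable_closed_box l c.
have sB : closed_box l c `<=` cube m.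
  move=> x xB i; have := xB i; rewrite /= !in_itv/= => /andP[h1 h2].
  by rewrite (le_trans (lm i) h1) (le_trans h2 (cm i)).
split; first exact: (in_L2_indicator mB sB).
have [] := @dominated_convergence _ _ _ mu setT measurableT
  (fun k x => (normc (indicator (closed_box l c) x - indicator (closed_box l c) (x - z k)) ^+ 2)%:E)
  (cst 0%E) (EFin \o \1_(cube (`|m| + `|Z|))).
- move=> k; apply: measurable_normc2E; apply: cmeasB; first exact: cmeas_indicator.
  by apply: (cmeas_shift (- z k)); exact: cmeas_indicator.
- exact: measurable_cst.
- pose H i t := [set x : V | x i ord0 = t].
  have neg i t : (mu).-negligible (H i t).
    exists (H i t); split => //; last exact: leb_hyperplane.
    rewrite (_ : H i t = coordinates i @^-1` [set t])//.
    by rewrite -[X in measurable X]setTI; apply: measurable_coordinate.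
  have : {ae mu, forall x : V, forall i, x i ord0 <> l i /\ x i ord0 <> c i}.
    apply: filter_forall => i.
    have aeH t : {ae mu, forall x : V, x i ord0 <> t}.
      by apply: negligibleS (neg i t) => x /= /contrapT.
    by apply: filterS2 (aeH (l i)) (aeH (c i)) => x.
  apply: filterS => x xH _.
  apply: cvg_near_cst.
  have : \forall k \near \oo, forall i, `[l i, c i]%classic ((x - z k) i ord0) <-> `[l i, c i]%classic (x i ord0).
    apply: filter_forall => i.
    have [x1 x2] := xH i.
    have d1 : 0 < `|x i ord0 - l i| by rewrite normr_gt0 subr_eq0; apply/eqP.
    have d2 : 0 < `|x i ord0 - c i| by rewrite normr_gt0 subr_eq0; apply/eqP.
    have := @z0 i => /cvgr0Pnorm_lt zi.
    near=> k.
    have h1 : `|z k i ord0| < `|x i ord0 - l i| by near: k; exact: zi.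
    have h2 : `|z k i ord0| < `|x i ord0 - c i| by near: k; exact: zi.
    rewrite /= !mxE !in_itv/=.
    move: h1 h2; rewrite !ltr_norml; case: (ger0P (x i ord0 - l i)) => ?; case: (ger0P (x i ord0 - c i)) => ? /andP[? ?] /andP[? ?];
    by split => /andP[? ?]; apply/andP; split; lra.
  apply: filterS => k xk.
  have -> : indicator (closed_box l c) (x - z k) = indicator (closed_box l c) x.
    rewrite /indicator !indicE; congr (_%:R%:C); congr nat_of_bool.
    apply/idP/idP => /set_mem h; apply/mem_set => i; exact/xk/h.
  by rewrite subrr normc_real normr0 expr0n.
- apply/integrableP; split.
    by apply/measurable_EFinP; apply: measurable_indic; exact: measurable_cube.
  under eq_integral do rewrite /= ger0_norm//.
  rewrite integral_indic; [|by []|exact: measurable_cube].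
  by rewrite setIT; exact: leb_cube_fin.
- apply: aeW => x k _.
  apply: (@le_trans _ _ (\1_(cube (`|m| + `|Z|)) x)%:E); last by [].
  rewrite gee0_abs; last by rewrite lee_fin sqr_ge0.
  rewrite lee_fin indicE.
  case: (boolP (x \in _)) => xm.
    rewrite /indicator -rmorphB normc_real !indicE.
    by case: (_ \in _); case: (_ \in _); rewrite ?subrr ?subr0 ?sub0r ?normrN ?normr0 ?normr1 ?expr1n ?expr0n/=.
  have out (y : V) : (forall i, `|y i ord0 - x i ord0| <= Z) -> y \notin closed_box l c.
    move=> yx; apply: contra xm => /set_mem yB; apply/mem_set => i.
    have := sB _ yB i; have := yx i; rewrite /= !in_itv/= ler_norml => /andP[? ?] /andP[? ?].
    have := ler_norm m; have := ler_norm Z => ? ?.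
    by apply/andP; split; lra.
  have Z0 (i : 'I_n) : 0 <= Z by apply: le_trans (zZ 0 i); exact: normr_ge0.
  have o1 : (x \in closed_box l c) = false.
    by apply/negbTE/out => i; rewrite subrr normr0 (Z0 i).
  have o2 : (x - z k \in closed_box l c) = false.
    by apply/negbTE/out => i; rewrite !mxE addrAC subrr add0r normrN.
  by rewrite /indicator !indicE o1 o2 subrr normc_real normr0 expr0n.
- by move=> _ _; rewrite integral0.
Unshelve. all: by end_near.
Qed.

(** This family of generators is closed under intersection, as the Dynkin class
    argument of [translation_continuous_indicator] requires. *)
Lemma measurable_orthants : @measurable _ V =
  <<s [set [set x : V | forall i, b i <= x i ord0] | b in [set: 'I_n -> R]] >>.
Proof.
set G := (X in <<s X >>).
have mG : G `<=` measurable.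
  move=> _ [b _ <-].
  rewrite (_ : [set x | _] = [set x : V | forall i, `[b i, +oo[%classic (x i ord0)]).
    exact (@measurable_box R n (fun i => `[b i, +oo[%classic) (fun=> measurable_itv _)).
  by apply/seteqP; split=> x /= xb i; have := xb i; rewrite /= in_itv/= andbT.
apply/seteqP; split; last by apply: smallest_sub; [exact: sigma_algebra_measurable|].
have mc i : @measurable_fun _ _ (g_sigma_algebraType G) (measurableTypeR R) setT (fun x : V => x i ord0).
  apply: (@measurability _ _ (g_sigma_algebraType G) (measurableTypeR R) _ _ (@RGenCInfty.G R)).
    exact: RGenCInfty.measurableE.
  move=> _ [_ [b ->] <-].
  rewrite setTI (_ : _ @^-1` _ = \bigcup_(N : nat) [set x : V | forall j,
      (if j == i then b else - N%:R) <= x j ord0]); last first.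
    apply/seteqP; split=> [x /=|x [N _ /=] /(_ i)]; rewrite in_itv/= andbT; last by rewrite eqxx.
    move=> bx; pose M := \sum_j `|x j ord0|.
    exists (Num.bound M) => // j; case: eqP => [->//|_].
    have h : `|x j ord0| <= M by rewrite /M (bigD1 j)//= lerDl sumr_ge0.
    have M0 : 0 <= M by apply: sumr_ge0.
    have := archi_boundP M0; move: h; rewrite ler_norml => /andP[? _] ?; lra.
  apply: bigcupT_measurable => N; apply: sub_sigma_algebra.
  by exists (fun j => if j == i then b else - N%:R).
apply: smallest_sub; first exact: smallest_sigma_algebra.
case: n => [|n'] in G mG mc *; first by rewrite big_ord0.
rewrite -bigcup_mkord_ord; apply: bigcup_sub => i _ _ [B mB <-].
exact: mc.
Qed.

Lemma indicator_setC A B : A `<=` B -> indicator (B `\` A) = fun x => indicator B x - indicator A x.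
Proof.
move=> AB; apply/funext => x; rewrite /indicator -rmorphB; congr (_%:C).
rewrite !indicE in_setD; have [xA|xA] := boolP (x \in A); last by rewrite andbT subr0.
by rewrite andbF (mem_set (AB _ (set_mem xA))) subrr.
Qed.

Lemma indicator_setU A B : A `&` B = set0 ->
  indicator (A `|` B) = fun x => indicator A x + indicator B x.
Proof.
move=> AB; apply/funext => x; rewrite /indicator -rmorphD; congr (_%:C).
rewrite !indicE in_setU; have [xA|xA] := boolP (x \in A); last by rewrite add0r.
have [xB|xB] := boolP (x \in B); last by rewrite addr0.
have : (A `&` B) x by split; exact: set_mem.
by rewrite AB.
Qed.

Lemma integrable_indicator_cube m : mu.-integrable setT (EFin \o \1_(cube m)).
Proof.
apply/integrableP; split.
  by apply/measurable_EFinP; apply: measurable_indic; exact: measurable_cube.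
under eq_integral do rewrite /= ger0_norm//.
rewrite integral_indic; [|by []|exact: measurable_cube].
by rewrite setIT; exact: leb_cube_fin.
Qed.

(** The measurable sets with this property form a Dynkin class that contains the
    orthants; the cube keeps all measures finite. *)
Lemma translation_continuous_indicator A m : measurable A ->
  translation_continuous (indicator (A `&` cube m)).
Proof.
move=> mA; have mAG := mA; rewrite measurable_orthants in mAG; move: A mAG {mA}.
have Tcube : translation_continuous (indicator (cube m)).
  rewrite (_ : cube m = closed_box (fun=> - m) (fun=> m))//.
  by apply: (@translation_continuous_box m).
apply: dynkin_induction.
- exact: measurable_orthants.
- move=> _ _ [b _ <-] [c _ <-]; exists (fun i => Num.max (b i) (c i)) => //.
  apply/seteqP; split=> x /= => [xbc|[xb xc] i]; last by rewrite ge_max xb xc.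
  by split=> i; have := xbc i; rewrite ge_max => /andP[].
- by rewrite setTI.
- move=> _ [b _ <-]; rewrite (_ : _ `&` _ = closed_box (fun i => Num.max (b i) (- m)) (fun=> m)).
    by apply: (@translation_continuous_box m) => // i; rewrite le_max lexx orbT.
  apply/seteqP; split=> x /=.
    by move=> [xb xm] i; have := xm i; rewrite /= !in_itv/= ge_max xb => /andP[-> ->].
  move=> xbm; split=> i; have := xbm i; rewrite /= !in_itv/= ge_max => /andP[/andP[]] //.
  by move=> _ -> ->.
- move=> S mS ST.
  rewrite (_ : ~` S `&` cube m = cube m `\` (S `&` cube m)).
    by rewrite indicator_setC; [exact: translation_continuousB|exact: subIsetr].
  by rewrite setDIr setDv setU0 setIC setDE.
- move=> F mF tF FT.
  pose U k := \bigcup_(i < k) F i.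
  have mU k : measurable (U k) by apply: bigcup_measurable => i _; exact: mF.
  have UT k : translation_continuous (indicator (U k `&` cube m)).
    elim: k => [|k IH].
      rewrite /U bigcup_mkord big_ord0 set0I.
      have := translation_continuousZ 0 Tcube.
      congr (translation_continuous _); apply/funext => x.
      by rewrite mul0r /indicator indicE in_set0.
    rewrite /U bigcup_mkord big_ord_recr/= -bigcup_mkord setIUl indicator_setU.
      exact: (translation_continuousD IH (FT k)).
    apply/seteqP; split=> // x [[[i /= ik Fi] _] [Fk _]].
    have /trivIsetP/(_ i k I I) := tF.
    rewrite (ltn_eqF ik) => /(_ isT) FF.
    by have : (F i `&` F k) x by []; rewrite FF.
  have mUF : measurable (\bigcup_k F k) by apply: bigcupT_measurable.
  apply: (translation_continuous_dominated (g := \1_(cube m)) UT).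
  + apply: (@in_L2_indicator _ m); last exact: subIsetr.
    by apply: measurableI => //; exact: measurable_cube.
  + move=> x; apply: cvg_near_cst.
    have [[[k _ Fk] xm]|xn] := pselect (((\bigcup_k F k) `&` cube m) x).
      near=> N; have kN : (k < N)%N by near: N; exact: nbhs_infty_gt.
      rewrite /indicator !indicE !mem_set//; first by rewrite subrr normc_real normr0.
        by split=> //; exists k.
      by split=> //; exists k.
    apply: nearW => N; rewrite /indicator !indicE !memNset// ?subrr ?normc_real ?normr0//.
    by move=> [[i _ Fi] xm]; apply: xn; split=> //; exists i.
  + move=> k x; rewrite /indicator -rmorphB normc_real !indicE.
    have [xm|xm] := boolP (x \in cube m).
      by case: (_ \in _); case: (_ \in _); rewrite ?subrr ?subr0 ?sub0r ?normrN ?normr0 ?normr1 ?expr1n ?expr0n/=.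
    by rewrite !in_setI (negbTE xm) !andbF subrr normr0 expr0n.
  + exact: integrable_indicator_cube.
Unshelve. all: by end_near.
Qed.

Lemma translation_continuous_sum (I : Type) (r : seq I) (F : I -> V -> R[i]) :
  (forall i, translation_continuous (F i)) ->
  translation_continuous (fun x => \sum_(i <- r) F i x).
Proof.
move=> FT; elim: r => [|i r IH]; last first.
  by under eq_fun do rewrite big_cons; exact: translation_continuousD.
under eq_fun do rewrite big_nil.
have := translation_continuousZ 0 (@translation_continuous_indicator set0 0 measurable0).
by under eq_fun do rewrite mul0r.
Qed.

(** Simple functions, cut off by growing cubes, increase to g. *)
Lemma translation_continuous_ge0 (g : V -> R) : (forall x, 0 <= g x) ->
  in_L2 (fun x => (g x)%:C) -> translation_continuous (fun x => (g x)%:C).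
Proof.
move=> g0 g2; have mg : measurable_fun setT g := g2.1.1.
have mgE : measurable_fun setT (EFin \o g) by exact/measurable_EFinP.
pose h := nnsfun_approx measurableT mgE.
pose F k x := (h k x * \1_(cube k%:R) x)%:C.
have hg k x : h k x <= g x.
  by rewrite -lee_fin /h nnsfun_approxE; apply: le_approx => // *; rewrite lee_fin.
apply: (translation_continuous_dominated (F := F) (g := fun x => g x ^+ 2)) => //.
- move=> k; have [r rE] : exists r : seq R, forall x,
      h k x = \sum_(y <- r) y * \1_(h k @^-1` [set y]) x.
    exists (finmap.enum_fset (fset_set (range (h k)))) => x.
    by rewrite [LHS]fimfunE fsbig_finite//; exact: fimfunP.
  rewrite (_ : F k = fun x => \sum_(y <- r) (y%:C * indicator ((h k @^-1` [set y]) `&` cube k%:R) x)).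
    apply: translation_continuous_sum => y; apply: translation_continuousZ.
    by apply: translation_continuous_indicator; exact: measurable_sfunP.
  apply/funext => x; rewrite /F rE mulr_suml.
  rewrite rmorph_sum/=; apply: eq_bigr => y _.
  by rewrite /indicator -rmorphM indicI/= mulrA.
- move=> x; under eq_fun do rewrite /F -rmorphB normc_real.
  have /fine_cvgP[_ hx] := cvg_nnsfun_approx measurableT mgE (fun x _ => ltac:(by rewrite lee_fin)) (I : setT x).
  have hx1 : h k x @[k --> \oo] --> g x by exact: hx.
  apply: (@cvg_trans _ ((fun k => `|h k x - g x|) @ \oo)); last first.
    by apply/norm_cvg0P; rewrite -(subrr (g x)); apply: cvgB => //; exact: cvg_cst.
  apply: near_eq_cvg; near=> k.
  rewrite /= indicE mem_set ?mulr1// => i /=; rewrite in_itv/= -ler_norml.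
  apply: (@le_trans _ _ (\sum_j `|x j ord0|)); first by rewrite (bigD1 i)//= lerDl sumr_ge0.
  by near: k; exact: nbhs_infty_ger.
- move=> k x; rewrite /F -rmorphB normc_real real_normK ?num_real//.
  have h0 : 0 <= h k x by [].
  have := hg k x; rewrite indicE; case: (_ \in _) => /= ?; rewrite ?mulr1 ?mulr0; nra.
- have := g2.2; rewrite /sqnorm => goo; apply/integrableP; split.
    by apply/measurable_EFinP; exact: measurable_funX.
  apply: le_lt_trans goo; rewrite le_eqVlt; apply/orP; left; apply/eqP.
  by apply: eq_integral => x _; rewrite normc_real (ger0_norm (g0 x)) /= ger0_norm// sqr_ge0.
Unshelve. all: by end_near.
Qed.

Lemma translation_continuous_real (g : V -> R) :
  in_L2 (fun x => (g x)%:C) -> translation_continuous (fun x => (g x)%:C).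
Proof.
move=> g2; have mg : measurable_fun setT g := g2.1.1.
pose p x := Num.max (g x) 0; pose m x := Num.max (- g x) 0.
have pmE x : g x = p x - m x.
  by rewrite /p /m; have [h0|h0] := leP 0 (g x);
    [rewrite (max_r _) ?subr0// oppr_le0|rewrite (max_l _) ?sub0r ?opprK// oppr_ge0 ltW].
have p0 x : 0 <= p x by rewrite le_max lexx orbT.
have m0 x : 0 <= m x by rewrite le_max lexx orbT.
have pT : translation_continuous (fun x => (p x)%:C).
  apply: translation_continuous_ge0 => //; apply: in_L2_le g2 _.
    by apply: cmeas_real; exact: measurable_maxr.
  move=> x; rewrite !normc_real ger0_norm//.
  by rewrite /p; have [] := leP 0 (g x) => // ?; rewrite ler_norm.
have mT : translation_continuous (fun x => (m x)%:C).
  apply: translation_continuous_ge0 => //; apply: in_L2_le g2 _.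
    by apply: cmeas_real; apply: measurable_maxr => //; exact: measurableT_comp.
  move=> x; rewrite !normc_real ger0_norm//.
  by rewrite /m; have [] := leP 0 (- g x) => // ?; rewrite -normrN ler_norm.
have := translation_continuousB pT mT.
by under eq_fun do rewrite -rmorphB -pmE.
Qed.

Theorem translation_continuous_L2 f : in_L2 f -> translation_continuous f.
Proof.
move=> f2; have mf := f2.1.
have fr : translation_continuous (fun x => (Re (f x))%:C).
  apply: translation_continuous_real; apply: in_L2_le f2 _.
    by apply: cmeas_real; exact: mf.1.
  by move=> x; rewrite normc_real Re_le_normc.
have fi : translation_continuous (fun x => (Im (f x))%:C).
  apply: translation_continuous_real; apply: in_L2_le f2 _.
    by apply: cmeas_real; exact: mf.2.
  by move=> x; rewrite normc_real Im_le_normc.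
have := translation_continuousD fr (translation_continuousZ 'i fi).
by congr translation_continuous; apply/funext => x; rewrite -complexE.
Qed.

End translation_continuity.

(** * Plancherel's identity *)

Lemma emul_fin_inj (R : realType) (c : R) (x y : \bar R) : 0 < c ->
  (c%:E * x = c%:E * y)%E -> x = y.
Proof.
move=> c0 /(congr1 (fun t => (c^-1)%:E * t)%E).
by rewrite !muleA -!EFinM mulVf ?gt_eqF// !mul1e.
Qed.

Section fourier_basics.
Variables (R : realType) (n : nat).
Local Notation V := 'cV[R]_n.
Local Notation mu := (leb R n).
Implicit Types f g : V -> R[i].

Lemma cmeas_pair1 f : cmeas f -> cmeas (fun p : V * V => f p.1).
Proof. by apply: cmeas_comp; exact: measurable_fst. Qed.

Lemma cmeas_pair2 f : cmeas f -> cmeas (fun p : V * V => f p.2).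
Proof. by apply: cmeas_comp; exact: measurable_snd. Qed.

Lemma cmeas_sub f : cmeas f -> cmeas (fun p : V * V => f (p.1 - p.2)).
Proof. by apply: cmeas_comp; exact: measurable_subVV. Qed.

Lemma cmeas_reflect (c : V) f : cmeas f -> cmeas (fun x : V => f (c - x)).
Proof. by apply: cmeas_comp; exact: measurable_reflectV. Qed.

Lemma cintegrable_character f xi : cintegrable mu f ->
  cintegrable mu (fun x => f x * character x xi).
Proof.
move=> fi; apply: (cintegrable_le _ fi).
  by apply: cmeasM; [exact: fi.1|exact: cmeas_character].
by move=> x; rewrite normcM normc_character mulr1.
Qed.

Lemma cmeas_fourier f : cmeas f -> cmeas (fourier f).
Proof.
move=> mf.
apply: (@cmeas_cint2 _ _ _ _ _ mu (fun p : V * V => f p.1 * character p.1 p.2)).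
by apply: cmeasM; [exact: cmeas_pair1|exact: cmeas_character2].
Qed.

Definition norm1 f : R := fine (\int[mu]_x (normc (f x))%:E).

Lemma norm1E f : cintegrable mu f -> ((norm1 f)%:E = \int[mu]_x (normc (f x))%:E)%E.
Proof.
move=> [_ foo]; rewrite fineK// ge0_fin_numE//.
by apply: integral_ge0 => x _; rewrite lee_fin normc_ge0.
Qed.

Lemma normc_fourier_le f xi : cintegrable mu f -> normc (fourier f xi) <= norm1 f.
Proof.
move=> fi; rewrite -lee_fin norm1E// fourierE.
apply: le_trans (normc_cint_le (cintegrable_character xi fi)) _.
rewrite le_eqVlt; apply/orP; left; apply/eqP; apply: eq_integral => x _.
by rewrite normcM normc_character mulr1.
Qed.

Lemma fourier_shift f (z xi : V) : cintegrable mu f ->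
  fourier (fun x => f (x - z)) xi = character z xi * fourier f xi.
Proof.
move=> fi; rewrite !fourierE -cintZ; last exact: cintegrable_character.
pose F x := character z xi * (f x * character x xi).
have mF : cmeas F.
  by apply: cmeasM; [exact: cmeas_cst|exact: (cintegrable_character xi fi).1].
rewrite -(cint_leb_shift (- z) mF); apply: eq_cint => x.
rewrite /F mulrCA; congr (_ * _).
by rewrite -characterDl addrC subrK.
Qed.

Lemma fourierB f g xi : cintegrable mu f -> cintegrable mu g ->
  fourier (fun x => f x - g x) xi = fourier f xi - fourier g xi.
Proof.
move=> fi gi; rewrite !fourierE -cintB; try exact: cintegrable_character.
by apply: eq_cint => x; rewrite mulrBl.
Qed.

Lemma fourierZ (c : R[i]) f xi : cintegrable mu f ->
  fourier (fun x => c * f x) xi = c * fourier f xi.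
Proof.
move=> fi; rewrite !fourierE -cintZ; last exact: cintegrable_character.
by apply: eq_cint => x; rewrite mulrA.
Qed.

End fourier_basics.

Section plancherel.
Variables (R : realType) (n : nat).
Local Notation V := 'cV[R]_n.
Local Notation mu := (leb R n).
Local Notation P := (@laplace_prod R n).
Local Notation p := (@poisson_prod R n).

Variable f : V -> R[i].
Hypotheses (f1 : cintegrable mu f) (f2 : in_L2 f).

Let mf : cmeas f := f1.1.

Let gauge e : cmeas (fun xi : V => (P e xi)%:C).
Proof. by apply: cmeas_real; exact: measurable_laplace_prod. Qed.

(** The factor P makes the double integral absolutely convergent. *)
Lemma fubini_laplace (e : R) (u g : V -> R[i]) (k : V * V -> R[i]) (c : R) :
  0 < e -> cintegrable mu u -> cmeas g -> (forall xi, normc (g xi) <= c) ->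
  cmeas k -> (forall q, normc (k q) = 1) ->
  cint mu (fun xi => (P e xi)%:C * g xi * cint mu (fun x => u x * k (x, xi))) =
  cint mu (fun x => u x * cint mu (fun xi => (P e xi)%:C * g xi * k (x, xi))).
Proof.
move=> e0 ui mg gc mk k1.
have c0 : 0 <= c by apply: le_trans (gc 0); exact: normc_ge0.
have Pi := cintegrable_laplace_prod n e0.
have Pgi : cintegrable mu (fun xi => (P e xi)%:C * g xi).
  apply: (cintegrable_le _ (cintegrableZ c%:C Pi)); first by apply: cmeasM => //; exact: gauge.
  move=> xi; rewrite !normcM mulrC ler_wpM2r ?normc_ge0//.
  by rewrite normc_real ger0_norm.
have mk1 xi : cmeas (fun x => k (x, xi)) by apply: cmeas_comp mk; exact: measurable_pair2.
have mk2 x : cmeas (fun xi => k (x, xi)) by apply: cmeas_comp mk; exact: measurable_pair1.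
pose F (q : V * V) := (P e q.1)%:C * g q.1 * (u q.2 * k (q.2, q.1)).
have mF : cmeas F.
  apply: cmeasM; first exact: (cmeas_pair1 Pgi.1).
  apply: cmeasM; first exact: (cmeas_pair2 ui.1).
  apply: cmeas_comp mk.
  by apply: measurable_fun_pair; [exact: measurable_snd|exact: measurable_fst].
transitivity (cint mu (fun xi => cint mu (fun x => F (xi, x)))).
  apply: eq_cint => xi; rewrite /F/= cintZ//; apply: (cintegrable_le _ ui).
    by apply: cmeasM => //; exact: ui.1.
  by move=> x; rewrite normcM k1 mulr1.
rewrite cfubini//; last first.
  rewrite (_ : (\int[mu]_x _)%E = (\int[mu]_xi ((normc ((P e xi)%:C * g xi))%:E * (norm1 u)%:E))%E); last first.
    apply: eq_integral => xi _; rewrite norm1E// -ge0_integralZl ?lee_fin ?normc_ge0//.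
    - apply: eq_integral => x _.
      by rewrite /F normcM [normc (u x * _)]normcM k1 mulr1 EFinM.
    - exact: measurable_normcE ui.1.
    - by move=> x _; rewrite lee_fin normc_ge0.
  rewrite ge0_integralZr//.
  - by rewrite -norm1E// -EFinM ltry.
  - exact: measurable_normcE Pgi.1.
  - by move=> x _; rewrite lee_fin normc_ge0.
  - by rewrite norm1E//; apply: integral_ge0 => x _; rewrite lee_fin normc_ge0.
apply: eq_cint => x; rewrite /F/= -cintZ.
  by apply: eq_cint => xi; ring.
apply: (cintegrable_le _ Pgi).
  by apply: cmeasM => //; exact: Pgi.1.
by move=> xi; rewrite normcM k1 mulr1.
Qed.

Lemma poisson_prod_le e z : 0 < e -> p e z <= norm1 (fun xi => (P e xi)%:C).
Proof.
move=> e0; have Pi := cintegrable_laplace_prod n e0.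
have := normc_fourier_le z Pi; rewrite fourierE laplace_prod_fourier// normc_real.
by apply: le_trans; exact: ler_norm.
Qed.

Lemma cint_leb_reflect (c : V) (G : V -> R[i]) : cmeas G ->
  cint mu (fun x => G (c - x)) = cint mu G.
Proof.
move=> mG; have mG' : cmeas (fun x : V => G (- x)).
  by apply: cmeas_comp mG; exact: measurable_oppV.
rewrite -[RHS](cint_leb_opp mG) -[RHS](cint_leb_shift (- c) mG').
by apply: eq_cint => x; rewrite opprB.
Qed.

(** Both transforms are written as integrals, and the frequency variable is
    integrated first: it turns P into the Poisson kernel at x - y, and z stands
    for x - y. *)
Lemma regularized_energy e : 0 < e ->
  cint mu (fun xi => (P e xi)%:C * conjc (fourier f xi) * fourier f xi) =
  cint mu (fun x => cint mu (fun z => (p e z)%:C * (f x * conjc (f (x - z))))).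
Proof.
move=> e0; have Pi := cintegrable_laplace_prod n e0.
have mchar := @cmeas_character2 R n.
rewrite (@fubini_laplace e f (fun xi => conjc (fourier f xi)) (fun q => character q.1 q.2) (norm1 f))//; last 3 first.
- by apply: cmeas_conj; exact: cmeas_fourier.
- by move=> xi; rewrite normc_conj; exact: normc_fourier_le.
- by move=> q; exact: normc_character.
apply: eq_cint => x.
have cf1 := cintegrable_conj f1.
have step : cint mu (fun xi => (P e xi)%:C * conjc (fourier f xi) * character x xi) =
    cint mu (fun y => conjc (f y) * (p e (x - y))%:C).
  transitivity (cint mu (fun xi => (P e xi)%:C * character x xi *
      cint mu (fun y => conjc (f y) * conjc (character y xi)))).
    apply: eq_cint => xi; rewrite mulrAC; congr (_ * _).
    rewrite fourierE -cint_conj; last exact: cintegrable_character.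
    by apply: eq_cint => y; rewrite conjM.
  rewrite (@fubini_laplace e _ _ (fun q => conjc (character q.1 q.2)) 1)//; last 4 first.
  - rewrite (_ : character x = fun xi => character xi x); first exact: cmeas_character.
    by apply/funext => xi; rewrite characterC.
  - by move=> xi; rewrite normc_character.
  - exact: cmeas_conj.
  - by move=> q; rewrite normc_conj normc_character.
  apply: eq_cint => y; congr (_ * _); rewrite -laplace_prod_fourier//; apply: eq_cint => xi.
  cbn [fst snd]; by rewrite -mulrA -characterNl -characterDl characterC.
rewrite /= step.
pose G y := f x * (conjc (f y) * (p e (x - y))%:C).
have mp : cmeas (fun y : V => (p e (x - y))%:C).
  apply: cmeas_real; apply: measurableT_comp; first exact: measurable_poisson_prod.
  exact: measurable_reflectV.
have mG : cmeas G.
  by apply: cmeasM; [exact: cmeas_cst|apply: cmeasM => //; exact: cmeas_conj].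
rewrite -cintZ; last first.
  pose c := norm1 (fun xi => (P e xi)%:C).
  have c0 : 0 <= c by apply: le_trans (poisson_prod_le 0 e0); exact: poisson_prod_ge0.
  apply: (cintegrable_le _ (cintegrableZ c%:C cf1)).
    by apply: cmeasM => //; exact: cmeas_conj.
  move=> y; rewrite !normcM mulrC ler_wpM2r ?normc_ge0// !normc_real.
  by rewrite !ger0_norm ?poisson_prod_ge0//; exact: poisson_prod_le.
rewrite -[LHS](cint_leb_reflect x mG); apply: eq_cint => z.
by rewrite /G subKr; ring.
Qed.

Let modulus (z : V) := sqnorm (fun x => f x - f (x - z)).

(** Polarization, 2 Re (a b^* ) = |a|^2 + |b|^2 - |a - b|^2, in the correlations
    of [regularized_energy]. The kernel has total mass 1, hence each of the two
    squares contributes the full energy of f. *)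
Lemma plancherel_defect e : 0 < e ->
  (2%:E * (\int[mu]_xi (P e xi * normc (fourier f xi) ^+ 2)%:E) +
   \int[mu]_z ((p e z)%:E * modulus z) = 2%:E * sqnorm f)%E.
Proof.
move=> e0.
pose u0 (q : V * V) := p e q.2 * Re (f q.1 * conjc (f (q.1 - q.2))).
pose u1 (q : V * V) := p e q.2 * normc (f q.1) ^+ 2.
pose u2 (q : V * V) := p e q.2 * normc (f (q.1 - q.2)) ^+ 2.
pose u3 (q : V * V) := p e q.2 * normc (f q.1 - f (q.1 - q.2)) ^+ 2.
have mp : measurable_fun [set: V] (p e) by exact: measurable_poisson_prod.
have mp2 : measurable_fun [set: V * V] (fun q : V * V => p e q.2) by exact: measurableT_comp.
have pp z : 0 <= p e z by exact: poisson_prod_ge0.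
have m1 : cmeas (fun q : V * V => f q.1) by exact: cmeas_pair1.
have m2 : cmeas (fun q : V * V => f (q.1 - q.2)) by exact: cmeas_sub.
have mu1 : measurable_fun setT (EFin \o u1).
  by apply/measurable_EFinP; apply: measurable_funM => //; exact: measurable_normc2.
have mu2 : measurable_fun setT (EFin \o u2).
  by apply/measurable_EFinP; apply: measurable_funM => //; exact: measurable_normc2.
have mu3 : measurable_fun setT (EFin \o u3).
  by apply/measurable_EFinP; apply: measurable_funM => //; apply: measurable_normc2; exact: cmeasB.
have pos1 q : (0 <= (EFin \o u1) q)%E by rewrite lee_fin mulr_ge0// sqr_ge0.
have pos2 q : (0 <= (EFin \o u2) q)%E by rewrite lee_fin mulr_ge0// sqr_ge0.
have pos3 q : (0 <= (EFin \o u3) q)%E by rewrite lee_fin mulr_ge0// sqr_ge0.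
have int_p (c : \bar R) : (0 <= c)%E -> (\int[mu]_z ((p e z)%:E * c) = c)%E.
  move=> c0; rewrite ge0_integralZr//; last 2 first.
  - exact/measurable_EFinP.
  - by move=> z _; rewrite lee_fin.
  by rewrite integral_poisson_prod// mul1e.
have mf2 := measurable_normc2E mf.
have E1 : (\int[mu \x mu]_q (u1 q)%:E = sqnorm f)%E.
  rewrite (fubini_tonelli2 (EFin \o u1))// -[RHS](int_p _ (sqnorm_ge0 _)).
  apply: eq_integral => z _; rewrite /fubini_G/= /sqnorm -ge0_integralZl ?lee_fin//.
  by move=> x _; rewrite lee_fin sqr_ge0.
have E2 : (\int[mu \x mu]_q (u2 q)%:E = sqnorm f)%E.
  rewrite (fubini_tonelli2 (EFin \o u2))// -[RHS](int_p _ (sqnorm_ge0 _)).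
  apply: eq_integral => z _; rewrite /fubini_G/= -(sqnorm_shift (- z) mf) /sqnorm -ge0_integralZl ?lee_fin//.
  - by apply: measurable_normc2E; exact: cmeas_shift.
  - by move=> x _; rewrite lee_fin sqr_ge0.
have E3 : (\int[mu \x mu]_q (u3 q)%:E = \int[mu]_z ((p e z)%:E * modulus z))%E.
  rewrite (fubini_tonelli2 (EFin \o u3))//.
  apply: eq_integral => z _; rewrite /fubini_G/= /modulus /sqnorm -ge0_integralZl ?lee_fin//.
  - by apply: measurable_normc2E; apply: cmeasB => //; exact: (cmeas_shift (- z)).
  - by move=> x _; rewrite lee_fin sqr_ge0.
have i1 : (mu \x mu)%E.-integrable setT (EFin \o u1).
  apply/integrableP; split => //; under eq_integral do rewrite gee0_abs//.
  by rewrite E1; exact: f2.2.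
have i2 : (mu \x mu)%E.-integrable setT (EFin \o u2).
  apply/integrableP; split => //; under eq_integral do rewrite gee0_abs//.
  by rewrite E2; exact: f2.2.
have polar q : u3 q = u1 q + u2 q - 2 * u0 q.
  rewrite /u0 /u1 /u2 /u3 !normc_sqrE ReM ReB ImB ReJ ImJ; ring.
pose F (q : V * V) := (p e q.2)%:C * (f q.1 * conjc (f (q.1 - q.2))).
have mF : cmeas F.
  apply: cmeasM; first exact: cmeas_real.
  by apply: cmeasM => //; exact: cmeas_conj.
have Fle q : normc (F q) <= u1 q + u2 q.
  rewrite /F !normcM normc_real ger0_norm// normc_conj /u1 /u2 -mulrDr ler_wpM2l//.
  have := normc_ge0 (f q.1); have := normc_ge0 (f (q.1 - q.2)); nra.
have iF : cintegrable (mu \x mu)%E F.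
  split=> //; have /integrableP[_] := integrableD measurableT i1 i2.
  apply: le_lt_trans; apply: ge0_le_integral => //=.
  - by move=> q _; rewrite lee_fin normc_ge0.
  - exact: measurable_normcE.
  - apply/measurable_EFinP; apply: measurableT_comp => //.
    by apply: measurable_funD; apply/measurable_EFinP.
  - move=> q _; rewrite lee_fin (le_trans (Fle q))// ler_norm//.
have FE : Re (cint (mu \x mu)%E F) = (\int[(mu \x mu)%E]_q u0 q)%R.
  by apply: eq_Rintegral => q _; rewrite /F ReM /= mul0r subr0.
have i0 : (mu \x mu)%E.-integrable setT (EFin \o u0).
  have /cintegrableP[+ _] := iF; apply: eq_integrable => // q _.
  by rewrite /F ReM /= mul0r subr0.
have i3 : (mu \x mu)%E.-integrable setT (EFin \o u3).
  rewrite (_ : EFin \o u3 = fun q => ((u1 q + u2 q)%:E - (2 * u0 q)%:E)%E); last first.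
    by apply/funext => q /=; rewrite polar.
  apply: integrableB => //; last exact: integrable_scale.
  by rewrite (_ : (fun q => _) = (EFin \o u1) \+ (EFin \o u2)); [exact: integrableD|apply/funext].
have R12 : (\int[(mu \x mu)%E]_q u3 q + 2 * \int[(mu \x mu)%E]_q u0 q = 2 * fine (sqnorm f))%R.
  rewrite -RintegralZl// -RintegralD//; last exact: integrable_scale.
  rewrite (_ : (fun q => _) = fun q => u1 q + u2 q); last first.
    by apply/funext => q; rewrite polar; ring.
  by rewrite RintegralD// /Rintegral E1 E2; ring.
have mfh : measurable_fun setT (fun xi => P e xi * normc (fourier f xi) ^+ 2).
  apply: measurable_funM; first exact: measurable_laplace_prod.
  by apply: measurable_normc2; exact: cmeas_fourier.
have n0 : 0 <= norm1 f := le_trans (normc_ge0 _) (normc_fourier_le 0 f1).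
have ifh : mu.-integrable setT (fun xi => (P e xi * normc (fourier f xi) ^+ 2)%:E).
  have /cintegrableP[+ _] := cintegrableZ (norm1 f ^+ 2)%:C (cintegrable_laplace_prod n e0).
  apply: le_integrable => //; first exact/measurable_EFinP.
  move=> xi _; rewrite /= mul0r subr0 lee_fin !ger0_norm ?mulr_ge0 ?sqr_ge0 ?laplace_prod_ge0//.
  rewrite mulrC ler_wpM2r ?laplace_prod_ge0// lerXn2r ?nnegrE ?normc_ge0//.
  exact: normc_fourier_le.
have key : (\int[mu]_xi (P e xi * normc (fourier f xi) ^+ 2) = \int[(mu \x mu)%E]_q u0 q)%R.
  rewrite -FE cint_prod//; last first.
    by rewrite -(fubini_tonelli1 (fun q => (normc (F q))%:E));
      [exact: iF.2|exact: measurable_normcE|move=> q; rewrite lee_fin normc_ge0].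
  rewrite -(regularized_energy e0); apply: eq_Rintegral => xi _.
  by move: (fourier f xi) => t; rewrite !ReM !ImM ReJ ImJ normc_sqrE /=; ring.
rewrite -E3.
have -> : (\int[mu]_xi (P e xi * normc (fourier f xi) ^+ 2)%:E)%E = (\int[(mu \x mu)%E]_q u0 q)%:E.
  by rewrite -key /Rintegral fineK//; exact: integrable_fin_num.
have -> : (\int[mu \x mu]_q (u3 q)%:E)%E = (\int[(mu \x mu)%E]_q u3 q)%:E.
  by rewrite /Rintegral fineK//; exact: integrable_fin_num.
by rewrite -(fineK (in_L2_fin f2)) -!EFinM -EFinD addrC R12.
Qed.

Lemma modulus_le z : (modulus z <= (4 * fine (sqnorm f))%:E)%E.
Proof.
have mfz := cmeas_shift (- z) mf.
rewrite /modulus; have := sqnormD_le mf (cmeasM (cmeas_cst _ (-1)) mfz).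
rewrite sqnormZ// normc_opp normc_real normr1 expr1n mul1e sqnorm_shift//.
under eq_fun do rewrite mulN1r.
move=> /le_trans; apply; rewrite -(fineK (in_L2_fin f2)) -!EFinM -EFinD lee_fin /=; lra.
Qed.

Lemma measurable_modulus : measurable_fun setT modulus.
Proof.
apply: (measurable_fun_fubini_tonelli_G (fun q : V * V => (normc (f q.1 - f (q.1 - q.2)) ^+ 2)%:E)).
  by apply: measurable_normc2E; apply: cmeasB; [exact: cmeas_pair1|exact: cmeas_sub].
by move=> q; rewrite lee_fin sqr_ge0.
Qed.

(** The dilation moves e from the kernel, which has no limit, to the argument of
    the modulus of continuity, where dominated convergence applies. *)
Lemma poisson_modulus_scale e : 0 < e ->
  (\int[mu]_z ((p e z)%:E * modulus z) = \int[mu]_w ((p 1 w)%:E * modulus (e *: w)))%E.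
Proof.
move=> e0; have en0 : e != 0 by rewrite gt_eqF.
pose D (z : V) := fine (modulus z).
have DE z : modulus z = (D z)%:E.
  rewrite fineK// ge0_fin_numE ?sqnorm_ge0//.
  by apply: le_lt_trans (modulus_le z) _; exact: ltry.
have D0 z : 0 <= D z by rewrite fine_ge0// sqnorm_ge0.
have mD : measurable_fun setT D.
  by apply: measurableT_comp measurable_modulus; exact: fine_measurable.
have BB : (e%:M : 'M[R]_n) *m (e^-1)%:M = 1%:M by rewrite -scalar_mxM mulfV.
have BB' : ((e^-1)%:M : 'M[R]_n) *m e%:M = 1%:M by rewrite -scalar_mxM mulVf.
have [c c0 cP] := ge0_leb_linear BB BB'.
have pp z : 0 <= p e z by exact: poisson_prod_ge0.
have pp1 z : 0 <= p 1 z by exact: poisson_prod_ge0.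
have mp : measurable_fun setT (p e) by exact: measurable_poisson_prod.
have mp1 : measurable_fun setT (p 1) by exact: measurable_poisson_prod.
have cE : c = e ^- n.
  have := cP _ mp pp; rewrite integral_poisson_prod// mule1.
  under eq_integral do rewrite mul_scalar_mx poisson_prod_scale// EFinM.
  rewrite ge0_integralZl//; last 3 first.
  - exact/measurable_EFinP.
  - by move=> z _; rewrite lee_fin.
  - by rewrite lee_fin invr_ge0 exprn_ge0// ltW.
  by rewrite integral_poisson_prod// mule1 => -[].
have en : 0 < e ^- n by rewrite invr_gt0 exprn_gt0.
have mpD : measurable_fun setT (fun z => p e z * D z) by exact: measurable_funM.
have h := cP _ mpD (fun z => mulr_ge0 (pp z) (D0 z)).
have h1 : (\int[mu]_x (p e (e%:M *m x) * D (e%:M *m x))%:E =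
    (e ^- n)%:E * \int[mu]_w (p 1 w * D (e *: w))%:E)%E.
  rewrite -ge0_integralZl//.
  - by apply: eq_integral => w _; rewrite mul_scalar_mx poisson_prod_scale// -mulrA EFinM.
  - apply/measurable_EFinP; apply: measurable_funM => //.
    by apply: measurableT_comp => //; exact: measurable_scaleV.
  - by move=> w _; rewrite lee_fin mulr_ge0.
  - by rewrite lee_fin ltW.
move: h; rewrite h1 cE.
have -> : (\int[mu]_z ((p e z)%:E * modulus z) = \int[mu]_x (p e x * D x)%:E)%E.
  by apply: eq_integral => z _; rewrite DE.
have -> : (\int[mu]_w ((p 1 w)%:E * modulus (e *: w)) = \int[mu]_w (p 1 w * D (e *: w))%:E)%E.
  by apply: eq_integral => z _; rewrite DE.
move=> /esym; set A := (\int[mu]_x (p e x * D x)%:E)%E; set B := (\int[mu]_x _)%E.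
exact: emul_fin_inj.
Qed.

Lemma poisson_modulus_cvg :
  (\int[mu]_z ((p k.+1%:R^-1 z)%:E * modulus z))%E @[k --> \oo] --> 0%E.
Proof.
have pp1 z : 0 <= p 1 z by exact: poisson_prod_ge0.
have mp1 : measurable_fun setT (p 1) by exact: measurable_poisson_prod.
under eq_cvg do rewrite poisson_modulus_scale//.
have [] := @dominated_convergence _ _ _ mu setT measurableT
  (fun k w => (p 1 w)%:E * modulus (k.+1%:R^-1 *: w))%E (cst 0%E)
  (fun w => (4 * fine (sqnorm f) * p 1 w)%:E).
- move=> k; apply: emeasurable_funM; first exact/measurable_EFinP.
  by apply: measurableT_comp measurable_modulus _; exact: measurable_scaleV.
- exact: measurable_cst.
- apply: aeW => w _; rewrite -[X in _ --> X](mule0 (p 1 w)%:E).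
  apply: cvgeZl => //.
  pose Z := \sum_i `|w i ord0|.
  have Z1 i : `|w i ord0| <= Z by rewrite /Z (bigD1 i)//= lerDl sumr_ge0.
  apply: (@translation_continuous_L2 R n (fun k => k.+1%:R^-1 *: w) Z _ _ f f2).2.
    move=> i; under eq_fun do rewrite mxE.
    by rewrite -(mul0r (w i ord0)); apply: cvgMl; exact: cvg_harmonic.
  move=> k i; rewrite mxE normrM ger0_norm ?invr_ge0//.
  by apply: le_trans (Z1 i); rewrite ler_piMl// invf_le1// ler1n.
- apply: (integrable_scale (4 * fine (sqnorm f))); apply/integrableP; split; first exact/measurable_EFinP.
  under eq_integral do rewrite /= ger0_norm//.
  by rewrite integral_poisson_prod// ltry.
- apply: aeW => w k _ /=; rewrite gee0_abs; last by rewrite mule_ge0 ?lee_fin ?sqnorm_ge0.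
  by rewrite mulrC EFinM; apply: lee_wpmul2l; rewrite ?lee_fin//; exact: modulus_le.
- by move=> _ _; rewrite integral0.
Qed.

(** The limit of [plancherel_defect] as e tends to 0: the regularized energies
    increase to the full one, and the defect vanishes. *)
Theorem plancherel : sqnorm (fourier f) = sqnorm f.
Proof.
have mh := measurable_normc2E (cmeas_fourier mf).
pose A k := (\int[mu]_xi (P k.+1%:R^-1 xi * normc (fourier f xi) ^+ 2)%:E)%E.
have A0 k : (0 <= A k)%E.
  by apply: integral_ge0 => xi _; rewrite lee_fin mulr_ge0 ?sqr_ge0 ?laplace_prod_ge0.
have Acvg : A k @[k --> \oo] --> sqnorm (fourier f).
  rewrite /sqnorm.
  rewrite (_ : (fun xi => (normc (fourier f xi) ^+ 2)%:E) =
      fun xi => limn (fun k => (P k.+1%:R^-1 xi * normc (fourier f xi) ^+ 2)%:E)); last first.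
    apply/funext => xi; apply/esym/cvg_lim => //; apply: cvg_EFin; first exact: nearW.
    rewrite -[X in _ --> X]mul1r; apply: cvgMl.
    under eq_fun do rewrite laplace_prodE.
    pose S : R := \sum_i `|xi i ord0|.
    have h0 : - (k.+1%:R^-1 * S) @[k --> \oo] --> - (0 * S).
      by apply: cvgN; apply: cvgMl; exact: cvg_harmonic.
    have h1 : expR (- (k.+1%:R^-1 * S)) @[k --> \oo] --> expR (- (0 * S)).
      by apply: (cvg_comp _ expR h0); exact: continuous_expR.
    by rewrite mul0r oppr0 expR0 in h1.
  apply: cvg_monotone_convergence => //.
  - move=> k; apply/measurable_EFinP; apply: measurable_funM; first exact: measurable_laplace_prod.
    by apply: measurable_normc2; exact: cmeas_fourier.
  - by move=> k xi _; rewrite lee_fin mulr_ge0 ?sqr_ge0 ?laplace_prod_ge0.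
  - move=> xi _ k l kl; rewrite lee_fin ler_wpM2r ?sqr_ge0// !laplace_prodE ler_expR lerN2.
    by rewrite ler_wpM2r ?sumr_ge0// lef_pV2 ?posrE// ler_nat ltnS.
have h : (2%:E * A k + \int[mu]_z ((p k.+1%:R^-1 z)%:E * modulus z))%E @[k --> \oo] -->
    (2%:E * sqnorm (fourier f) + 0)%E.
  apply: cvgeD; last exact: poisson_modulus_cvg.
    by rewrite ge0_adde_def ?inE// mule_ge0// sqnorm_ge0.
  by apply: cvgeZl.
have : (2%:E * sqnorm f = 2%:E * sqnorm (fourier f))%E.
  rewrite -[RHS]adde0; apply: (cvg_unique _ _ h) => //=.
  rewrite (_ : (fun k => _) = fun=> (2%:E * sqnorm f)%E); first exact: cvg_cst.
  by apply/funext => k; exact: plancherel_defect.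
by move=> /emul_fin_inj ->.
Qed.

End plancherel.

(** * Convolution *)

Section convolution_theory.
Variables (R : realType) (n : nat).
Local Notation V := 'cV[R]_n.
Local Notation mu := (leb R n).
Implicit Types f g : V -> R[i].

Lemma convolutionE f g x : convolution f g x = cint mu (fun y => f y * g (x - y)).
Proof. by []. Qed.

Lemma cmeas_convolution_kernel f g : cmeas f -> cmeas g ->
  cmeas (fun q : V * V => f q.2 * g (q.1 - q.2)).
Proof. by move=> mf mg; apply: cmeasM; [exact: cmeas_pair2|exact: cmeas_sub]. Qed.

Lemma cmeas_convolution f g : cmeas f -> cmeas g -> cmeas (convolution f g).
Proof.
by move=> mf mg; apply: (cmeas_cint1 mu (cmeas_convolution_kernel mf mg)).
Qed.

Lemma sqnorm_reflect (c : V) g : cmeas g -> sqnorm (fun x => g (c - x)) = sqnorm g.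
Proof.
move=> mg; apply: (ge0_leb_reflect c (f := fun x => (normc (g x) ^+ 2)%:E)).
  exact: measurable_normc2E.
by move=> x; rewrite lee_fin sqr_ge0.
Qed.

(** Replaces the Cauchy-Schwarz inequality, of which it is the form before
    optimization over t. *)
Lemma integral_normc_prod_le (t : R) f h : 0 < t -> cmeas f -> cmeas h ->
  (\int[mu]_y (normc (f y * h y))%:E <= (t^-1)%:E * sqnorm f + t%:E * sqnorm h)%E.
Proof.
move=> t0 mf mh; have ti : 0 <= t^-1 by rewrite invr_ge0 ltW.
have mf2 := measurable_normc2E mf; have mh2 := measurable_normc2E mh.
rewrite -!ge0_integralZl ?lee_fin ?(ltW t0)//; last 2 first.
- by move=> y _; rewrite lee_fin sqr_ge0.
- by move=> y _; rewrite lee_fin sqr_ge0.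
rewrite -ge0_integralD//.
- apply: ge0_le_integral => //.
  + by move=> y _; rewrite lee_fin normc_ge0.
  + by apply: measurable_normcE; exact: cmeasM.
  + by apply: emeasurable_funD; exact: measurable_funeM.
  + by move=> y _; rewrite -!EFinM -EFinD lee_fin normcM_weighted.
- by move=> y _; rewrite -EFinM lee_fin mulr_ge0// sqr_ge0.
- exact: measurable_funeM.
- by move=> y _; rewrite -EFinM lee_fin mulr_ge0 ?sqr_ge0// ltW.
- exact: measurable_funeM.
Qed.

Lemma cintegrable_prod f h : in_L2 f -> in_L2 h -> cintegrable mu (fun y => f y * h y).
Proof.
move=> [mf ff] [mh fh]; split; first exact: cmeasM.
apply: le_lt_trans (integral_normc_prod_le ltr01 mf mh) _.
by rewrite lte_add_pinfty// lte_mul_pinfty// lee_fin invr_ge0.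
Qed.

Lemma in_L2_reflect (c : V) g : in_L2 g -> in_L2 (fun x => g (c - x)).
Proof. by move=> [mg fg]; split; [exact: cmeas_reflect|rewrite sqnorm_reflect]. Qed.

Lemma cintegrable_convolution f g x : in_L2 f -> in_L2 g ->
  cintegrable mu (fun y => f y * g (x - y)).
Proof. by move=> f2 g2; apply: cintegrable_prod => //; exact: in_L2_reflect. Qed.

Lemma convolutionB f h g : in_L2 f -> in_L2 h -> in_L2 g ->
  convolution (fun x => f x - h x) g = fun x => convolution f g x - convolution h g x.
Proof.
move=> f2 h2 g2; apply/funext => x; rewrite !convolutionE -cintB.
- by apply: eq_cint => y; rewrite mulrBl.
- exact: cintegrable_convolution.
- exact: cintegrable_convolution.
Qed.

(** At a point where the integral defining the convolution diverges absolutely,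
    the bound by that integral is trivial. *)
Lemma convolution_L1 f g : cintegrable mu f -> cintegrable mu g ->
  cintegrable mu (convolution f g) /\
  (\int[mu]_y \int[mu]_x (normc (f y * g (x - y)))%:E < +oo)%E.
Proof.
move=> f1 g1; have mk := cmeas_convolution_kernel f1.1 g1.1.
have mk' : measurable_fun setT (fun q : V * V => (normc (f q.2 * g (q.1 - q.2)))%:E).
  exact: measurable_normcE.
have k0 (q : V * V) : (0 <= (normc (f q.2 * g (q.1 - q.2)))%:E)%E by rewrite lee_fin normc_ge0.
have fin : (\int[mu]_y \int[mu]_x (normc (f y * g (x - y)))%:E < +oo)%E.
  rewrite (_ : (\int[mu]_y _)%E = (\int[mu]_y ((normc (f y))%:E * (norm1 g)%:E))%E); last first.
    apply: eq_integral => y _.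
    rewrite norm1E// -(ge0_leb_shift (- y) (measurable_normcE g1.1)); last first.
      by move=> x; rewrite lee_fin normc_ge0.
    rewrite -ge0_integralZl ?lee_fin ?normc_ge0//.
    - by apply: eq_integral => x _; rewrite normcM EFinM.
    - by apply: measurable_normcE; exact: (cmeas_shift (- y) g1.1).
    - by move=> x _; rewrite lee_fin normc_ge0.
  rewrite ge0_integralZr//.
  - by rewrite -norm1E// -EFinM ltry.
  - exact: measurable_normcE f1.1.
  - by move=> x _; rewrite lee_fin normc_ge0.
  - by rewrite norm1E//; apply: integral_ge0 => x _; rewrite lee_fin normc_ge0.
split=> //; split; first exact: cmeas_convolution f1.1 g1.1.
apply: le_lt_trans fin.
rewrite -(fubini_tonelli (m1:=mu) (m2:=mu) (fun q : V * V => (normc (f q.2 * g (q.1 - q.2)))%:E))//.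
have mF := measurable_fun_fubini_tonelli_F (m2 := mu) _ mk' k0.
apply: ge0_le_integral => //.
- by move=> x _; rewrite lee_fin normc_ge0.
- by apply: measurable_normcE; exact: cmeas_convolution f1.1 g1.1.
- move=> x _; rewrite convolutionE.
  have [h|h] := ltP (\int[mu]_y (normc (f y * g (x - y)))%:E)%E +oo%E.
    by apply: normc_cint_le; split=> //; apply: cmeasM f1.1 _; exact: cmeas_reflect g1.1.
  by apply: (le_trans _ h); exact: leey.
Qed.

Lemma fourier_convolution f g xi : in_L12 f -> in_L12 g ->
  fourier (convolution f g) xi = fourier f xi * fourier g xi.
Proof.
move=> [f1 f2] [g1 g2]; have [c1 fin] := convolution_L1 f1 g1.
pose F (q : V * V) := f q.1 * g (q.2 - q.1) * character q.2 xi.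
have mg' : cmeas (fun q : V * V => g (q.2 - q.1)).
  apply: (cmeas_comp _ g1.1 (h := fun q : V * V => q.2 - q.1)).
  apply: measurable_fun_cVP => i; under eq_fun do rewrite !mxE.
  by apply: measurable_funB; [exact: measurable_coord2|exact: measurable_coord1].
have mF : cmeas F.
  apply: cmeasM; first by apply: cmeasM => //; exact: cmeas_pair1 f1.1.
  exact: (cmeas_pair2 (f := fun x : V => character x xi) (cmeas_character _)).
have normF q : normc (F q) = normc (f q.1 * g (q.2 - q.1)).
  by rewrite /F normcM normc_character mulr1.
rewrite !fourierE.
transitivity (cint mu (fun x => cint mu (fun y => F (y, x)))).
  apply: eq_cint => x; rewrite convolutionE -cintZr; last exact: cintegrable_convolution.
  by [].
rewrite -(cfubini mF); last first.
  by under eq_integral do under eq_integral do rewrite normF.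
rewrite -cintZr; last exact: cintegrable_character.
apply: eq_cint => y; rewrite /F.
transitivity (f y * fourier (fun x => g (x - y)) xi).
  rewrite fourierE -cintZ.
    by apply: eq_cint => x; rewrite /= mulrA.
  by apply: cintegrable_character; split; [exact: cmeas_shift g1.1|];
    rewrite (ge0_leb_shift (- y) (measurable_normcE g1.1)) ?g1.2// => x; rewrite lee_fin normc_ge0.
by rewrite fourier_shift// mulrA fourierE.
Qed.

Lemma convolution_bound (t : R) f g x : 0 < t -> in_L2 f -> in_L2 g ->
  normc (convolution f g x) <= t^-1 * fine (sqnorm f) + t * fine (sqnorm g).
Proof.
move=> t0 f2 g2; rewrite -lee_fin EFinD !EFinM !fineK ?in_L2_fin//.
rewrite convolutionE; apply: le_trans (normc_cint_le (cintegrable_convolution x f2 g2)) _.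
rewrite -(sqnorm_reflect x g2.1); apply: integral_normc_prod_le => //; first exact: f2.1.
exact: cmeas_reflect g2.1.
Qed.

(** A bounded integrable function is square integrable. *)
Lemma convolution_L12 f g : in_L12 f -> in_L12 g -> in_L12 (convolution f g).
Proof.
move=> [f1 f2] [g1 g2]; have [[mc c1] _] := convolution_L1 f1 g1.
split=> //; split=> //.
set C := 1^-1 * fine (sqnorm f) + 1 * fine (sqnorm g).
have C0 : 0 <= C by apply: le_trans (convolution_bound 0 ltr01 f2 g2); exact: normc_ge0.
apply: (@le_lt_trans _ _ (C%:E * \int[mu]_x (normc (convolution f g x))%:E)%E).
  rewrite -ge0_integralZl//.
  - apply: ge0_le_integral => //.
    + by move=> x _; rewrite lee_fin sqr_ge0.
    + exact: measurable_normc2E.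
    + by apply: measurable_funeM; exact: measurable_normcE.
    + move=> x _; rewrite -EFinM lee_fin expr2 ler_wpM2r ?normc_ge0//.
      exact: convolution_bound.
  - exact: measurable_normcE.
  - by move=> x _; rewrite lee_fin normc_ge0.
by rewrite lte_mul_pinfty// ?lee_fin// ge0_fin_numE.
Qed.

Lemma sqnorm_convolution f g : in_L12 f -> in_L12 g ->
  sqnorm (convolution f g) = sqnorm (fun xi => fourier f xi * fourier g xi).
Proof.
move=> f12 g12; have [c1 c2] := convolution_L12 f12 g12.
rewrite -(plancherel c1 c2); congr (sqnorm _); apply/funext => xi.
exact: fourier_convolution.
Qed.

End convolution_theory.

(** * Taking the modulus moves the spectrum towards the origin *)

Section sine.
Variable R : realType.
Implicit Types x t : R.

Lemma sin_le_id x : 0 <= x -> sin x <= x.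
Proof.
move=> x0; have [|c _] := @MVT_segment R sin cos 0 x x0 (fun y _ => is_derive_sin y).
  by apply: derivable_within_continuous => y _; exact: derivable_sin.
rewrite sin0 !subr0 => ->; rewrite -[leRHS]mul1r ler_wpM2r//; exact: cos_le1.
Qed.

Lemma sqr_sin_le x : sin x ^+ 2 <= x ^+ 2.
Proof.
wlog x0 : x / 0 <= x => [H|].
  have [/H//|/ltW x0] := leP 0 x.
  by have := H (- x); rewrite sinN !sqrrN; apply; rewrite oppr_ge0.
have [xpi|xpi] := leP x pi.
  by rewrite ler_sqr ?nnegrE ?sin_le_id// sin_ge0_pi// x0.
apply: (@le_trans _ _ 1); first by rewrite -(real_normK (num_real _)) expr_le1 ?sin_max.
by rewrite -[1](expr1n _ 2) ler_sqr ?nnegrE// (le_trans _ (ltW xpi))// (le_trans _ (pi_ge2 R))// ler1n.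
Qed.

Lemma normc_sub1_cis t : normc (1 - cis t) ^+ 2 = 4 * sin (t / 2) ^+ 2.
Proof.
have e : t = t / 2 + t / 2 by lra.
rewrite normc_sqrE ReB ImB /=; rewrite [in LHS]e cosD sinD.
have := cos2Dsin2 (t / 2); move: (cos _) (sin _) => c s h.
have -> : (1 - (c * c - s * s)) ^+ 2 + (0 - - (s * c + c * s)) ^+ 2 =
  1 + (c ^+ 2 + s ^+ 2) ^+ 2 - 2 * (c ^+ 2 - s ^+ 2) by ring.
by rewrite h; have -> : c ^+ 2 = 1 - s ^+ 2; [lra|ring].
Qed.

Lemma cvg_sin_scaled t : k.+1%:R * sin (t / k.+1%:R) @[k --> \oo] --> t.
Proof.
have [->|t0] := eqVneq t 0.
  by under eq_cvg do rewrite mul0r sin0 mulr0; exact: cvg_cst.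
have h := @derivable_sin R 0.
have : (h^-1 *: ((sin \o shift 0) (h *: (1 : R)) - sin 0)) @[h --> (0 : R)^'] --> (1 : R).
  by rewrite -[X in _ --> X](cos0 R) -(@derive_val _ _ _ _ _ _ _ (is_derive_sin (0 : R))).
move=> /cvgr_dnbhsP /(_ (fun k => t / k.+1%:R)) H.
have : ((t / k.+1%:R)^-1 *: ((sin \o shift 0) ((t / k.+1%:R) *: (1 : R)) - sin 0)) @[k --> \oo] --> (1 : R).
  apply: H; split=> [k|]; first by rewrite mulf_neq0// invr_neq0// pnatr_eq0.
  by rewrite -[X in _ --> X](mulr0 t); apply: cvgMr; exact: cvg_harmonic.
move=> /(cvgM (@cvg_cst _ t _ \oo _)); rewrite mulr1; apply: cvg_trans; apply: near_eq_cvg.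
near=> k => /=; rewrite addr0 sin0 subr0 /GRing.scale/= mulr1 invfM invrK.
by field.
Unshelve. all: by end_near.
Qed.

End sine.

Section modulus_gradient.
Variables (R : realType) (n : nat).
Local Notation V := 'cV[R]_n.
Local Notation mu := (leb R n).
Implicit Types (f g h : V -> R[i]) (nu xi z : V).

(** The second moment about nu of the energy density |h|^2. *)
Definition moment nu h : \bar R := (\int[mu]_xi ((norm2 (xi - nu) * normc (h xi)) ^+ 2)%:E)%E.

Lemma norm2_sqr xi : norm2 xi ^+ 2 = \sum_i (xi i ord0) ^+ 2.
Proof. by rewrite sqr_sqrtr//; apply: sumr_ge0 => i _; exact: sqr_ge0. Qed.

Lemma norm2_ge0 xi : 0 <= norm2 xi.
Proof. exact: sqrtr_ge0. Qed.

Lemma momentE nu h : cmeas h ->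
  moment nu h = (\sum_i \int[mu]_xi (((xi - nu) i ord0 * normc (h xi)) ^+ 2)%:E)%E.
Proof.
move=> mh; rewrite -ge0_integral_sum//.
- apply: eq_integral => xi _; rewrite sumEFin; congr EFin.
  by rewrite exprMn norm2_sqr mulr_suml; apply: eq_bigr => i _; rewrite exprMn.
- move=> i; apply/measurable_EFinP; apply: measurable_funX; apply: measurable_funM.
    under eq_fun do rewrite !mxE; apply: measurable_funB => //; exact: measurable_coordinate.
  exact: measurable_normc.
- by move=> i xi _; rewrite lee_fin sqr_ge0.
Qed.

Lemma modulus_difference_le (c z w : R[i]) : normc c = 1 ->
  normc ((normc z)%:C - (normc w)%:C) <= normc (z - c * w).
Proof.
move=> c1; rewrite -rmorphB normc_real.
have -> : normc w = normc (c * w) by rewrite normcM c1 mul1r.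
exact: normc_dist.
Qed.

Lemma in_L12_modulus h : in_L12 h -> in_L12 (fun x => (normc (h x))%:C).
Proof.
move=> [[mh h1] [_ h2]].
have m : cmeas (fun x => (normc (h x))%:C) by apply: cmeas_real; exact: measurable_normc.
have e x : normc (normc (h x))%:C = normc (h x) by rewrite normc_real ger0_norm ?normc_ge0.
split; split=> //; first by under eq_integral do rewrite e.
by rewrite (eq_sqnorm e).
Qed.

Lemma cintegrable_shift (z : V) h : cintegrable mu h -> cintegrable mu (fun x => h (x - z)).
Proof.
move=> [mh hoo]; split; first exact: cmeas_shift.
by rewrite (ge0_leb_shift (- z) (measurable_normcE mh))// => x; rewrite lee_fin normc_ge0.
Qed.

Lemma sqnorm_difference (c : R[i]) z h : in_L12 h ->
  sqnorm (fun x => h x - c * h (x - z)) =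
  sqnorm (fun xi => (1 - c * character z xi) * fourier h xi).
Proof.
move=> [h1 h2]; rewrite -plancherel.
- congr (sqnorm _); apply/funext => xi.
  rewrite fourierB//; last by apply: cintegrableZ; exact: cintegrable_shift.
  by rewrite fourierZ; [rewrite fourier_shift//; ring|exact: cintegrable_shift].
- apply: cintegrableD => //; apply: cintegrableN; apply: cintegrableZ.
  exact: cintegrable_shift.
- by apply: in_L2B => //; apply: in_L2Z; exact: in_L2_shift.
Qed.

(** [modulus_difference_le] with the character of nu at z as the unimodular
    factor, which recentres the spectrum of h at nu. *)
Lemma modulus_shift_le nu z h : in_L12 h ->
  (sqnorm (fun xi => (1 - character z xi) * fourier (fun x => (normc (h x))%:C) xi)%R <=
   sqnorm (fun xi => (1 - character z (xi - nu)) * fourier h xi)%R)%E.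
Proof.
move=> h12; have m12 := in_L12_modulus h12.
set c := character z (- nu).
have c1 : normc c = 1 by exact: normc_character.
have -> : (fun xi => (1 - character z (xi - nu)) * fourier h xi) =
    (fun xi => (1 - c * character z xi) * fourier h xi).
  by apply/funext => xi; rewrite /c [character z (xi - nu)]characterC characterDl !(characterC _ z) [character z xi * _]mulrC.
have -> : (fun xi => (1 - character z xi) * fourier (fun x => (normc (h x))%:C) xi) =
    (fun xi => (1 - 1 * character z xi) * fourier (fun x => (normc (h x))%:C) xi).
  by apply/funext => xi; rewrite mul1r.
rewrite -!sqnorm_difference//; apply: le_sqnorm => [||x].
- have mm := m12.1.1; apply: cmeasB => //.
  by apply: cmeasM; [exact: cmeas_cst|exact: (cmeas_shift (- z) mm)].
- have mm := h12.1.1; apply: cmeasB => //.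
  by apply: cmeasM; [exact: cmeas_cst|exact: cmeas_shift].
- by rewrite mul1r; exact: modulus_difference_le.
Qed.

(** [modulus_shift_le] for z = e_i / k, divided by |z|^2. By the inequality
    |sin t| <= |t| the right side is below its limit, and Fatou's lemma bounds
    the limit of the left side. *)
Lemma modulus_moment_coord nu h (i : 'I_n) : in_L12 h ->
  (\int[mu]_xi ((xi i ord0 * normc (fourier (fun x => (normc (h x))%:C) xi)) ^+ 2)%:E <=
   \int[mu]_xi (((xi - nu) i ord0 * normc (fourier h xi)) ^+ 2)%:E)%E.
Proof.
move=> h12; have m12 := in_L12_modulus h12.
set F := fourier _; have mF : cmeas F by apply: cmeas_fourier; exact: m12.1.1.
have mH : cmeas (fourier h) by apply: cmeas_fourier; exact: h12.1.1.
pose z k : V := k.+1%:R^-1 *: delta_mx i ord0.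
have zE k xi : character (z k) xi = cis (2 * pi * (xi i ord0 / k.+1%:R)).
  rewrite /character; congr (cis (_ * _)); rewrite /z innerZl mulrC; congr (_ / _).
  rewrite /inner (bigD1 i)//= big1 ?addr0 => [|j ji]; rewrite mxE.
    by rewrite !eqxx mul1r.
  by rewrite (negbTE ji) mul0r.
have p0 : (0 : R) < pi by exact: pi_gt0.
pose u k xi := ((pi^-1 * (k.+1%:R * sin (pi * xi i ord0 / k.+1%:R)) * normc (F xi)) ^+ 2)%:E.
have q0 k : (0 : R) < k.+1%:R by rewrite ltr0n.
have scaleE k (w : V -> R[i]) (y : V) : cmeas w ->
    (((k.+1%:R / (2 * pi)) ^+ 2)%:E * sqnorm (fun xi => (1 - character (z k) (xi - y)) * w xi)%R =
     \int[mu]_xi ((pi^-1 * (k.+1%:R * sin (pi * (xi - y) i ord0 / k.+1%:R)) * normc (w xi)) ^+ 2)%:E)%E.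
  move=> mw; rewrite -ge0_integralZl ?lee_fin ?sqr_ge0//.
  - apply: eq_integral => xi _; rewrite -EFinM; congr EFin.
    rewrite normcM [(normc (1 - _) * _) ^+ 2]exprMn zE normc_sub1_cis.
    have -> : 2 * pi * ((xi - y) i ord0 / k.+1%:R) / 2 = pi * (xi - y) i ord0 / k.+1%:R.
      by move: (pi : R) p0 ((xi - y) i ord0) (k.+1%:R : R) (q0 k) => p p0' a q q0'; field; lra.
    move: (sin _) (normc _) => b c; move: (pi : R) p0 (k.+1%:R : R) => p p0' q.
    by field; lra.
  - apply: measurable_normc2E; apply: cmeasM => //; apply: cmeasB; first exact: cmeas_cst.
    under eq_fun do rewrite characterC.
    apply: (cmeas_comp _ (cmeas_character (z k)) (h := fun x : V => x - y)).
    exact: measurable_addV.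
  - by move=> x _; rewrite lee_fin sqr_ge0.
have uE k : (\int[mu]_xi u k xi =
    ((k.+1%:R / (2 * pi)) ^+ 2)%:E * sqnorm (fun xi => (1 - character (z k) xi) * F xi)%R)%E.
  rewrite (_ : (fun xi => _) = (fun xi => (1 - character (z k) (xi - 0)) * F xi)); last first.
    by apply/funext => xi; rewrite subr0.
  by rewrite scaleE//; apply: eq_integral => xi _; rewrite subr0.
have msin (y : V) k (w : V -> R[i]) : cmeas w -> measurable_fun setT (fun xi : V =>
    ((pi^-1 * (k.+1%:R * sin (pi * (xi - y) i ord0 / k.+1%:R)) * normc (w xi)) ^+ 2)%:E).
  move=> mw; apply/measurable_EFinP; apply: measurable_funX; apply: measurable_funM; last exact: measurable_normc.
  do 2 apply: measurable_funM => //.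
  apply: (measurableT_comp (f := (sin : R -> R))); first by apply: continuous_measurable_fun; exact: continuous_sin.
  apply: measurable_funM => //; apply: measurable_funM => //.
  under eq_fun do rewrite !mxE; apply: measurable_funB => //; exact: measurable_coordinate.
have ule k : (\int[mu]_xi u k xi <=
    \int[mu]_xi (((xi - nu) i ord0 * normc (fourier h xi)) ^+ 2)%:E)%E.
  rewrite uE; apply: le_trans (lee_wpmul2l _ (modulus_shift_le nu (z k) h12)) _.
    by rewrite lee_fin sqr_ge0.
  rewrite scaleE//; apply: ge0_le_integral => //.
  - by move=> x _; rewrite lee_fin sqr_ge0.
  - exact: msin.
  - apply/measurable_EFinP; apply: measurable_funX; apply: measurable_funM; last exact: measurable_normc.
    by under eq_fun do rewrite !mxE; apply: measurable_funB => //; exact: measurable_coordinate.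
  - move=> xi _; rewrite lee_fin !exprMn ler_wpM2r ?sqr_ge0//.
    move: ((xi - nu) i ord0) => y.
    have := sqr_sin_le (pi * y / k.+1%:R); move: (sin _) => b; move: (k.+1%:R : R) (q0 k) => q q0'.
    move: (pi : R) p0 => p p0' hb.
    have -> : y ^+ 2 = p^-1 ^+ 2 * (q ^+ 2 * (p * y / q) ^+ 2) by field; lra.
    by do 2 (apply: ler_wpM2l; first exact: sqr_ge0).
have mu_ k : measurable_fun setT (u k).
  rewrite (_ : u k = (fun xi : V =>
    ((pi^-1 * (k.+1%:R * sin (pi * (xi - 0) i ord0 / k.+1%:R)) * normc (F xi)) ^+ 2)%:E)).
    exact: msin.
  by apply/funext => xi; rewrite subr0.
have : (\int[mu]_xi limn_einf (u ^~ xi) <= limn_einf (fun k => \int[mu]_xi u k xi))%E.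
  by apply: fatou => // k x _; rewrite lee_fin sqr_ge0.
have -> : (\int[mu]_xi limn_einf (u ^~ xi) = \int[mu]_xi ((xi i ord0 * normc (F xi)) ^+ 2)%:E)%E.
  apply: eq_integral => xi _; apply: (cvg_limn_einf_sup _).1.
  apply: cvg_EFin; first by near=> k.
  have -> : xi i ord0 * normc (F xi) = pi^-1 * (pi * xi i ord0) * normc (F xi).
    by rewrite mulrA mulVf ?mul1r// gt_eqF.
  have H : pi^-1 * (k.+1%:R * sin (pi * xi i ord0 / k.+1%:R)) * normc (F xi) @[k --> \oo]
      --> pi^-1 * (pi * xi i ord0) * normc (F xi).
    apply: cvgM; last exact: cvg_cst.
    by apply: cvgM; [exact: cvg_cst|exact: cvg_sin_scaled].
  exact: (cvgM H H).
move=> /le_trans; apply.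
rewrite limn_einf_lim; apply: lime_le; first exact: is_cvg_einfs.
near=> k; apply: le_trans (ule k); apply: ereal_inf_lbound; exists k => //=.
Unshelve. all: by end_near.
Qed.

Theorem modulus_moment_le nu h : in_L12 h ->
  (moment 0 (fourier (fun x => (normc (h x))%:C)) <= moment nu (fourier h))%E.
Proof.
move=> h12; have m12 := in_L12_modulus h12.
rewrite !momentE; try (by apply: cmeas_fourier; first [exact: m12.1.1|exact: h12.1.1]).
apply: lee_sum => i _; under eq_integral do rewrite subr0; exact: modulus_moment_coord.
Qed.

End modulus_gradient.

(** * Scattering energy of a Littlewood-Paley family *)

Section extended_sums.
Variables (R : realType) (T : choiceType).
Implicit Types (I : set T) (a : T -> \bar R).

Lemma esum_le_finite I a (M : \bar R) :
  (forall A, fsets I A -> (\sum_(i \in A) a i <= M)%E) -> (\esum_(i in I) a i <= M)%E.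
Proof. by move=> h; apply: ge_ereal_sup => _ [A IA <-]; exact: h. Qed.

Lemma finite_le_esum I a A : fsets I A -> (\sum_(i \in A) a i <= \esum_(i in I) a i)%E.
Proof. by move=> IA; apply: ereal_sup_ubound; exists A. Qed.

Lemma esum_mul_le (c : R) I a : 0 <= c -> (forall i, I i -> (0 <= a i)%E) ->
  (\esum_(i in I) (c%:E * a i) <= c%:E * \esum_(i in I) a i)%E.
Proof.
move=> c0 a0; apply: esum_le_finite => A IA.
have aE i : i \in A -> a i = (if i \in I then a i else 0)%E.
  by rewrite inE => /IA.2 Ii; rewrite mem_set.
rewrite (eq_fsbigr (fun i => c%:E * (if i \in I then a i else 0))%E); last first.
  by move=> i /aE {1}->.
rewrite -ge0_mule_fsumr.
  have <- : (\sum_(i \in A) a i = \sum_(i \in A) if i \in I then a i else 0)%E by exact: eq_fsbigr.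
  by apply: lee_wpmul2l; [rewrite lee_fin|exact: finite_le_esum].
by move=> i; case: ifPn => //; rewrite inE => /a0.
Qed.

End extended_sums.

Section littlewood_paley.
Variables (R : realType) (n : nat).
Local Notation V := 'cV[R]_n.
Local Notation mu := (leb R n).
Variable Psi : set (V -> R[i]).
Hypothesis Psi_L12 : forall g, Psi g -> in_L12 g.
Hypothesis Psi_le1 :
  \forall xi \ae mu, (\esum_(g in Psi) (normc (fourier g xi) ^+ 2)%:E <= 1)%E.
Implicit Types (f g h : V -> R[i]).

Lemma cmeas_fourier_filter g : Psi g -> cmeas (fourier g).
Proof. by move=> /Psi_L12[[mg _] _]; exact: cmeas_fourier. Qed.

(** A sum over the filters is the supremum of its finite partial sums, and these
    commute with the integral. *)
Lemma weighted_sum_le (w : V -> R) : measurable_fun setT w -> (forall xi, 0 <= w xi) ->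
  (\esum_(g in Psi) \int[mu]_xi (w xi * normc (fourier g xi) ^+ 2)%:E <=
   \int[mu]_xi (w xi)%:E)%E.
Proof.
move=> mw w0; apply: esum_le_finite => A [finA APsi].
have mA g : Psi g -> measurable_fun setT (fun xi => (w xi * normc (fourier g xi) ^+ 2)%:E).
  move=> Pg; apply/measurable_EFinP; apply: measurable_funM => //.
  by apply: measurable_normc2; exact: cmeas_fourier_filter.
pose F g xi := (if g \in Psi then (w xi * normc (fourier g xi) ^+ 2)%:E else 0)%E.
have FE g xi : g \in A -> F g xi = (w xi * normc (fourier g xi) ^+ 2)%:E.
  by rewrite inE => /APsi Pg; rewrite /F mem_set.
have mF g : measurable_fun setT (F g).
  have [gP|/negbTE gP] := boolP (g \in Psi); last by rewrite /F gP; exact: measurable_cst.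
  by rewrite /F gP; apply: mA; rewrite inE in gP.
have F0 g xi : (0 <= F g xi)%E.
  by rewrite /F; case: ifPn => // _; rewrite lee_fin mulr_ge0// sqr_ge0.
rewrite (eq_fsbigr (fun g => \int[mu]_xi F g xi)%E); last first.
  by move=> g Ag; apply: eq_integral => xi _; rewrite FE.
rewrite -ge0_integral_fsum//.
apply: ae_ge0_le_integral => //.
- by move=> xi _; apply: fsume_ge0.
- exact: emeasurable_fsum.
- by move=> xi _; rewrite lee_fin.
- exact/measurable_EFinP.
- apply: filterS Psi_le1 => xi h _.
  rewrite (eq_fsbigr (fun g => (w xi)%:E * (normc (fourier g xi) ^+ 2)%:E))%E; last first.
    by move=> g Ag; rewrite FE.
  rewrite -ge0_mule_fsumr; last by move=> g; rewrite lee_fin sqr_ge0.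
  rewrite -[leRHS]mule1; apply: lee_wpmul2l; first by rewrite lee_fin.
  by apply: le_trans h; apply: finite_le_esum.
Qed.

Lemma sqnorm_modulus f : sqnorm (fun x => (normc (f x))%:C) = sqnorm f.
Proof. by apply: eq_sqnorm => x; rewrite normc_real ger0_norm ?normc_ge0. Qed.

Lemma bessel h : in_L12 h -> (\esum_(g in Psi) sqnorm (convolution h g) <= sqnorm h)%E.
Proof.
move=> h12; have [h1 h2] := h12; rewrite -(plancherel h1 h2).
have mh := cmeas_fourier h1.1.
rewrite (eq_esum (b := fun g =>
  \int[mu]_xi (normc (fourier h xi) ^+ 2 * normc (fourier g xi) ^+ 2)%:E)%E); last first.
  move=> g Pg; rewrite sqnorm_convolution//; last exact: Psi_L12.
  by apply: eq_integral => xi _; rewrite normcM exprMn.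
apply: weighted_sum_le => [|xi]; [exact: measurable_normc2|exact: sqr_ge0].
Qed.

Lemma convolution_contraction12 h g : Psi g -> in_L12 h ->
  (sqnorm (convolution h g) <= sqnorm h)%E.
Proof.
move=> Pg h12; apply: le_trans (bessel h12).
apply: esum_ge; exists [set g]; last by rewrite fsbig_set1.
by split; [exact: finite_set1|move=> _ ->].
Qed.

Lemma energy_remainder0 f : energy_remainder Psi 0 f = sqnorm f.
Proof.
rewrite /energy_remainder (_ : [set p : 0.-tuple _ | _] = [set [tuple]]).
  by rewrite esum_set1// sqnorm_ge0.
by apply/seteqP; split=> [p _ /=|p _ []//]; exact: tuple0.
Qed.

(** A path is a first filter followed by a shorter path. *)
Lemma energy_remainderS N f : energy_remainder Psi N.+1 f =
  (\esum_(g in Psi) energy_remainder Psi N (fun x => (normc (convolution f g x))%:C))%E.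
Proof.
rewrite /energy_remainder esum_esum; last by move=> *; exact: sqnorm_ge0.
pose e (k : (V -> R[i]) * N.-tuple (V -> R[i])) := cons_tuple k.1 k.2.
apply: (reindex_esum _ _ e).
split.
- move=> [g p] [/= Pg Pp] i; rewrite /= (tnth_nth g).
  case: i => -[|i] hi //=; have hi' : (i < N)%N by [].
  by have := Pp (Ordinal hi'); rewrite (tnth_nth g).
- by move=> [g p] [g' p'] _ _ [-> /val_inj ->].
- case/tupleP => g p Pp; exists (g, p) => //; split=> [|i] /=; first exact: (Pp ord0).
  by have := Pp (lift ord0 i); rewrite tnthS.
Qed.

Lemma modulus_convolution_L12 h g : in_L12 h -> Psi g ->
  in_L12 (fun x => (normc (convolution h g x))%:C).
Proof.
by move=> h12 Pg; apply: in_L12_modulus; apply: convolution_L12 => //; exact: Psi_L12.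
Qed.

Lemma energy_remainder_le N h : in_L12 h -> (energy_remainder Psi N h <= sqnorm h)%E.
Proof.
elim: N h => [|N IH] h h12; first by rewrite energy_remainder0.
rewrite energy_remainderS; apply: le_trans (bessel h12); apply: le_esum => g Pg.
by rewrite -sqnorm_modulus; apply: IH; exact: modulus_convolution_L12.
Qed.

Section contraction.
Variables (r0 alpha : R).
Hypothesis r0_gt0 : 0 < r0.
Hypothesis alpha_ge0 : 0 <= alpha.
Hypothesis Psi_center : forall g, Psi g -> exists nu, forall xi, fourier g xi != 0 ->
  r0 <= norm2 xi /\ norm2 (xi - nu) <= alpha * norm2 xi.

Lemma measurable_norm2 (c : V) : measurable_fun setT (fun xi : V => norm2 (xi - c)).
Proof.
rewrite /norm2; apply: (measurableT_comp (f := @Num.sqrt R)).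
  by apply: continuous_measurable_fun; exact: sqrt_continuous.
apply: measurable_sum => i; apply: measurable_funX.
by under eq_fun do rewrite !mxE; apply: measurable_funB => //; exact: measurable_coordinate.
Qed.

Lemma moment0E h : (moment 0 h = \int[mu]_xi (norm2 xi ^+ 2 * normc (h xi) ^+ 2)%:E)%E.
Proof. by apply: eq_integral => xi _; rewrite subr0 exprMn. Qed.

(** In the last layer the moment dominates the energy, since the filters vanish
    where |xi| < r0. Every other layer contributes alpha^2, by demodulation with
    the centre of each filter and the bound on the sum of the filters. *)
Lemma energy_contraction N h : in_L12 h ->
  (energy_remainder Psi N.+1 h <=
   (r0 ^- 2 * alpha ^+ (2 * N))%:E * moment 0 (fourier h))%E.
Proof.
have m2 : measurable_fun setT (fun xi : V => norm2 xi ^+ 2).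
  by apply: measurable_funX; have := measurable_norm2 0; under eq_fun do rewrite subr0.
have r20 : 0 <= r0 ^- 2 by rewrite invr_ge0 sqr_ge0.
elim: N h => [|N IH] h h12; rewrite energy_remainderS.
  rewrite (eq_esum (b := fun g =>
    \int[mu]_xi (normc (fourier h xi) ^+ 2 * normc (fourier g xi) ^+ 2)%:E)%E); last first.
    move=> g Pg; rewrite energy_remainder0 sqnorm_modulus sqnorm_convolution//; last exact: Psi_L12.
    by apply: eq_integral => xi _; rewrite normcM exprMn.
  have mh := measurable_normc2 (cmeas_fourier h12.1.1).
  rewrite muln0 expr0 mulr1 moment0E -ge0_integralZl//.
  - rewrite (eq_integral (fun xi => (r0 ^- 2 * (norm2 xi ^+ 2 * normc (fourier h xi) ^+ 2))%:E))//.
    apply: le_trans (weighted_sum_le _ _); last 2 first.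
    + by apply: measurable_funM => //; exact: measurable_funM.
    + by move=> xi; apply: mulr_ge0 => //; apply: mulr_ge0; exact: sqr_ge0.
    apply: le_esum => g Pg; apply: ge0_le_integral => //.
    + by move=> xi _; rewrite lee_fin mulr_ge0 ?sqr_ge0.
    + apply/measurable_EFinP; apply: measurable_funM => //.
      by apply: measurable_normc2; exact: cmeas_fourier_filter.
    + apply/measurable_EFinP; apply: measurable_funM; last first.
        by apply: measurable_normc2; exact: cmeas_fourier_filter.
      by apply: measurable_funM => //; exact: measurable_funM.
    + move=> xi _; rewrite lee_fin.
      have [nu center] := Psi_center Pg.
      have [->|/center[r0x _]] := eqVneq (fourier g xi) 0.
        by rewrite normc_real normr0 expr0n/= !mulr0.
      apply: ler_wpM2r; rewrite ?sqr_ge0// mulrA -[leLHS]mul1r ler_wpM2r ?sqr_ge0//.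
      by rewrite mulrC ler_pdivlMr ?exprn_gt0// mul1r ler_sqr ?nnegrE ?norm2_ge0// ltW.
  - by apply/measurable_EFinP; apply: measurable_funM.
  - by move=> xi _; rewrite lee_fin mulr_ge0 ?sqr_ge0.
have c0 : 0 <= r0 ^- 2 * alpha ^+ (2 * N) by rewrite mulr_ge0// exprn_ge0.
have mh := measurable_normc2 (cmeas_fourier h12.1.1).
have H12 g : Psi g -> in_L12 (convolution h g).
  by move=> Pg; apply: convolution_L12 => //; exact: Psi_L12.
apply: (@le_trans _ _ (\esum_(g in Psi) ((r0 ^- 2 * alpha ^+ (2 * N))%:E *
    \int[mu]_xi (alpha ^+ 2 * (norm2 xi ^+ 2 * normc (fourier h xi) ^+ 2) *
                 normc (fourier g xi) ^+ 2)%:E))%E).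
  apply: le_esum => g Pg; have [nu center] := Psi_center Pg.
  apply: le_trans (IH _ (modulus_convolution_L12 h12 Pg)) _.
  apply: lee_wpmul2l; first by rewrite lee_fin.
  apply: le_trans (modulus_moment_le nu (H12 g Pg)) _.
  apply: ge0_le_integral => //.
  - by move=> xi _; rewrite lee_fin sqr_ge0.
  - apply/measurable_EFinP; apply: measurable_funX; apply: measurable_funM; first exact: measurable_norm2.
    by apply: measurable_normc; apply: cmeas_fourier; exact: (H12 g Pg).1.1.
  - apply/measurable_EFinP; apply: measurable_funM; last first.
      by apply: measurable_normc2; exact: cmeas_fourier_filter.
    by apply: measurable_funM => //; exact: measurable_funM.
  - move=> xi _; rewrite lee_fin fourier_convolution//; last exact: Psi_L12.
    have [->|/center[_ ax]] := eqVneq (fourier g xi) 0.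
      by rewrite mulr0 normc_real normr0 mulr0 expr0n/= mulr0.
    rewrite normcM [norm2 _ * (_ * _)]mulrA [(norm2 _ * _ * _) ^+ 2]exprMn.
    apply: ler_wpM2r; first exact: sqr_ge0.
    rewrite [(norm2 _ * _) ^+ 2]exprMn [alpha ^+ 2 * (_ * _)]mulrA; apply: ler_wpM2r; first exact: sqr_ge0.
    rewrite -exprMn.
    by rewrite ler_sqr ?nnegrE ?norm2_ge0// mulr_ge0 ?norm2_ge0.
apply: le_trans (esum_mul_le c0 _) _.
  by move=> g _; apply: integral_ge0 => xi _; rewrite lee_fin; do ?[exact: sqr_ge0|apply: mulr_ge0].
have -> : r0 ^- 2 * alpha ^+ (2 * N.+1) = r0 ^- 2 * alpha ^+ (2 * N) * alpha ^+ 2.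
  by rewrite mulnS addnC exprD mulrA.
rewrite [X in (X * moment _ _)%E]EFinM -muleA; apply: lee_wpmul2l; first by rewrite lee_fin.
rewrite moment0E -ge0_integralZl ?lee_fin ?sqr_ge0//.
- apply: weighted_sum_le; first by apply: measurable_funM => //; exact: measurable_funM.
  by move=> xi; do ?[exact: sqr_ge0|apply: mulr_ge0].
- by apply/measurable_EFinP; exact: measurable_funM.
- by move=> xi _; rewrite lee_fin mulr_ge0 ?sqr_ge0.
Qed.

End contraction.

End littlewood_paley.

(** * From integrable to square integrable signals *)

Section limits_in_L2.
Variables (R : realType) (n : nat).
Local Notation V := 'cV[R]_n.
Local Notation mu := (leb R n).
Implicit Types (f g h : V -> R[i]) (F : nat -> V -> R[i]).

Lemma sqnorm_diffC f g : sqnorm (fun x => f x - g x) = sqnorm (fun x => g x - f x).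
Proof. by apply: eq_sqnorm => x; rewrite -opprB normc_opp. Qed.

Lemma sqnorm_close (t : R) f g : in_L2 f -> in_L2 g -> 0 < t -> t <= 1 ->
  (sqnorm (fun x => f x - g x)%R <= (t ^+ 2)%:E)%E ->
  fine (sqnorm f) <= fine (sqnorm g) + t * (2 * fine (sqnorm g) + 4).
Proof.
move=> f2 g2 t0 t1 fg.
have := @sqnormD_weighted R n t g (fun x => f x - g x) t0 g2.1 (cmeasB f2.1 g2.1).
rewrite (_ : (fun x => g x + (f x - g x)) = f); last by apply/funext => x; rewrite addrC subrK.
have t2 : (0 <= (1 + t^-1)%:E)%E by rewrite lee_fin addr_ge0// invr_ge0 ltW.
move=> /le_trans /(_ (leeD2l _ (lee_wpmul2l t2 fg))).
have g0 : 0 <= fine (sqnorm g) by apply: fine_ge0; exact: sqnorm_ge0.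
rewrite -(fineK (in_L2_fin f2)) -(fineK (in_L2_fin g2)) -!EFinM -EFinD lee_fin => /le_trans; apply.
move: (fine (sqnorm g)) g0 => b b0; have -> : (1 + t^-1) * t ^+ 2 = t ^+ 2 + t by field; lra.
rewrite /=; have tt : t ^+ 2 <= t by rewrite expr2; nra.
by have := mulr_ge0 (ltW t0) b0; nra.
Qed.

(** The two inequalities between the norms are [sqnorm_close] with a small t. *)
Lemma sqnorm_cvg F f : (forall k, in_L2 (F k)) -> in_L2 f ->
  sqnorm (fun x => f x - F k x) @[k --> \oo] --> 0%E ->
  sqnorm (F k) @[k --> \oo] --> sqnorm f.
Proof.
move=> F2 f2 /cvge0P -/(_ (fun k => sqnorm_ge0 _)) H.
rewrite -(fineK (in_L2_fin f2)); apply: cvg_EFin.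
  by near=> k; exact: in_L2_fin.
set a := fine (sqnorm f); have a0 : 0 <= a by apply: fine_ge0; exact: sqnorm_ge0.
apply/cvgrPdist_le => e e0.
(* With this t the errors of both applications of [sqnorm_close] are below e. *)
pose t := Num.min 1 (e / (6 * a + 24)).
have d0 : 0 < 6 * a + 24 by lra.
have t0 : 0 < t by rewrite /t lt_min ltr01 divr_gt0.
have t1 : t <= 1 by rewrite /t ge_min lexx.
have te : t * (6 * a + 24) <= e by rewrite -ler_pdivlMr// /t ge_min lexx orbT.
have tt : 0 < t ^+ 2 by rewrite exprn_gt0.
near=> k.
have hk : (sqnorm (fun x => f x - F k x)%R <= (t ^+ 2)%:E)%E by near: k; exact: H.
have h1 := sqnorm_close f2 (F2 k) t0 t1 hk.
rewrite sqnorm_diffC in hk; have h2 := sqnorm_close (F2 k) f2 t0 t1 hk.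
rewrite /= -/a in h1 h2 *; have b0 : 0 <= fine (sqnorm (F k)) by apply: fine_ge0; exact: sqnorm_ge0.
move: (fine _) h1 h2 b0 => b h1 h2 b0.
rewrite ler_norml; apply/andP; split; nra.
Unshelve. all: by end_near.
Qed.

Definition truncate (m : nat) h : V -> R[i] := fun x => h x * indicator (cube m%:R) x.

Lemma normc_truncate_le m h x : normc (truncate m h x) <= normc (h x).
Proof.
rewrite normcM normc_indicator -[leRHS]mulr1 ler_wpM2l ?normc_ge0// indicE.
Qed.

Lemma truncate_L12 m h : in_L2 h -> in_L12 (truncate m h).
Proof.
move=> h2; have mI := cmeas_indicator (@measurable_cube R n m%:R).
have mt : cmeas (truncate m h) by apply: cmeasM => //; exact: h2.1.
split; last exact: (in_L2_le mt h2 (normc_truncate_le m h)).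
apply: (cintegrable_prod h2).
exact: (in_L2_indicator (m := m%:R) (@measurable_cube R n m%:R)).
Qed.

Lemma truncate_cvg h : in_L2 h -> sqnorm (fun x => h x - truncate k h x) @[k --> \oo] --> 0%E.
Proof.
move=> h2; apply: (@sqnorm_dominated R n (fun k => truncate k h) h (fun x => normc (h x) ^+ 2)).
- by move=> k; exact: (truncate_L12 k h2).1.1.
- exact: h2.1.
- move=> x; apply: cvg_near_cst.
  have [M hM] : exists M : nat, forall i, `|x i ord0| <= M%:R.
    exists (\max_i (Num.trunc `|x i ord0|).+1) => i.
    apply: ltW; apply: (lt_le_trans (truncnS_gt _)); rewrite ler_nat.
    exact: (@leq_bigmax _ (fun i : 'I_n => (Num.trunc `|x i ord0|).+1) i).
  near=> k; rewrite /truncate /indicator indicE mem_set ?mulr1 ?subrr ?normc_real ?normr0//.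
  move=> i /=; rewrite in_itv/= -ler_norml; apply: (le_trans (hM i)); rewrite ler_nat.
  by near: k; exact: nbhs_infty_ge.
- move=> k x; rewrite /truncate /indicator indicE; case: (_ \in _).
    by rewrite mulr1 subrr normc_real normr0 expr0n sqr_ge0.
  by rewrite mulr0 sub0r normc_opp.
- apply/integrableP; split; first exact: measurable_normc2E h2.1.
  by under eq_integral do rewrite /= ger0_norm ?sqr_ge0//; exact: h2.2.
Unshelve. all: by end_near.
Qed.

Lemma convolution_cvg F f g x : (forall k, in_L2 (F k)) -> in_L2 f -> in_L2 g ->
  sqnorm (fun x => f x - F k x) @[k --> \oo] --> 0%E ->
  normc (convolution f g x - convolution (F k) g x) @[k --> \oo] --> (0 : R).
Proof.
move=> F2 f2 g2 /cvge0P -/(_ (fun k => sqnorm_ge0 _)) H.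
apply/cvgrPdist_le => e e0; set b := fine (sqnorm g).
have b0 : 0 <= b by apply: fine_ge0; exact: sqnorm_ge0.
pose t := e / 2 / (b + 1); have t0 : 0 < t by rewrite /t !divr_gt0//; lra.
have tb : t * b <= e / 2 by rewrite /t mulrAC ler_pdivrMr; [nra|lra].
near=> k.
rewrite sub0r normrN ger0_norm ?normc_ge0//.
have E : convolution f g x - convolution (F k) g x = convolution (fun x => f x - F k x) g x.
  by rewrite convolutionB.
rewrite E; apply: (le_trans (convolution_bound x t0 (in_L2B f2 (F2 k)) g2)).
have hk : (sqnorm (fun x => f x - F k x)%R <= (t * (e / 2))%:E)%E.
  by near: k; apply: H; rewrite mulr_gt0// divr_gt0.
move: hk; rewrite -(fineK (in_L2_fin (in_L2B f2 (F2 k)))) lee_fin => hk.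
have : t^-1 * fine (sqnorm (fun x => f x - F k x)) <= e / 2 by rewrite mulrC ler_pdivrMr// mulrC.
rewrite -/b; lra.
Unshelve. all: by end_near.
Qed.

Lemma sqnorm_fatou F f (M : \bar R) : (forall k, cmeas (F k)) ->
  (forall x, normc (f x - F k x) @[k --> \oo] --> (0 : R)) ->
  (forall k, sqnorm (F k) <= M)%E -> (sqnorm f <= M)%E.
Proof.
move=> mF Ff FM.
have -> : sqnorm f = (\int[mu]_x limn_einf (fun k => (normc (F k x) ^+ 2)%:E))%E.
  apply: eq_integral => x _; apply/esym; apply: (cvg_limn_einf_sup _).1.
  apply: cvg_EFin; first by near=> k.
  have h : normc (F k x) @[k --> \oo] --> normc (f x).
    apply/cvgrPdist_le => e e0; have /cvgr0Pnorm_le /(_ _ e0) H := Ff x.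
    near=> k; apply: le_trans (normc_dist _ _) _.
    by rewrite -[leLHS]ger0_norm ?normc_ge0//; near: k.
  exact: (cvgM h h).
apply: le_trans (fatou _ _ _ _) _ => //.
- by move=> k; exact: measurable_normc2E.
- by move=> k x _; rewrite lee_fin sqr_ge0.
rewrite limn_einf_lim; apply: lime_le; first exact: is_cvg_einfs.
by near=> k; apply: le_trans (FM k); apply: ereal_inf_lbound; exists k => //=.
Unshelve. all: by end_near.
Qed.

End limits_in_L2.

Section littlewood_paley_L2.
Variables (R : realType) (n : nat).
Local Notation V := 'cV[R]_n.
Local Notation mu := (leb R n).
Variable Psi : set (V -> R[i]).
Hypothesis Psi_L12 : forall g, Psi g -> in_L12 g.
Hypothesis Psi_le1 :
  \forall xi \ae mu, (\esum_(g in Psi) (normc (fourier g xi) ^+ 2)%:E <= 1)%E.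
Implicit Types (f g h : V -> R[i]).

(** For integrable h this is a case of Bessel's inequality. The convolutions of
    the truncations of h converge pointwise, and Fatou's lemma applies. *)
Lemma convolution_contraction h g : Psi g -> in_L2 h ->
  (sqnorm (convolution h g) <= sqnorm h)%E.
Proof.
move=> Pg h2; have [_ g2] := Psi_L12 Pg.
apply: (@sqnorm_fatou R n (fun k => convolution (truncate k h) g)).
- by move=> k; apply: cmeas_convolution; [exact: (truncate_L12 k h2).1.1|exact: g2.1].
- move=> x; apply: convolution_cvg => //; last exact: truncate_cvg.
  by move=> k; exact: (truncate_L12 k h2).2.
- move=> k; have k12 := truncate_L12 k h2.
  apply: le_trans (convolution_contraction12 Psi_L12 Psi_le1 Pg k12) _.
  by apply: le_sqnorm => [||x]; [exact: k12.1.1|exact: h2.1|exact: normc_truncate_le].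
Qed.

Lemma convolution_L2 h g : Psi g -> in_L2 h -> in_L2 (convolution h g).
Proof.
move=> Pg h2; split; last exact: le_lt_trans (convolution_contraction Pg h2) h2.2.
by apply: cmeas_convolution; [exact: h2.1|exact: (Psi_L12 Pg).1.1].
Qed.

Lemma modulus_L2 f : in_L2 f -> in_L2 (fun x => (normc (f x))%:C).
Proof.
move=> f2; split; last by rewrite sqnorm_modulus f2.2.
by apply: cmeas_real; apply: measurable_normc; exact: f2.1.
Qed.

Lemma modulus_lipschitz f h : in_L2 f -> in_L2 h ->
  (sqnorm (fun x => (normc (f x))%:C - (normc (h x))%:C)%R <= sqnorm (fun x => f x - h x)%R)%E.
Proof.
move=> f2 h2; apply: le_sqnorm => [||x].
- by apply: cmeasB; [exact: (modulus_L2 f2).1|exact: (modulus_L2 h2).1].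
- by apply: cmeasB; [exact: f2.1|exact: h2.1].
- by rewrite -rmorphB normc_real normc_dist.
Qed.

Lemma modulus_convolution_lipschitz f h g : Psi g -> in_L2 f -> in_L2 h ->
  (sqnorm (fun x => (normc (convolution f g x))%:C - (normc (convolution h g x))%:C)%R <=
   sqnorm (fun x => f x - h x)%R)%E.
Proof.
move=> Pg f2 h2; apply: le_trans (modulus_lipschitz _ _) _; try exact: convolution_L2.
rewrite -convolutionB//; last exact: (Psi_L12 Pg).2.
by apply: convolution_contraction => //; exact: in_L2B.
Qed.

Lemma propagate_cons f g p :
  propagate f (g :: p) = propagate (fun x => (normc (convolution f g x))%:C) p.
Proof. by []. Qed.

Lemma propagate_L2 (p : seq (V -> R[i])) f : (forall g, g \in p -> Psi g) -> in_L2 f ->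
  in_L2 (propagate f p).
Proof.
elim: p f => [//|g p IH] f Pp f2; rewrite propagate_cons; apply: IH; first by move=> h hp; apply: Pp; rewrite in_cons hp orbT.
by apply: modulus_L2; apply: convolution_L2 => //; apply: Pp; rewrite in_cons eqxx.
Qed.

Lemma propagate_lipschitz (p : seq (V -> R[i])) f h : (forall g, g \in p -> Psi g) ->
  in_L2 f -> in_L2 h ->
  (sqnorm (fun x => propagate f p x - propagate h p x)%R <= sqnorm (fun x => f x - h x)%R)%E.
Proof.
elim: p f h => [//|g p IH] f h Pp f2 h2; rewrite !propagate_cons.
have Pg : Psi g by apply: Pp; rewrite in_cons eqxx.
apply: le_trans (IH _ _ _ _ _) _.
- by move=> k kp; apply: Pp; rewrite in_cons kp orbT.
- by apply: modulus_L2; exact: convolution_L2.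
- by apply: modulus_L2; exact: convolution_L2.
- exact: modulus_convolution_lipschitz.
Qed.

(** Along finitely many paths, propagation is continuous in the mean square. *)
Lemma energy_remainder_limit N (F : nat -> V -> R[i]) f (c : R) (u : nat -> V -> R[i]) v :
  0 <= c -> (forall k, in_L2 (F k)) -> in_L2 f -> (forall k, in_L2 (u k)) -> in_L2 v ->
  sqnorm (fun x => f x - F k x) @[k --> \oo] --> 0%E ->
  sqnorm (fun x => v x - u k x) @[k --> \oo] --> 0%E ->
  (forall k, energy_remainder Psi N (F k) <= c%:E * sqnorm (u k))%E ->
  (energy_remainder Psi N f <= c%:E * sqnorm v)%E.
Proof.
move=> c0 F2 f2 u2 v2 Ff uv h; apply: esum_le_finite => A [finA APsi].
have Pp p : A p -> forall g, g \in tval p -> Psi g.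
  by move=> /APsi Pp g /tnthP[i ->]; exact: Pp.
have cF p : A p -> sqnorm (propagate (F k) p) @[k --> \oo] --> sqnorm (propagate f p).
  move=> Ap; apply: sqnorm_cvg => [k||]; [exact/propagate_L2/F2/Pp|exact/propagate_L2/f2/Pp|].
  apply: (squeeze_cvge _ (cvg_cst 0%E) Ff).
  near=> k; rewrite sqnorm_ge0/=; apply: propagate_lipschitz => //; exact: Pp.
have cL : (\sum_(p \in A) sqnorm (propagate (F k) p))%E @[k --> \oo] -->
    (\sum_(p \in A) sqnorm (propagate f p))%E.
  under eq_cvg do rewrite fsbig_finite//= big_seq.
  rewrite fsbig_finite//= big_seq.
  apply: cvg_nnesum => [p _|p]; first by near=> k; exact: sqnorm_ge0.
  by rewrite in_fset_set// inE => /cF.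
have cR : (c%:E * sqnorm (u k))%E @[k --> \oo] --> (c%:E * sqnorm v)%E.
  by apply: cvgeZl => //; exact: sqnorm_cvg.
apply: (lee_cvg_to cL cR); near=> k; apply: le_trans (h k).
by apply: finite_le_esum.
Unshelve. all: by end_near.
Qed.

(** Both sides are continuous in f for the mean square, and they agree on the
    approximants that define the transform F. *)
Lemma sqnorm_convolution_fourier f F g : is_fourier_L2 f F -> Psi g ->
  sqnorm (convolution f g) = sqnorm (fun xi => F xi * fourier g xi).
Proof.
move=> [f2 F2 [u [u12 uf uF]]] Pg; have [g1 g2] := Psi_L12 Pg.
have u2 k : in_L2 (u k) by exact: (u12 k).2.
have mg := cmeas_fourier_filter Psi_L12 Pg.
have ghat_bound : forall h, in_L2 h -> in_L2 (fun xi => h xi * fourier g xi) /\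
    (sqnorm (fun xi => h xi * fourier g xi)%R <= (norm1 g ^+ 2)%:E * sqnorm h)%E.
  move=> h h2; have mhg : cmeas (fun xi => h xi * fourier g xi) by apply: cmeasM => //; exact: h2.1.
  suff H : (sqnorm (fun xi => h xi * fourier g xi)%R <= (norm1 g ^+ 2)%:E * sqnorm h)%E.
    split=> //; split=> //; apply: le_lt_trans H _.
    by rewrite lte_mul_pinfty ?lee_fin ?sqr_ge0// h2.2.
  have n0 : 0 <= norm1 g by apply: le_trans (normc_fourier_le 0 g1); exact: normc_ge0.
  have -> : ((norm1 g ^+ 2)%:E * sqnorm h)%E = sqnorm (fun xi => (norm1 g)%:C * h xi).
    by rewrite sqnormZ ?normc_real ?ger0_norm//; exact: h2.1.
  apply: le_sqnorm => [//||xi]; first by apply: cmeasM; [exact: cmeas_cst|exact: h2.1].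
  rewrite !normcM normc_real ger0_norm// mulrC ler_wpM2r ?normc_ge0//.
  exact: normc_fourier_le.
have hat2 k : in_L2 (fourier (u k)).
  split; first by apply: cmeas_fourier; exact: (u12 k).1.1.
  by rewrite (plancherel (u12 k).1 (u2 k)); exact: (u2 k).2.
have c1 : sqnorm (convolution (u k) g) @[k --> \oo] --> sqnorm (convolution f g).
  apply: sqnorm_cvg => [k||]; [exact: convolution_L2|exact: convolution_L2|].
  apply: (squeeze_cvge _ (cvg_cst 0%E) uf); near=> k; rewrite sqnorm_ge0/=.
  rewrite -convolutionB//; apply: le_trans (convolution_contraction Pg (in_L2B f2 (u2 k))) _.
  by rewrite sqnorm_diffC.
have c2 : sqnorm (fun xi => fourier (u k) xi * fourier g xi) @[k --> \oo] -->
    sqnorm (fun xi => F xi * fourier g xi).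
  apply: sqnorm_cvg => [k||]; [exact: (ghat_bound _ (hat2 k)).1|exact: (ghat_bound _ F2).1|].
  have z : ((norm1 g ^+ 2)%:E * sqnorm (fourier (u k) \- F)%R)%E @[k --> \oo] --> 0%E.
    by rewrite -[X in _ --> X](mule0 (norm1 g ^+ 2)%:E); apply: cvgeZl.
  apply: (squeeze_cvge _ (cvg_cst 0%E) z); near=> k; rewrite sqnorm_ge0/=.
  apply: le_trans (ghat_bound _ (in_L2B (hat2 k) F2)).2.
  by rewrite sqnorm_diffC; under [X in (_ <= sqnorm X)%E]eq_fun do rewrite mulrBl.
have E k : sqnorm (convolution (u k) g) = sqnorm (fun xi => fourier (u k) xi * fourier g xi).
  by apply: sqnorm_convolution => //; exact: Psi_L12.
rewrite (_ : (fun k => sqnorm (convolution (u k) g)) =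
  (fun k => sqnorm (fun xi => fourier (u k) xi * fourier g xi))) in c1; last first.
  by apply/funext => k; exact: E.
exact: (cvg_unique (@ereal_hausdorff R) c1 c2).
Unshelve. all: by end_near.
Qed.

Variables (r0 alpha : R).
Hypothesis r0_gt0 : 0 < r0.
Hypothesis alpha_ge0 : 0 <= alpha.
Hypothesis Psi_center : forall g, Psi g -> exists nu, forall xi, fourier g xi != 0 ->
  r0 <= norm2 xi /\ norm2 (xi - nu) <= alpha * norm2 xi.

(** The share of the energy of a filtered signal that can survive N + 1 further
    layers when the spectrum of the filter lies in a ball of radius r. *)
Definition damping N (r : R) : R := Num.min 1 (r0 ^- 2 * alpha ^+ (2 * N) * r ^+ 2).

Lemma damping_ge0 N r : 0 <= damping N r.
Proof.
rewrite /damping le_min ler01/= mulr_ge0 ?sqr_ge0// mulr_ge0 ?exprn_ge0//.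
by rewrite invr_ge0 sqr_ge0.
Qed.

(** The bound by 1 holds because no energy is created. The other one combines
    [energy_contraction] with demodulation at the centre nu of the band. *)
Lemma localized_energy12 N h g nu r : in_L12 h -> Psi g ->
  (forall xi, fourier g xi != 0 -> norm2 (xi - nu) <= r) ->
  (energy_remainder Psi N.+1 (fun x => (normc (convolution h g x))%:C) <=
   (damping N r)%:E * sqnorm (convolution h g))%E.
Proof.
move=> h12 Pg rP; have m12 := modulus_convolution_L12 Psi_L12 h12 Pg.
have hg12 : in_L12 (convolution h g) by apply: convolution_L12 => //; exact: Psi_L12.
have := energy_remainder_le Psi_L12 Psi_le1 N.+1 m12; rewrite sqnorm_modulus => B1.
rewrite /damping minEle; case: ifP => _; first by rewrite mul1e.
have c0 : 0 <= r0 ^- 2 * alpha ^+ (2 * N).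
  by rewrite mulr_ge0 ?exprn_ge0// invr_ge0 sqr_ge0.
apply: le_trans (energy_contraction Psi_L12 Psi_le1 r0_gt0 alpha_ge0 Psi_center N m12) _.
rewrite [X in (_ <= X * _)%E]EFinM -muleA; apply: lee_wpmul2l; first by rewrite lee_fin.
apply: le_trans (modulus_moment_le nu hg12) _.
rewrite -(plancherel hg12.1 hg12.2) -ge0_integralZl ?lee_fin ?sqr_ge0//; last 2 first.
- by apply: measurable_normc2E; apply: cmeas_fourier; exact: hg12.1.1.
- by move=> xi _; rewrite lee_fin sqr_ge0.
apply: ge0_le_integral => //.
- by move=> xi _; rewrite lee_fin sqr_ge0.
- apply/measurable_EFinP; apply: measurable_funX; apply: measurable_funM; first exact: measurable_norm2.
  by apply: measurable_normc; apply: cmeas_fourier; exact: hg12.1.1.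
- by apply: measurable_funeM; apply: measurable_normc2E; apply: cmeas_fourier; exact: hg12.1.1.
- move=> xi _; rewrite -EFinM lee_fin -exprMn.
  have [r_0|z] : norm2 (xi - nu) <= r \/ fourier (convolution h g) xi = 0.
    rewrite fourier_convolution//; last exact: Psi_L12.
    by have [->|/rP] := eqVneq (fourier g xi) 0; [right; rewrite mulr0|left].
  + rewrite ler_sqr ?nnegrE ?mulr_ge0 ?norm2_ge0 ?normc_ge0 ?(le_trans _ r_0) ?norm2_ge0//.
    by rewrite ler_wpM2r ?normc_ge0.
  + by rewrite z normc_real normr0 !mulr0.
Qed.

Lemma localized_energy N f g nu r : in_L2 f -> Psi g ->
  (forall xi, fourier g xi != 0 -> norm2 (xi - nu) <= r) ->
  (energy_remainder Psi N.+1 (fun x => (normc (convolution f g x))%:C) <=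
   (damping N r)%:E * sqnorm (convolution f g))%E.
Proof.
move=> f2 Pg rP; have t12 k := truncate_L12 k f2; have tf := truncate_cvg f2.
have t2 k : in_L2 (truncate k f) by exact: (t12 k).2.
apply: (@energy_remainder_limit _ (fun k x => (normc (convolution (truncate k f) g x))%:C)
   _ _ (fun k => convolution (truncate k f) g)).
- exact: damping_ge0.
- by move=> k; apply: modulus_L2; exact: convolution_L2.
- by apply: modulus_L2; exact: convolution_L2.
- by move=> k; exact: convolution_L2.
- exact: convolution_L2.
- apply: (squeeze_cvge _ (cvg_cst 0%E) tf); near=> k; rewrite sqnorm_ge0/=.
  exact: modulus_convolution_lipschitz.
- apply: (squeeze_cvge _ (cvg_cst 0%E) tf); near=> k; rewrite sqnorm_ge0/=.
  rewrite -convolutionB//; last exact: (Psi_L12 Pg).2.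
  by apply: convolution_contraction => //; exact: in_L2B.
- by move=> k; exact: (localized_energy12 N (t12 k) Pg rP).
Unshelve. all: by end_near.
Qed.

Theorem energy_remainder_decay N f (rad : (V -> R[i]) -> R) : in_L2 f ->
  (forall g, Psi g -> exists nu, forall xi, fourier g xi != 0 -> norm2 (xi - nu) <= rad g) ->
  (energy_remainder Psi N.+2 f <=
   \esum_(g in Psi) ((damping N (rad g))%:E * sqnorm (convolution f g)))%E.
Proof.
move=> f2 radP; rewrite energy_remainderS; apply: le_esum => g Pg.
by have [nu nuP] := radP _ Pg; exact: (localized_energy N f2 Pg nuP).
Qed.

End littlewood_paley_L2.

(** * Contraction on a cone intersected with a shell *)

Section contraction_rate.
Variables (R : realType) (K rho : R).
Hypothesis K1 : 1 < K.
Hypothesis rho01 : 0 <= rho < 1.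

Definition contraction_rate : R :=
  Num.sqrt (1 - 4 * K / (1 + K) ^+ 2 * (1 - rho) ^+ 2).

Lemma contraction_defect_bounds : 0 < 4 * K / (1 + K) ^+ 2 * (1 - rho) ^+ 2 < 1.
Proof.
have hK := K1; have [r_0 r_1] := andP rho01; have uK : 0 < 1 + K by lra.
have u0 : 0 < (1 + K) ^+ 2 by rewrite exprn_gt0//; lra.
have q0 : 0 < (1 - rho) ^+ 2 by rewrite exprn_gt0//; lra.
have q1 : (1 - rho) ^+ 2 <= 1 by rewrite expr2; nra.
have D0 : 0 < 4 * K / (1 + K) ^+ 2 by rewrite divr_gt0//; lra.
have D1 : 4 * K / (1 + K) ^+ 2 < 1.
  by rewrite ltr_pdivrMr// mul1r expr2; nra.
by rewrite mulr_gt0//=; nra.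
Qed.

Lemma contraction_rate_sqr :
  contraction_rate ^+ 2 = 1 - 4 * K / (1 + K) ^+ 2 * (1 - rho) ^+ 2.
Proof. by rewrite sqr_sqrtr//; have /andP[] := contraction_defect_bounds; lra. Qed.

Lemma contraction_rate_bounds : 0 < contraction_rate < 1.
Proof.
have /andP[d0 d1] := contraction_defect_bounds.
rewrite sqrtr_gt0 subr_gt0 d1/= -[ltRHS]sqrtr1 ltr_sqrt//; lra.
Qed.

(** The coefficient 2 (1 - rho) r K / (K + 1) is the distance of the optimal
    centre from the origin. For it the two ends s = r and s = r K of the shell
    are equally critical: if p = (1 - rho) s, the difference of the two sides is
    a positive multiple of (s - r) (s - r K). *)
Lemma contraction_rate_quadratic (r p s : R) : 0 < r -> r <= s <= r * K ->
  (1 - rho) * s <= p ->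
  s ^+ 2 - 2 * (2 * (1 - rho) * r * K / (K + 1) * p) + (2 * (1 - rho) * r * K / (K + 1)) ^+ 2 <=
  contraction_rate ^+ 2 * s ^+ 2.
Proof.
move=> r0 /andP[rs sK] sp; rewrite contraction_rate_sqr.
have hK := K1; have [r_0 r_1] := andP rho01; have uK : 0 < K + 1 by lra.
set c := 2 * _ * _ * _ / _.
have cpos : 0 <= c.
  by rewrite /c; apply: divr_ge0; [do !apply: mulr_ge0|]; lra.
have hp := ler_wpM2l cpos sp.
rewrite -subr_le0; set D := (4 * K / _).
have E : c ^+ 2 - 2 * c * (1 - rho) * s + D * (1 - rho) ^+ 2 * s ^+ 2 =
    D * (1 - rho) ^+ 2 * ((s - r) * (s - r * K)) by rewrite /c /D; field; lra.
have D0 : 0 <= D * (1 - rho) ^+ 2 by have /andP[/ltW] := contraction_defect_bounds.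
have h : (s - r) * (s - r * K) <= 0 by rewrite mulr_ge0_le0//; lra.
have := mulr_ge0_le0 D0 h; rewrite -E; lra.
Qed.

End contraction_rate.

Section geometry.
Variables (R : realType) (n : nat).
Local Notation V := 'cV[R]_n.
Implicit Types (x y nu xi : V) (A M : 'M[R]_n).

Lemma norm2_inner x : norm2 x ^+ 2 = inner x x.
Proof. by rewrite norm2_sqr; apply: eq_bigr => i _; rewrite expr2. Qed.

Lemma innerE x y : inner x y = (x^T *m y) ord0 ord0.
Proof. by rewrite mxE; apply: eq_bigr => i _; rewrite mxE. Qed.

Lemma inner_orthogonal A x y : orthogonal_group A -> inner (A *m x) (A *m y) = inner x y.
Proof. by move=> AO; rewrite !innerE trmx_mul mulmxA -(mulmxA _ A^T) AO mulmx1. Qed.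

Lemma norm2_orthogonal A x : orthogonal_group A -> norm2 (A *m x) = norm2 x.
Proof.
move=> AO; apply/eqP; rewrite -(@eqrXn2 _ 2) ?norm2_ge0//.
by rewrite !norm2_inner inner_orthogonal.
Qed.

Lemma orthogonal_unit A : orthogonal_group A -> A \in unitmx.
Proof. by move=> AO; case/mulmx1_unit : AO. Qed.

Lemma orthogonal_inv A : orthogonal_group A -> orthogonal_group (invmx A).
Proof.
move=> AO; have uA := orthogonal_unit AO.
have -> : invmx A = A^T by rewrite -[RHS]mulmx1 -(mulmxV uA) mulmxA AO mul1mx.
by rewrite /orthogonal_group/= trmxK; exact: mulmx1C.
Qed.

Lemma norm2Z (c : R) x : 0 <= c -> norm2 (c *: x) = c * norm2 x.
Proof.
move=> c0; apply/eqP; rewrite -(@eqrXn2 _ 2) ?norm2_ge0// ?mulr_ge0 ?norm2_ge0//.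
by rewrite exprMn !norm2_inner innerZl innerZr mulrA expr2.
Qed.

Lemma norm2B_sqr x y : norm2 (x - y) ^+ 2 = norm2 x ^+ 2 - 2 * inner x y + norm2 y ^+ 2.
Proof.
by rewrite !norm2_inner innerDl !innerDr !innerNl !innerNr (innerC y x); ring.
Qed.

Lemma coord_le_norm2 x i : `|x i ord0| <= norm2 x.
Proof.
rewrite -(@ler_pXn2r _ 2)// ?nnegrE ?norm2_ge0// norm2_sqr (bigD1 i)//=.
rewrite real_normK ?num_real// lerDl; apply: sumr_ge0 => j _; exact: sqr_ge0.
Qed.

Lemma norm2_diagonal : (0 < n)%N -> norm2 (diagonal_direction R n) = 1.
Proof.
move=> n0; apply/eqP; rewrite -(@eqrXn2 _ 2) ?norm2_ge0// norm2_sqr expr1n; apply/eqP.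
rewrite (eq_bigr (fun=> n%:R^-1)); last first.
  by move=> i _; rewrite mxE exprVn sqr_sqrtr.
by rewrite big_const_ord iter_addr_0 -[LHS]mulr_natr mulVf// pnatr_eq0 -lt0n.
Qed.

Section cone_contraction.
Variables (K rho : R).
Hypothesis K1 : 1 < K.
Hypothesis rho01 : 0 <= rho < 1.
Hypothesis n0 : (0 < n)%N.

Definition cone_center (r : R) : V :=
  (2 * (1 - rho) * r * K / (K + 1)) *: diagonal_direction R n.

Lemma cone_center_le r x : 0 < r -> cone rho x -> r <= norm2 x <= r * K ->
  norm2 (x - cone_center r) <= contraction_rate K rho * norm2 x.
Proof.
move=> r0 [_ xc] rxK; rewrite -(@ler_pXn2r _ 2)// ?nnegrE ?norm2_ge0 ?mulr_ge0 ?norm2_ge0 ?sqrtr_ge0//.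
rewrite norm2B_sqr innerZr exprMn.
have /andP[_ r_1] := rho01.
have cpos : 0 <= 2 * (1 - rho) * r * K / (K + 1).
  by apply: divr_ge0; [do !apply: mulr_ge0|]; rewrite ?subr_ge0 ?addr_ge0 ?ltW// (lt_trans ltr01).
by rewrite norm2Z// norm2_diagonal// mulr1; exact: contraction_rate_quadratic.
Qed.

End cone_contraction.

Lemma continuous_norm2 nu : continuous (fun x : V => norm2 (x - nu)).
Proof.
move=> x0; apply: (continuous_comp (g := @Num.sqrt R)); last exact: sqrt_continuous.
move: x0; apply: (continuous_big (op := +%R)) => [|i _ x]; first exact: add_continuous.
have c := @coord_continuous R n 1 i ord0 x.
have c2 : continuous (fun t : R => (t - nu i ord0) ^+ 2).
  move=> t; have h : s - nu i ord0 @[s --> t] --> t - nu i ord0.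
    by apply: cvgB; [exact: cvg_id|exact: cvg_cst].
  exact: (cvgM h h).
rewrite (_ : (fun _ => _) = (fun t : R => (t - nu i ord0) ^+ 2) \o (fun M : V => M i ord0)).
  exact: (continuous_comp c (c2 _)).
by apply/funext => y; rewrite !mxE.
Qed.

Lemma closure_norm2_le (S : set V) nu r : (forall x, S x -> norm2 (x - nu) <= r) ->
  forall x, closure S x -> norm2 (x - nu) <= r.
Proof.
move=> Sr; have cl : closed [set x : V | norm2 (x - nu) <= r].
  apply: (@closed_comp _ _ (fun x : V => norm2 (x - nu)) [set y | y <= r]) => [x _|].
    exact: continuous_norm2.
  exact: closed_le.
move=> x Sx; have : closure [set x : V | norm2 (x - nu) <= r] x by apply: closure_subset Sx.
by rewrite -((closure_id _).1 cl).
Qed.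

(** The infimum over the centres need not be attained, hence the factor 2. If it
    is 0, any two points of the spectrum coincide. *)
Lemma band_radius_center (g : V -> R[i]) nu r :
  (forall xi, fourier g xi != 0 -> norm2 (xi - nu) <= r) ->
  0 <= band_radius g /\ exists nu', forall xi, fourier g xi != 0 ->
    norm2 (xi - nu') <= 2 * band_radius g.
Proof.
move=> gr.
have [[xi0 xi0g]|noxi] := pselect (exists xi, fourier g xi != 0); last first.
  have suppE : supp (fourier g) = set0.
    rewrite /supp (_ : [set x | _] = set0) ?closure0//.
    by apply/seteqP; split=> // xi /= h; apply: noxi; exists xi.
  have -> : band_radius g = 0.
    rewrite /band_radius (_ : [set ereal_sup _ | _ in _] = [set -oo%E]) ?ereal_inf1//.
    apply/seteqP; split=> [_ [xi _ <-]|_ ->]; first by rewrite suppE image_set0 ereal_sup0.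
    by exists 0 => //; rewrite suppE image_set0 ereal_sup0.
  by split=> //; exists 0 => xi h; exfalso; apply: noxi; exists xi.
have sr := closure_norm2_le gr.
set S : set (\bar R) := [set ereal_sup [set (norm2 (xi - xi'))%:E | xi in supp (fourier g)]
                  | xi' in [set: V]].
have S0 : (0 <= ereal_inf S)%E.
  apply: le_ereal_inf_tmp => _ [nu' _ <-]; apply: ereal_sup_ge.
  exists (norm2 (xi0 - nu'))%:E; last by rewrite lee_fin norm2_ge0.
  by exists xi0 => //; apply: subset_closure.
have Sr : (ereal_inf S <= r%:E)%E.
  apply: ge_ereal_inf; exists (ereal_sup [set (norm2 (xi - nu))%:E | xi in supp (fourier g)]); first by exists nu.
  by apply: ge_ereal_sup => _ [xi xis <-]; rewrite lee_fin sr.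
have Sfin : ereal_inf S \is a fin_num by rewrite ge0_fin_numE// (le_lt_trans Sr)// ltry.
have d0 : 0 <= band_radius g by apply: fine_ge0.
have dE : ((band_radius g)%:E = ereal_inf S)%E by rewrite fineK.
have approx e : band_radius g < e -> exists nu', forall xi, fourier g xi != 0 -> norm2 (xi - nu') <= e.
  move=> de; have : (ereal_inf S < e%:E)%E by rewrite -dE lte_fin.
  move=> /ereal_inf_lt[_ [nu' _ <-]] h; exists nu' => xi xig; rewrite -lee_fin; apply: le_trans (ltW h).
  by apply: ereal_sup_ubound; exists xi => //; exact: subset_closure.
split=> //; have [dpos|dneg] := ltP 0 (band_radius g).
  by apply: approx; lra.
have de : band_radius g = 0 by apply/eqP; rewrite eq_le dneg.
(* The spectrum lies in balls of arbitrarily small radius about varying centres. *)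
exists xi0 => xi xig; rewrite de mulr0.
suff -> : xi = xi0 by rewrite subrr /norm2 big1 ?sqrtr0// => i _; rewrite mxE expr0n.
apply/colP => i; apply/eqP; rewrite -subr_eq0 -normr_le0; apply/ler_addgt0Pr => e e0; rewrite add0r.
have [|nu' h] := approx (e / 2); first by rewrite de divr_gt0.
have := le_trans (coord_le_norm2 (xi - nu') i) (h _ xig).
have := le_trans (coord_le_norm2 (xi0 - nu') i) (h _ xi0g).
rewrite !mxE => h1 h2.
have -> : xi i ord0 - xi0 i ord0 = (xi i ord0 - nu' i ord0) - (xi0 i ord0 - nu' i ord0) by ring.
by apply: le_trans (ler_normB _ _) _; lra.
Qed.

End geometry.

(** * Fourier supports of the wavelets *)

Section wavelet_support.
Variables (R : realType) (n : nat).
Local Notation V := 'cV[R]_n.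
Local Notation mu := (leb R n).
Implicit Types (psi g : V -> R[i]) (x xi nu : V) (M : 'M[R]_n) (a : R) (j : int).

Lemma wavelet_dilationV a j M : a != 0 -> M \in unitmx ->
  (a ^ j *: invmx M) *m (a ^ (- j) *: M) = 1%:M /\
  (a ^ (- j) *: M) *m (a ^ j *: invmx M) = 1%:M.
Proof.
move=> a0 uM; rewrite -!scalemxAl -!scalemxAr !scalerA mulVmx// mulmxV//.
by rewrite -!expfzDr// subrr addNr expr0z scale1r.
Qed.

Lemma cmeas_wavelet psi a l : cmeas psi -> cmeas (wavelet psi a l).
Proof.
move=> mpsi; apply: cmeasM; first exact: cmeas_cst.
apply: (cmeas_comp (h := fun x : V => a ^ l.1 *: (invmx l.2 *m x))) => //.
under eq_fun do rewrite scalemxAl.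
exact: measurable_mulmxV.
Qed.

(** Substitution of y = a^j M^-1 x, whose Jacobian enters the constant c. *)
Lemma fourier_wavelet psi a j M : 0 < a -> orthogonal_group M -> cintegrable mu psi ->
  exists c : R[i], forall xi,
    fourier (wavelet psi a (j, M)) xi = c * fourier psi (a ^ (- j) *: (invmx M *m xi)).
Proof.
move=> a0 MO psi1; have [BB' B'B] := wavelet_dilationV j (lt0r_neq0 a0) (orthogonal_unit MO).
have [c c0 cP] := cint_leb_linear BB' B'B.
pose k := (a ^ (n%:Z * j))%:C; exists (c%:C * k) => xi.
set eta := _ *: _; rewrite -mulrA [fourier psi eta]fourierE.
rewrite -cintZ; last exact: cintegrable_character.
rewrite -cP; last by apply: cintegrableZ; exact: cintegrable_character.
rewrite fourierE; apply: eq_cint => x; rewrite /wavelet /= -/k -mulrA; congr (_ * (_ * _)).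
  by rewrite scalemxAl.
rewrite /character; congr (cis (_ * _)); rewrite -scalemxAl /eta innerZl innerZr.
rewrite inner_orthogonal; last exact: orthogonal_inv.
by rewrite mulrA -expfzDr ?lt0r_neq0// subrr expr0z mul1r.
Qed.

Lemma fourier_ae psi g : cmeas psi -> cmeas g -> g = psi %[ae mu] -> fourier g = fourier psi.
Proof.
move=> mp mg gp; apply/funext => xi; rewrite !fourierE; apply: ae_eq_cint.
- by apply: cmeasM => //; exact: cmeas_character.
- by apply: cmeasM => //; exact: cmeas_character.
- by apply: filterS gp => x /= ->.
Qed.

Section filters.
Variables (a rho : R) (kappa : nat) (G : set 'M[R]_n) (J : int) (psi : V -> R[i]).
Variables (Psi : set (V -> R[i])) (Mpsi : 'M[R]_n).
Hypothesis n_gt0 : (0 < n)%N.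
Hypothesis a_gt1 : 1 < a.
Hypothesis G_orthogonal : G `<=` @orthogonal_group R n.
Hypothesis psi_L12 : in_L12 psi.
Hypothesis Psi_Wav : same_filters Psi (Wav psi a G J).
Hypothesis Mpsi_orthogonal : orthogonal_group Mpsi.
Hypothesis rho01 : 0 <= rho < 1.
Hypothesis kappa_gt0 : (0 < kappa)%N.
Hypothesis psi_supp : supp (fourier psi) `<=`
  rotated_cone Mpsi rho `&` shell a^-1 (a ^+ kappa.-1).

Let alpha := contraction_rate (a ^+ kappa) rho.

(** The spectrum of the wavelet at scale a^j M is that of psi, dilated by a^j and
    rotated by M, and the centre of the cone moves along. The last inequality
    says that the radius of the band is comparable to each of its frequencies,
    as the outer radius of the shell is a^kappa times the inner one. *)
Lemma filter_support g : Psi g -> exists nu r, forall xi, fourier g xi != 0 ->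
  [/\ a ^ (- J) <= norm2 xi, norm2 (xi - nu) <= alpha * norm2 xi,
      norm2 (xi - nu) <= r & r <= alpha * a ^+ kappa * norm2 xi].
Proof.
move=> Pg; have [hP _ _] := Psi_Wav.
have [[g1 _] [_ [[j M] [/= jJ GM] <-] gw]] := hP g Pg.
have a0 : 0 < a by apply: lt_trans a_gt1.
have MO := G_orthogonal GM.
rewrite (fourier_ae (cmeas_wavelet _ _ psi_L12.1.1) g1.1 gw).
have [c cP] := fourier_wavelet j a0 MO psi_L12.1.
pose t := a ^ j; have t0 : 0 < t by rewrite exprz_gt0.
have K1 : 1 < a ^+ kappa by rewrite exprn_egt1// -lt0n.
have al0 : 0 <= alpha by rewrite sqrtr_ge0.
exists (t *: (M *m (Mpsi *m cone_center n (a ^+ kappa) rho a^-1))).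
exists (alpha * (t * a ^+ kappa.-1)) => xi.
rewrite cP mulf_eq0 negb_or => /andP[_ etan0].
have etas : supp (fourier psi) (a ^ (- j) *: (invmx M *m xi)) by exact: subset_closure.
have [[x xcone xE] etashell] := psi_supp etas.
have xiE : xi = t *: (M *m (Mpsi *m x)).
  rewrite xE -scalemxAr scalerA mulmxA mulmxV ?mul1mx; last exact: orthogonal_unit.
  by rewrite /t -expfzDr ?lt0r_neq0// subrr expr0z scale1r.
have hK : a^-1 * a ^+ kappa = a ^+ kappa.-1.
  by rewrite -[in LHS](prednK kappa_gt0) exprS mulrA mulVf ?mul1r// lt0r_neq0.
have xs : a^-1 <= norm2 x <= a^-1 * a ^+ kappa.
  have <- : norm2 (Mpsi *m x) = norm2 x by exact: norm2_orthogonal.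
  by rewrite xE hK.
have xiN : norm2 xi = t * norm2 x.
  by rewrite xiE norm2Z ?(ltW t0)// !norm2_orthogonal.
have d : norm2 (xi - t *: (M *m (Mpsi *m cone_center n (a ^+ kappa) rho a^-1))) <= alpha * norm2 xi.
  rewrite {1}xiE -scalerBr -!mulmxBr norm2Z ?(ltW t0)// !norm2_orthogonal//.
  rewrite xiN mulrCA ler_wpM2l ?(ltW t0)//; apply: cone_center_le => //.
  by rewrite invr_gt0.
have /andP[xs1 xs2] := xs.
split=> //.
- rewrite xiN; apply: (@le_trans _ _ (t * a^-1)); last by rewrite ler_wpM2l// ltW.
  by rewrite /t -exprN1 -expfzDr ?lt0r_neq0// ler_weXz2l ?(ltW a_gt1)// lerBrDr lezD1.
- apply: (le_trans d); rewrite ler_wpM2l// xiN ler_wpM2l ?(ltW t0)// -hK; exact: xs2.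
- rewrite -mulrA ler_wpM2l// xiN mulrCA ler_wpM2l ?(ltW t0)// -hK mulrC.
  by rewrite ler_wpM2l// exprn_ge0// ltW.
Qed.

Lemma filter_center g : Psi g -> exists nu, forall xi, fourier g xi != 0 ->
  a ^ (- J) <= norm2 xi /\ norm2 (xi - nu) <= alpha * norm2 xi.
Proof. by move=> /filter_support[nu [r h]]; exists nu => xi /h[]. Qed.

End filters.

Lemma Littlewood_Paley_le1 chi (Psi : set (V -> R[i])) : Littlewood_Paley chi Psi ->
  \forall xi \ae mu, (\esum_(g in Psi) (normc (fourier g xi) ^+ 2)%:E <= 1)%E.
Proof.
rewrite /Littlewood_Paley => H; apply: filterS H => xi <-; apply: leeDr; rewrite lee_fin; exact: sqr_ge0.
Qed.

End wavelet_support.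

(** * Elementary rates *)

Section rates.
Variable R : realType.
Implicit Types (alpha d m s t x y T : R) (omega : R -> R).

Lemma eventually_le_invX alpha T : 0 < alpha < 1 ->
  exists N0, forall N, (N0 <= N)%N -> T <= alpha ^- N.
Proof.
move=> /andP[a0 a1]; pose e : R := (`|T| + 1)^-1.
have e0 : 0 < e by rewrite invr_gt0; have := normr_ge0 T; lra.
have : alpha ^+ k @[k --> \oo] --> (0 : R) by apply: cvg_expr; rewrite ger0_norm// ltW.
move=> /cvgr0Pnorm_le/(_ _ e0)[N0 _ h]; exists N0 => N N0N.
have := h N N0N; rewrite /= ger0_norm ?exprn_ge0 ?(ltW a0)// => aN.
apply: (@le_trans _ _ e^-1); first by rewrite invrK; have := ler_norm T; lra.
by rewrite lef_pV2// posrE// exprn_gt0.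
Qed.

(** Up to constants: for d >= t by the monotonicity of omega, for T <= d < t by
    that of the weight ratio, and for d < T because the weight ratio is bounded
    there and at least its value at T from T on. *)
Lemma weight_comparison omega : weakly_dominated_weight 2 omega ->
  exists2 T, 0 < T & forall C1, 0 <= C1 -> exists2 C, 0 < C & forall d t, 0 < d -> T <= t ->
    Num.min 1 (C1 * (d / t) ^+ 2) <= C * (omega d ^+ 2 * omega t ^- 2).
Proof.
move=> [wpos wmono [T [T0 [B hB] hmono _]]]; exists T => // C1 C10.
have hE u : 0 < u -> weight_ratio 2 omega u = u ^+ 2 / omega u ^+ 2.
  by move=> u0; rewrite /weight_ratio powR_mulrn// ltW.
have h0 : 0 < T ^+ 2 / omega T ^+ 2 by rewrite divr_gt0// exprn_gt0// wpos.
set hT := T ^+ 2 / _ in h0.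
have B0 : 0 <= `|B| / hT by rewrite divr_ge0// ltW.
exists (1 + C1 + C1 * (`|B| / hT)); first by have := mulr_ge0 C10 B0; lra.
move=> d t d0 Tt; have t0 : 0 < t by apply: lt_le_trans Tt.
have od := wpos d d0; have ot := wpos t t0.
set q := omega d ^+ 2 * omega t ^- 2.
have q0 : 0 < q by rewrite mulr_gt0 ?invr_gt0 ?exprn_gt0.
have CB := mulr_ge0 C10 B0.
have [td|dt] := leP t d.
  apply: (@le_trans _ _ 1); first by rewrite ge_min lexx.
  have q1 : 1 <= q.
    rewrite /q ler_pdivlMr ?exprn_gt0// mul1r ler_sqr ?nnegrE ?(ltW od) ?(ltW ot)//.
    exact: wmono.
  by nra.
apply: (@le_trans _ _ (C1 * (d / t) ^+ 2)); first by rewrite ge_min lexx orbT.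
suff [h|h] : (d / t) ^+ 2 <= q \/ (d / t) ^+ 2 <= `|B| / hT * q.
- by have := ler_wpM2l C10 h; nra.
- by have := ler_wpM2l C10 h; rewrite mulrA; nra.
have [Td|dT] := leP T d; [left|right].
- have := hmono _ _ Td (ltW dt); rewrite !hE// expr_div_n /q.
  by rewrite ler_pdivrMr ?exprn_gt0// ler_pdivrMr ?exprn_gt0//; rewrite !mulrA; congr (_ <= _); ring.
- have b1 : d ^+ 2 <= `|B| * omega d ^+ 2.
    have := hB d; rewrite d0 dT => /(_ isT); rewrite hE// => hb.
    rewrite -ler_pdivrMr ?exprn_gt0//; apply: le_trans (le_trans hb (ler_norm _)).
    exact: ler_norm.
  have b2 : hT * omega t ^+ 2 <= t ^+ 2.
    have := hmono _ _ (lexx T) Tt; rewrite !hE// -/hT.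
    by rewrite ler_pdivlMr ?exprn_gt0.
  rewrite expr_div_n ler_pdivrMr ?exprn_gt0//.
  have b3 : 0 <= `|B| / hT * q by rewrite mulr_ge0// ltW.
  apply: (le_trans b1); apply: (le_trans _ (ler_wpM2l b3 b2)).
  rewrite /q; have hn := lt0r_neq0 h0; have on : omega t != 0 by rewrite lt0r_neq0.
  have -> : `|B| / hT * (omega d ^+ 2 / omega t ^+ 2) * (hT * omega t ^+ 2) = `|B| * omega d ^+ 2.
    by field; rewrite hn on.
  by [].
Qed.

Lemma powR_ge1 m y : 0 <= m -> 1 <= y -> 1 <= y `^ m.
Proof.
move=> m0 y1; have y0 : 0 <= y by apply: le_trans y1.
by have := @ge0_ler_powR R m m0 1 y; rewrite powR1; apply; rewrite ?nnegrE.
Qed.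

Lemma shift_exponent alpha c N : 0 < alpha ->
  c * alpha ^+ (2 * N) = c * alpha ^- 4 * alpha ^+ (2 * N.+2).
Proof.
move=> a0; have an : alpha ^+ 4 != 0 by rewrite lt0r_neq0// exprn_gt0.
rewrite (_ : (2 * N.+2)%N = (4 + 2 * N)%N); last by rewrite !mulnS addnA.
by rewrite exprD; move: (alpha ^+ 4) an => q qn; field.
Qed.

Lemma min_le_powR m y : 0 < m -> m <= 1 -> 0 <= y -> Num.min 1 y <= y `^ m.
Proof.
move=> m0 m1 y0; have [y1|y1] := leP 1 y.
  by apply: powR_ge1 => //; exact: ltW.
have [->|yn0] := eqVneq y 0; first exact: powR_ge0.
have yp : 0 < y by rewrite lt_neqAle eq_sym yn0.
by rewrite -[leLHS]powRr1//; apply: ger_powR => //; rewrite yp ltW.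
Qed.

(** By min (1, y) <= y^m for every m in ]0, 1]. *)
Lemma sobolev_rate alpha c s : 0 < alpha < 1 -> 0 <= c -> 0 < s ->
  exists2 C, 0 < C & forall N x, 0 <= x ->
    Num.min 1 (c * alpha ^+ (2 * N) * x ^+ 2) <=
    C * alpha `^ (2 * Num.min s 1 * N.+2%:R) * (1 + x ^+ 2) `^ s.
Proof.
move=> /andP[a0 a1] c0 s0; set m := Num.min s 1.
have m0 : 0 < m by rewrite /m lt_min s0 ltr01.
have m1 : m <= 1 by rewrite /m ge_min lexx orbT.
have ms : m <= s by rewrite /m ge_min lexx.
pose c' := c * alpha ^- 4; have c'0 : 0 <= c' by rewrite mulr_ge0// invr_ge0 exprn_ge0// ltW.
exists (c' `^ m + 1) => [|N x x0]; first by have := powR_ge0 c' m; lra.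
have x20 := sqr_ge0 x.
have y0 : 0 <= c' * alpha ^+ (2 * N.+2) * (1 + x ^+ 2).
  by apply: mulr_ge0; [rewrite mulr_ge0// exprn_ge0// ltW|lra].
have E : c * alpha ^+ (2 * N) = c' * alpha ^+ (2 * N.+2).
  exact: shift_exponent.
apply: (@le_trans _ _ ((c' * alpha ^+ (2 * N.+2) * (1 + x ^+ 2)) `^ m)).
  apply: le_trans (min_le_powR m0 m1 y0); rewrite le_min ge_min lexx/= ge_min E.
  apply/orP; right; apply: ler_wpM2l; last by lra.
  by rewrite mulr_ge0// exprn_ge0// ltW.
have A0 : 0 <= alpha ^+ (2 * N.+2) by rewrite exprn_ge0// ltW.
have x1 : 0 <= 1 + x ^+ 2 by lra.
rewrite (powRM m (mulr_ge0 c'0 A0) x1) (powRM m c'0 A0).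
have -> : (alpha ^+ (2 * N.+2)) `^ m = alpha `^ (2 * m * N.+2%:R).
  by rewrite -powR_mulrn ?ltW// -powRrM natrM; congr (_ `^ _); ring.
apply: ler_pM; rewrite ?mulr_ge0 ?powR_ge0//.
  by rewrite ler_wpM2r ?powR_ge0//; lra.
by apply: ler_powR => //; lra.
Qed.

(** The inequality 1 + u <= expR u at u = x / k, to the power k. *)
Lemma expRN_le_powR k x : 0 < k -> 0 < x -> expR (- x) <= (k / x) `^ k.
Proof.
move=> k0 x0; have kn := lt0r_neq0 k0; have -> : - x = - (x / k) * k by field.
rewrite expRM; apply: ge0_ler_powR; rewrite ?nnegrE ?expR_ge0 ?(ltW k0) ?divr_ge0 ?(ltW k0) ?(ltW x0)//.
rewrite expRN -[leRHS]invrK lef_pV2 ?posrE ?expR_gt0 ?invr_gt0 ?divr_gt0//.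
rewrite invf_div; have := expR_ge1Dx (x / k); lra.
Qed.

Lemma expR_natX x N : expR (x * N%:R) = expR x ^+ N.
Proof. by rewrite expRM powR_mulrn// expR_ge0. Qed.

(** Let alpha = expR (- b). Where 2 ln (e + x) >= b n the weight alone suffices;
    below, the left side is at most a multiple of expR (- b n), which decays
    faster than every power of n. *)
Lemma log_sobolev_rate alpha c s : 0 < alpha < 1 -> 0 <= c -> 0 < s ->
  exists2 C, 0 < C & forall N x, 0 <= x ->
    Num.min 1 (c * alpha ^+ (2 * N) * x ^+ 2) <=
    C * N.+2%:R `^ (- (2 * s)) * (ln (expR 1 + x) `^ s) ^+ 2.
Proof.
move=> /andP[a0 a1] c0 s0; pose k := 2 * s; have k0 : 0 < k by rewrite /k; lra.
pose b := - ln alpha; have b0 : 0 < b by rewrite oppr_gt0 ln_lt0// a0.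
have aE : alpha = expR (- b) by rewrite opprK lnK// posrE.
pose c' := c * alpha ^- 4; have c'0 : 0 <= c' by rewrite mulr_ge0// invr_ge0 exprn_ge0// ltW.
have p1 : 0 < (2 / b) `^ k by rewrite powR_gt0// divr_gt0.
have p2 : 0 <= c' * (k / b) `^ k by rewrite mulr_ge0// powR_ge0.
exists ((2 / b) `^ k + c' * (k / b) `^ k) => [|N x x0]; first by lra.
pose L := ln (expR 1 + x).
have e1 : (1 : R) <= expR 1 by have := expR_ge1Dx (1 : R); lra.
have eL : expR L = expR 1 + x by rewrite lnK// posrE; lra.
have L1 : 1 <= L by rewrite -ler_expR eL; lra.
have -> : (ln (expR 1 + x) `^ s) ^+ 2 = L `^ k.
  by rewrite -powR_mulrn ?powR_ge0// -powRrM mulrC.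
pose n : R := N.+2%:R; have n0 : 0 < n by rewrite ltr0n.
have nk0 : 0 < n `^ k by rewrite powR_gt0.
have Lk1 : 1 <= L `^ k.
  by apply: powR_ge1 => //; exact: ltW.
rewrite -/n -/k powRN [leRHS]mulrAC ler_pdivlMr//.
have E : c * alpha ^+ (2 * N) = c' * alpha ^+ (2 * N.+2).
  exact: shift_exponent.
have [nL|Ln] := leP n (2 / b * L).
  apply: (@le_trans _ _ (n `^ k)); first by rewrite ler_piMl ?(ltW nk0)// ge_min lexx.
  apply: (@le_trans _ _ ((2 / b * L) `^ k)).
    by rewrite ge0_ler_powR ?nnegrE ?(ltW k0) ?(ltW n0)// (le_trans _ nL)// ltW.
  have q0 : 0 <= 2 / b by rewrite divr_ge0// ltW.
  have L0 : 0 <= L by apply: le_trans L1.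
  rewrite (powRM k q0 L0).
  by rewrite ler_wpM2r ?powR_ge0//; lra.
apply: (@le_trans _ _ (c' * expR (- (b * n)) * n `^ k)).
  rewrite ler_wpM2r ?(ltW nk0)// ge_min E; apply/orP; right.
  rewrite -mulrA ler_wpM2l// aE -expR_natX natrM -/n.
  have xL : x ^+ 2 <= expR (2 * L).
    rewrite [2 * L]mulrC expR_natX eL ler_sqr ?nnegrE; lra.
  apply: (le_trans (ler_wpM2l _ xL)); first exact: expR_ge0.
  rewrite -expRD ler_expR; move: Ln; rewrite mulrAC ltr_pdivrMr//; nra.
have bn : 0 < b * n by rewrite mulr_gt0.
have h := expRN_le_powR k0 bn; rewrite -mulrA.
have h2 : expR (- (b * n)) * n `^ k <= (k / b) `^ k.
  apply: (le_trans (ler_wpM2r (ltW nk0) h)).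
  have kbn : 0 <= k / (b * n) by rewrite divr_ge0// ltW.
  rewrite -(powRM k kbn (ltW n0)).
  have -> // : k / (b * n) * n = k / b.
  by move: (lt0r_neq0 b0) (lt0r_neq0 n0); clearbody b n => bn0 nn0; field; rewrite bn0 nn0.
have h3 := ler_wpM2l c'0 h2.
apply: (le_trans h3); nra.
Qed.

End rates.

(** * Decay of the scattering energy *)

Section frequency_bound.
Variables (R : realType) (n : nat).
Local Notation V := 'cV[R]_n.
Local Notation mu := (leb R n).
Variable Psi : set (V -> R[i]).
Hypothesis Psi_L12 : forall g, Psi g -> in_L12 g.
Hypothesis Psi_le1 :
  \forall xi \ae mu, (\esum_(g in Psi) (normc (fourier g xi) ^+ 2)%:E <= 1)%E.
Variables (r0 alpha beta : R).
Hypothesis r0_gt0 : 0 < r0.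
Hypothesis alpha_ge0 : 0 <= alpha.
Hypothesis Psi_center : forall g, Psi g -> exists nu, forall xi, fourier g xi != 0 ->
  r0 <= norm2 xi /\ norm2 (xi - nu) <= alpha * norm2 xi.

Lemma le_damping N (r s : R) : 0 <= r -> r <= s -> damping r0 alpha N r <= damping r0 alpha N s.
Proof.
move=> r_0 rs; rewrite /damping le_min !ge_min lexx/=; apply/orP; right.
have s0 : 0 <= s := le_trans r_0 rs.
apply: ler_wpM2l; last by rewrite ler_sqr ?nnegrE.
by rewrite mulr_ge0 ?exprn_ge0// invr_ge0 sqr_ge0.
Qed.

Lemma measurable_damping N : measurable_fun setT (fun xi : V => damping r0 alpha N (beta * norm2 xi)).
Proof.
apply: measurable_minr => //; apply: measurable_funM => //.
apply: measurable_funX; apply: measurable_funM => //.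
by have := @measurable_norm2 R n 0; under eq_fun do rewrite subr0.
Qed.

(** On the band of a filter the damping is at most that of its own frequencies,
    so it moves under the integral, where the squares of the filters sum up to
    at most 1. *)
Lemma energy_frequency_bound N f F : is_fourier_L2 f F ->
  (forall g, Psi g -> exists nu r, forall xi, fourier g xi != 0 ->
    norm2 (xi - nu) <= r /\ r <= beta * norm2 xi) ->
  (energy_remainder Psi N.+2 f <=
   \int[mu]_xi (damping r0 alpha N (beta * norm2 xi) * normc (F xi) ^+ 2)%:E)%E.
Proof.
move=> fF band; have [f2 F2 _] := fF.
have /choice[rad radP] : forall g, exists r, Psi g -> exists nu, forall xi, fourier g xi != 0 ->
    norm2 (xi - nu) <= r /\ r <= beta * norm2 xi.
  move=> g; have [Pg|nPg] := pselect (Psi g); last by exists 0 => /nPg.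
  by have [nu [r h]] := band g Pg; exists r => _; exists nu.
have mF := measurable_normc2 F2.1; have mD := measurable_damping N.
apply: le_trans (energy_remainder_decay Psi_L12 Psi_le1 r0_gt0 alpha_ge0 Psi_center N (rad := rad) f2 _) _.
  by move=> g /radP[nu h]; exists nu => xi /h[].
apply: le_trans (weighted_sum_le Psi_L12 Psi_le1 (w := fun xi => damping r0 alpha N (beta * norm2 xi) * normc (F xi) ^+ 2) _ _); last 2 first.
- exact: measurable_funM.
- by move=> xi; rewrite mulr_ge0 ?sqr_ge0// damping_ge0.
apply: le_esum => g Pg; rewrite (sqnorm_convolution_fourier Psi_L12 Psi_le1 fF Pg).
have mg := cmeas_fourier_filter Psi_L12 Pg.
have mFg : cmeas (fun xi => F xi * fourier g xi) by apply: cmeasM => //; exact: F2.1.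
have [nu h] := radP g Pg.
rewrite -ge0_integralZl ?lee_fin ?damping_ge0//; last 2 first.
- exact: measurable_normc2E.
- by move=> xi _; rewrite lee_fin sqr_ge0.
apply: ge0_le_integral => //.
- by move=> xi _; rewrite mule_ge0 ?lee_fin ?sqr_ge0 ?damping_ge0.
- by apply: measurable_funeM; exact: measurable_normc2E.
- apply/measurable_EFinP; apply: measurable_funM; first exact: measurable_funM.
  exact: measurable_normc2.
- move=> xi _; rewrite -EFinM lee_fin normcM exprMn mulrA.
  have [->|/h[h1 h2]] := eqVneq (fourier g xi) 0; first by rewrite normc_real normr0 expr0n !mulr0.
  apply: ler_wpM2r; first exact: sqr_ge0.
  apply: ler_wpM2r; first exact: sqr_ge0.
  by apply: le_damping => //; apply: le_trans h1; exact: norm2_ge0.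
Qed.

Lemma energy_rate (E : nat -> R) (v : V -> R) f F : is_fourier_L2 f F ->
  (forall g, Psi g -> exists nu r, forall xi, fourier g xi != 0 ->
    norm2 (xi - nu) <= r /\ r <= beta * norm2 xi) ->
  in_L2 (fun xi => (v xi)%:C * F xi) -> (forall N, 0 <= E N) ->
  (exists2 C, 0 < C & forall N xi, damping r0 alpha N (beta * norm2 xi) <= C * E N.+2 * v xi ^+ 2) ->
  is_bigO (fun N => energy_remainder Psi N f) E.
Proof.
move=> fF band vF E0 [C C0 CP]; have [f2 F2 _] := fF.
pose s := fine (sqnorm (fun xi => (v xi)%:C * F xi)).
have s0 : 0 <= s by apply: fine_ge0; exact: sqnorm_ge0.
exists (C * (s + 1)), 2%N; split => //; first by rewrite mulr_gt0//; lra.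
case=> [//|[//|N]] _.
apply: le_trans (energy_frequency_bound N fF band) _.
apply: (@le_trans _ _ ((C * E N.+2)%:E * sqnorm (fun xi => (v xi)%:C * F xi)%R)%E).
  have CE : 0 <= C * E N.+2 by rewrite mulr_ge0// ltW.
  rewrite -ge0_integralZl ?lee_fin//; last 2 first.
  - by apply: measurable_normc2E; exact: vF.1.
  - by move=> xi _; rewrite lee_fin sqr_ge0.
  apply: ge0_le_integral => //.
  - by move=> xi _; rewrite lee_fin mulr_ge0 ?sqr_ge0 ?damping_ge0.
  - apply/measurable_EFinP; apply: measurable_funM; first exact: measurable_damping.
    by apply: measurable_normc2; exact: F2.1.
  - by apply: measurable_funeM; apply: measurable_normc2E; exact: vF.1.
  - move=> xi _; rewrite -EFinM lee_fin normcM exprMn normc_real real_normK ?num_real// [leRHS]mulrA.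
    by apply: ler_wpM2r; [exact: sqr_ge0|exact: CP].
rewrite -(fineK (in_L2_fin vF)) -/s -EFinM lee_fin; have := E0 N.+2.
by move: (E _) => e e0; have := mulr_ge0 (ltW C0) e0; nra.
Qed.

End frequency_bound.

Section decay_space.
Variables (R : realType) (n : nat).
Local Notation V := 'cV[R]_n.
Local Notation mu := (leb R n).
Variable Psi : set (V -> R[i]).
Hypothesis Psi_L12 : forall g, Psi g -> in_L12 g.
Hypothesis Psi_le1 :
  \forall xi \ae mu, (\esum_(g in Psi) (normc (fourier g xi) ^+ 2)%:E <= 1)%E.
Variables (r0 alpha : R).
Hypothesis r0_gt0 : 0 < r0.
Hypothesis alpha01 : 0 < alpha < 1.
Hypothesis Psi_center : forall g, Psi g -> exists nu, forall xi, fourier g xi != 0 ->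
  r0 <= norm2 xi /\ norm2 (xi - nu) <= alpha * norm2 xi.
Hypothesis Psi_bounded : forall g, Psi g -> exists nu r, forall xi, fourier g xi != 0 ->
  norm2 (xi - nu) <= r.

(** [energy_remainder_decay] with twice the band radii, and [weight_comparison]
    at t = alpha ^- N. *)
Theorem decay_space_rate omega f : weakly_dominated_weight 2 omega ->
  in_decay_space omega Psi f ->
  is_bigO (fun N => energy_remainder Psi N f) (fun N => omega (alpha ^- N) ^- 2).
Proof.
move=> wd [f2 S_fin]; have /andP[a0 a1] := alpha01.
have [wpos _ _] := wd.
set S := (\esum_(g in Psi) _)%E in S_fin.
have S0 : (0 <= S)%E.
  by apply: esum_ge0 => g _; rewrite mule_ge0 ?sqnorm_ge0// lee_fin sqr_ge0.
have [T T0 /(_ (4 * r0 ^- 2 * alpha ^- 4))[|C C0 CP]] := weight_comparison wd.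
  by rewrite !mulr_ge0 ?invr_ge0 ?exprn_ge0// ltW.
have [N0 N0P] := eventually_le_invX T alpha01.
pose s := fine S; have s0 : 0 <= s by exact: fine_ge0.
have sE : (s%:E = S)%E by rewrite fineK// ge0_fin_numE.
exists (C * (s + 1)), N0.+2; split => //; first by rewrite mulr_gt0//; lra.
case=> [//|[//|N]] hN.
pose w : R := omega (alpha ^- N.+2) ^- 2.
have t0 : 0 < alpha ^- N.+2 by rewrite invr_gt0 exprn_gt0.
have w0 : 0 <= w by rewrite invr_ge0 sqr_ge0.
apply: le_trans (energy_remainder_decay Psi_L12 Psi_le1 r0_gt0 (ltW a0) Psi_center N
  (rad := fun g => 2 * band_radius g) f2 _) _.
  by move=> g /Psi_bounded[nu [r h]]; have [] := band_radius_center h.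
apply: (@le_trans _ _ ((C * w)%:E * S)%E); last first.
  by rewrite -sE -EFinM lee_fin -/w; have := mulr_ge0 (ltW C0) w0; nra.
have Cw : 0 <= C * w by rewrite mulr_ge0// ltW.
apply: le_trans (esum_mul_le Cw _); last first.
  by move=> g _; rewrite mule_ge0 ?sqnorm_ge0// lee_fin sqr_ge0.
apply: le_esum => g Pg; rewrite muleA -EFinM; apply: lee_wpmul2r; first exact: sqnorm_ge0.
have [nu [r h]] := Psi_bounded Pg; have [d0 _] := band_radius_center h.
rewrite lee_fin; have [dz|dn] := eqVneq (band_radius g) 0.
  (* A band of radius 0 is damped completely, whatever omega does at 0. *)
  rewrite /damping dz mulr0 expr0n/= mulr0; apply: (@le_trans _ _ 0).
    by rewrite ge_min lexx orbT.
  by rewrite mulr_ge0// sqr_ge0.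
have dpos : 0 < band_radius g by rewrite lt_neqAle eq_sym dn.
have Tt : T <= alpha ^- N.+2 by apply: N0P; apply: leq_trans hN; rewrite leqW// leqW.
apply: le_trans (le_trans _ (CP _ _ dpos Tt)) _.
  rewrite /damping shift_exponent//; have -> // : r0 ^- 2 * alpha ^- 4 * alpha ^+ (2 * N.+2) * (2 * band_radius g) ^+ 2 =
      4 / r0 ^+ 2 / alpha ^+ 4 * (band_radius g / alpha ^- N.+2) ^+ 2.
  rewrite mulnC exprM; move: (alpha ^+ N.+2) (band_radius g) => A b.
  by rewrite expr_div_n exprVn invrK; field; rewrite !lt0r_neq0.
by rewrite -/w [omega _ ^+ 2 * w]mulrC mulrA.
Qed.

End decay_space.

Theorem corollary4p7 (R : realType) (d : nat) (hd : (0 < d)%N)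
    (a : R) (ha : 1 < a)
    (G : set 'M[R]_d) (hG : finite_orthogonal_subgroup G)
    (hGopp : G (- 1%:M)) (J : int)
    (psi phi : 'cV[R]_d -> R[i]) (hadm : admissible a G psi phi)
    (Psi : set ('cV[R]_d -> R[i]))
    (hPsi : same_filters Psi (Wav psi a G J))
    (hinf : countably_infinite (low_pass phi a J |` Psi))
    (hLP : Littlewood_Paley (low_pass phi a J) Psi)
    (Mpsi : 'M[R]_d) (hMpsi : orthogonal_group Mpsi)
    (rho : R) (hrho : 0 <= rho < 1) (kappa : nat) (hkappa : (2 <= kappa)%N)
    (hsupp : supp (fourier psi) `<=`
       rotated_cone Mpsi rho `&` shell a^-1 (a ^+ kappa.-1)) :
  let alpha := Num.sqrt
    (1 - 4 * a ^+ kappa / (1 + a ^+ kappa) ^+ 2 * (1 - rho) ^+ 2) in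
  [/\ 0 < alpha < 1,
      forall omega : R -> R, weakly_dominated_weight 2 omega ->
        forall f, in_decay_space omega Psi f ->
          is_bigO (fun N => energy_remainder Psi N f)
                  (fun N => omega (alpha ^- N) ^- 2),
      forall (f : 'cV[R]_d -> R[i]) (s : R), 0 < s -> in_Sobolev s f ->
        is_bigO (fun N => energy_remainder Psi N f)
                (fun N => alpha `^ (2 * Num.min s 1 * N%:R)) &
      forall (f : 'cV[R]_d -> R[i]) (s : R), 0 < s -> in_log_Sobolev s f ->
        is_bigO (fun N => energy_remainder Psi N f)
                (fun N => N%:R `^ (- (2 * s)))].
Proof.
move=> alpha.
have a0 : 0 < a by apply: lt_trans ha.
have kappa_gt0 : (0 < kappa)%N by apply: leq_trans hkappa.
have K1 : 1 < a ^+ kappa by rewrite exprn_egt1// -lt0n.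
have alpha01 : 0 < alpha < 1 := contraction_rate_bounds K1 hrho.
have [al0 al1] := andP alpha01.
have [psi12 _ _] := hadm; have [_ GO _ _ _] := hG; have [Psi_in _ _] := hPsi.
have Psi12 g : Psi g -> in_L12 g by move=> /Psi_in[].
have Psi1 := Littlewood_Paley_le1 hLP.
have r0 : 0 < a ^ (- J) by rewrite exprz_gt0.
have supp_g := filter_support hd ha GO psi12 hPsi hMpsi hrho kappa_gt0 hsupp.
have center := filter_center hd ha GO psi12 hPsi hMpsi hrho kappa_gt0 hsupp.
have bounded g : Psi g -> exists nu r, forall xi, fourier g xi != 0 -> norm2 (xi - nu) <= r.
  by move=> /supp_g[nu [r h]]; exists nu, r => xi /h[].
have band g : Psi g -> exists nu r, forall xi, fourier g xi != 0 ->
    norm2 (xi - nu) <= r /\ r <= alpha * a ^+ kappa * norm2 xi.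
  by move=> /supp_g[nu [r h]]; exists nu, r => xi /h[].
pose c := (a ^ (- J)) ^- 2 * (alpha * a ^+ kappa) ^+ 2.
have c0 : 0 <= c by rewrite mulr_ge0 ?sqr_ge0// invr_ge0 sqr_ge0.
have dampE N (xi : 'cV[R]_d) : damping (a ^ (- J)) alpha N (alpha * a ^+ kappa * norm2 xi) =
    Num.min 1 (c * alpha ^+ (2 * N) * norm2 xi ^+ 2).
  rewrite /damping /c; congr (Num.min _ _).
  by move: ((a ^ (- J)) ^- 2) (alpha ^+ (2 * N)) (alpha * a ^+ kappa) (norm2 xi) => x y z t; ring.
split=> //.
- by move=> omega wd f; apply: (decay_space_rate Psi12 Psi1 r0 alpha01 center bounded).
- move=> f s s0 [F [fF vF]].
  apply: (energy_rate Psi12 Psi1 r0 (ltW al0) center fF band vF) => [N|]; first exact: powR_ge0.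
  have [C C0 CP] := sobolev_rate alpha01 c0 s0; exists C => // N xi.
  rewrite dampE; apply: le_trans (CP N _ (norm2_ge0 xi)) _.
  have -> // : ((1 + norm2 xi ^+ 2) `^ (s / 2)) ^+ 2 = (1 + norm2 xi ^+ 2) `^ s.
  by rewrite -powR_mulrn ?powR_ge0// -powRrM divfK// pnatr_eq0.
- move=> f s s0 [F [fF vF]].
  apply: (energy_rate Psi12 Psi1 r0 (ltW al0) center fF band vF) => [N|]; first exact: powR_ge0.
  have [C C0 CP] := log_sobolev_rate alpha01 c0 s0; exists C => // N xi.
  by rewrite dampE; exact: (CP N _ (norm2_ge0 xi)).
Qed.
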